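(* Let $K$ be a field with $\frac16\in K$. Let $H\in K[x]^n$ be cubic homogeneous such that $\mathcal{J}H$ is nilpotent. (i) If $\operatorname{rk}\mathcal{J}H=1$, then there exists a $T\in\operatorname{GL}_n(K)$ such that for $\tilde H:=T^{-1}H(Tx)$, $$\tilde H_1\in K[x_2,x_3,x_4,\dots,x_n],\qquad \tilde H_2=\tilde H_3=\tilde H_4=\cdots=\tilde H_n=0.$$ (ii) If $\operatorname{rk}\mathcal{J}H=2$ and $\mathcal{J}H$ is not similar over $K$ to a triangular matrix, then there exists a $T\in\operatorname{GL}_n(K)$ such that for $\tilde H:=T^{-1}H(Tx)$, $$\tilde H_1-(x_1x_3x_4-x_2x_4^2)\in K[x_3,x_4,\dots,x_n],$$ $$\tilde H_2-(x_1x_3^2-x_2x_3x_4)\in K[x_3,x_4,\dots,x_n],$$ $$\tilde H_3=\tilde H_4=\cdots=\tilde H_n=0.$$ Furthermore, $x+H$ is invertible if $\operatorname{rk}\mathcal{J}H\le 2$. Moreover, $x+H$ is even tame if either $\operatorname{rk}\mathcal{J}H=1$, or $\operatorname{rk}\mathcal{J}H=2$ and $n\ge 5$.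
   Context: $n$ is a positive integer and $x=(x_1,\dots,x_n)$ is an $n$-tuple of variables (a column vector in matrix products). $\mathcal{J}H=(\partial H_i/\partial x_j)_{i,j}$ is the Jacobian matrix with respect to $x$, and $\operatorname{rk}$ is the rank over $K(x)$. $H(Tx)$ denotes substitution of $Tx$ for $x$. Cubic homogeneous means that every nonzero component is homogeneous of degree $3$. $\frac16\in K$ means that the characteristic of $K$ is neither $2$ nor $3$. A matrix $M$ over $K(x)$ is similar over $K$ to $\tilde M$ if $\tilde M=T^{-1}MT$ for some $T\in\operatorname{GL}_n(K)$. A polynomial map $F\in K[x]^n$ is invertible if it has a polynomial inverse over $K$; it is tame if it is a composition of invertible affine maps and elementary maps $(x_1,\dots,x_{i-1},x_i+p,x_{i+1},\dots,x_n)$ with $p\in K[x]$ not involving $x_i$. The conclusion of (ii) involves $x_3,x_4$, so it entails $n\ge4$. *)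

(* Defs.v *)
From HB Require Import structures.
From mathcomp Require Import all_boot all_order all_algebra.
From mathcomp Require Import mpoly.

Set Implicit Arguments.
Unset Strict Implicit.
Unset Printing Implicit Defensive.

Import GRing.Theory.
Local Open Scope ring_scope.

Section PolynomialMaps.

Variables (K : fieldType) (n : nat).

(* A polynomial map K^n -> K^n is the column vector of its components. *)
Definition polymap := 'cV[{mpoly K[n]}]_n.

Definition vars : polymap := \col_i 'X_i.

(* pcomp F G is F(G), i.e. the substitution of G for x in F. *)
Definition pcomp (F G : polymap) : polymap :=
  map_mx (comp_mpoly [tuple G i 0 | i < n]) F.

Definition constmx (m p : nat) (A : 'M[K]_(m, p)) : 'M[{mpoly K[n]}]_(m, p) :=
  map_mx (@mpolyC n K) A.

Definition jacobian (H : polymap) : 'M[{mpoly K[n]}]_n :=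
  \matrix_(i, j) (H i 0)^`M(j).

Definition ratmx (M : 'M[{mpoly K[n]}]_n) : 'M[{fraction {mpoly K[n]}}]_n :=
  map_mx (@tofrac {mpoly K[n]}) M.

Definition rkJ (H : polymap) : nat := \rank (ratmx (jacobian H)).

(* 0 is d.-homog for every d, so zero components are allowed. *)
Definition cubic_homogeneous (H : polymap) : Prop :=
  forall i, H i 0 \is 3.-homog.

Definition nilpotent_mx (M : 'M[{mpoly K[n]}]_n) : Prop :=
  exists k : nat, M ^+ k = 0.

Definition triangular (M : 'M[{fraction {mpoly K[n]}}]_n) : bool :=
  is_trig_mx M || is_trig_mx M^T.

(* The conjugating matrix has entries in K, not in K(x). *)
Definition similar_over_base (M M' : 'M[{fraction {mpoly K[n]}}]_n) : Prop :=
  exists2 T : 'M[K]_n, T \in unitmx &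
    M' = ratmx (constmx (invmx T)) *m M *m ratmx (constmx T).

Definition lin_conj (T : 'M[K]_n) (H : polymap) : polymap :=
  constmx (invmx T) *m pcomp H (constmx T *m vars).

(* p lies in the subring of polynomials in the variables x_j with S j. *)
Definition in_vars (S : pred 'I_n) (p : {mpoly K[n]}) : Prop :=
  forall m, m \in msupp p -> forall j, ~~ S j -> m j = 0%N.

Definition invertible_map (F : polymap) : Prop :=
  exists G : polymap, pcomp F G = vars /\ pcomp G F = vars.

Definition affine_map (A : 'M[K]_n) (b : 'cV[K]_n) : polymap :=
  constmx A *m vars + constmx b.

Definition elementary_map (i : 'I_n) (p : {mpoly K[n]}) : polymap :=
  \col_j ('X_j + (if j == i then p else 0)).

Inductive tame : polymap -> Prop :=
| tame_affine (A : 'M[K]_n) (b : 'cV[K]_n) :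
    A \in unitmx -> tame (affine_map A b)
| tame_elementary (i : 'I_n) (p : {mpoly K[n]}) :
    in_vars [pred j | j != i] p -> tame (elementary_map i p)
| tame_comp (F G : polymap) : tame F -> tame G -> tame (pcomp F G).

End PolynomialMaps.

Arguments vars {K n}.

(* Main.v *)
(* Rank one: the 2 x 2 minors of the Jacobian, combined with Euler's identity, say
   that the components of H are pairwise Wronskian-dependent, hence proportional,
   H = h c with c constant.  Then tr JH = 0 reads D_c h = 0, and T maps the first
   basis vector to c.

   Rank two: let V be the span of the components of H, whose elements have
   vanishing 3 x 3 Jacobian minors.  At a point a with rk JH(a) = 2, moved to the
   first basis vector, V contains f1, f2 with gradients 3 dx1 and dx2, and
   comparing powers of x1 in the minors of f1, f2 and any other element of V leaves
   three cases: dim V <= 2; all elements of V depend on x1, x2 only; or all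
   elements of V are z q(l1, x2) with q a binary quadratic form and z, l1, x2
   independent linear forms.  In each case, after a linear change, H has a 2 x 2
   Jacobian block carrying trace and determinant, both zero since JH is nilpotent.
   A vanishing trace makes the two components of the block a Hamiltonian field, and
   a vanishing determinant makes the binary Hessian of its quartic Hamiltonian
   zero.  Thus either a constant vector annihilates the block and JH is
   triangularizable, or the block is that of k m (y x1 + m x2), - k y (y x1 + m x2)
   with y, m independent linear forms not involving x1, x2; the latter is (ii).

   With w = x1 x3 - x2 x4, the map of (ii) is (x1 + x4 w, x2 + x3 w) followed by
   elementary maps; w is invariant, so changing its sign gives the inverse.  A fifth
   variable makes this shear a commutator of tame maps. *)

From HB Require Import structures.
From mathcomp Require Import all_boot all_order all_algebra all_fingroup.
From mathcomp Require Import mpoly ring zify.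
Require Import Defs.

Set Implicit Arguments.
Unset Strict Implicit.
Unset Printing Implicit Defensive.

Import Order.TTheory GRing.Theory.
Local Open Scope ring_scope.

(** The smallest admissible field has five elements, and this bound shapes the estimates. Exponents
    are determined by their images in K only below 5. That is enough for linear, quadratic and cubic
    forms, but the Wronskian that detects rank two has degree 5, and a grid with five values per
    coordinate cannot separate the exponents 0, ..., 5. Its only monomials with an exponent 5 are
    the x_k^5, and these are seen at the basis vectors. Rank and nilpotency are turned at once into
    polynomial identities: vanishing minors, tr JH = 0 and tr JH^2 = 0. Such identities survive
    linear substitution, evaluation at a point and comparison of coefficients. Normalizing gradients
    at one point, rather than the forms themselves, controls the degree in x1: a cubic form whose
    gradient vanishes at the first basis vector has degree at most one in x1, so its minors with f1
    and f2 can be expanded completely. Factorization arguments are replaced by differentiation: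
    relations such as u^2 = v w are solved by derivatives along suitable vectors, and divisibility
    by a variable is tested by setting it to 0. *)

Lemma comp_mpolyM (K : fieldType) (n k : nat) (s : n.-tuple {mpoly K[k]}) :
  {morph comp_mpoly s : p q / p * q}.
Proof. exact: rmorphM. Qed.

(** * Chain rule, homogeneity and Euler's identity *)

Section Generalities.

Variables (K : fieldType) (n : nat).
Implicit Types (p q : {mpoly K[n]}) (i j : 'I_n).

(** Constants, variables, sums and products are what substitutions and derivations respect, so
    identities between these operations need only be checked on generators. *)
Lemma mpoly_alg_ind (P : {mpoly K[n]} -> Prop) :
  (forall c, P c%:MP) -> (forall i, P 'X_i) ->
  (forall p q, P p -> P q -> P (p + q)) ->
  (forall p q, P p -> P q -> P (p * q)) -> forall p, P p.
Proof.
move=> PC PX PD PM; elim/mpolyind; first by rewrite -mpolyC0.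
move=> c m p _ _ Pp; apply: (PD) => //; rewrite -mul_mpolyC; apply: (PM) => //.
rewrite mpolyXE_id; apply: (big_ind P); [by rewrite -mpolyC1|exact: PM|move=> i _].
elim: (m i) => [|k IHk]; first by rewrite expr0 -mpolyC1.
by rewrite exprS; apply: (PM).
Qed.

Lemma comp_mpoly_var (k : nat) (G : 'I_n -> {mpoly K[k]}) i :
  'X_i \mPo [tuple G j | j < n] = G i.
Proof. by rewrite comp_mpolyXU -tnth_nth tnth_mktuple. Qed.

Lemma comp_mpoly_comp (k l : nat) (G : 'I_n -> {mpoly K[k]})
    (s : k.-tuple {mpoly K[l]}) p :
  (p \mPo [tuple G j | j < n]) \mPo s = p \mPo [tuple G j \mPo s | j < n].
Proof.
elim/mpoly_alg_ind: p => [c|i|p q IHp IHq|p q IHp IHq].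
- by rewrite !comp_mpolyC.
- by rewrite !comp_mpoly_var.
- by rewrite !comp_mpolyD IHp IHq.
- by rewrite !comp_mpolyM IHp IHq.
Qed.

Lemma eq_comp_mpoly (k : nat) (G G' : 'I_n -> {mpoly K[k]}) p :
  G =1 G' -> p \mPo [tuple G j | j < n] = p \mPo [tuple G' j | j < n].
Proof.
move=> eqG; elim/mpoly_alg_ind: p => [c|i|p q IHp IHq|p q IHp IHq].
- by rewrite !comp_mpolyC.
- by rewrite !comp_mpoly_var eqG.
- by rewrite !comp_mpolyD IHp IHq.
- by rewrite !comp_mpolyM IHp IHq.
Qed.

Lemma mderivXU i j : ('X_j : {mpoly K[n]})^`M(i) = (i == j)%:R.
Proof.
rewrite mderivX mnm1E eq_sym; case: eqP => [->|_]; last by rewrite scale0r.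
rewrite scale1r (_ : (_ - _)%MM = 0%MM) ?mpolyX0 //.
by apply/mnmP => k; rewrite mnmBE mnm0E subnn.
Qed.

Lemma mderiv_comp (k : nat) (G : 'I_n -> {mpoly K[k]}) p (j : 'I_k) :
  (p \mPo [tuple G i | i < n])^`M(j) =
  \sum_i (p^`M(i) \mPo [tuple G i | i < n]) * (G i)^`M(j).
Proof.
elim/mpoly_alg_ind: p => [c|i|p q IHp IHq|p q IHp IHq].
- rewrite comp_mpolyC mderivC big1 // => i _.
  by rewrite mderivC comp_mpoly0 mul0r.
- rewrite comp_mpoly_var (bigD1 i) //= mderivXU eqxx comp_mpoly1 mul1r.
  rewrite big1 ?addr0 // => l /negPf neq_li.
  by rewrite mderivXU neq_li comp_mpoly0 mul0r.
- rewrite comp_mpolyD mderivD IHp IHq -big_split /=.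
  by apply: eq_bigr => i _; rewrite mderivD comp_mpolyD mulrDl.
- rewrite comp_mpolyM mderivM IHp IHq mulr_suml mulr_sumr -big_split /=.
  apply: eq_bigr => i _; rewrite mderivM comp_mpolyD !comp_mpolyM.
  ring.
Qed.

Lemma dhomog_comp (k d : nat) (G : 'I_n -> {mpoly K[k]}) p :
  (forall i, G i \is 1.-homog) -> p \is d.-homog ->
  p \mPo [tuple G i | i < n] \is d.-homog.
Proof.
move=> G1 /dhomogP p_homog; rewrite comp_mpolyEX big_seq.
apply: rpred_sum => m /p_homog /= <-; apply: dhomogZ.
rewrite comp_mpolyX mdegE; elim/big_rec2: _ => [|i q e _ q_homog].
  exact: dhomog1.
apply: dhomogM => //; rewrite tnth_mktuple -[X in _ \is X.-homog](mul1n (m i)).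
exact: dhomogMn.
Qed.

Lemma mderiv_dhomog d p i : p \is d.+1.-homog -> p^`M(i) \is d.-homog.
Proof.
move=> /dhomogP p_homog; apply/dhomogP => m; rewrite mcoeff_msupp mcoeff_mderiv.
case: (boolP (m + U_(i) \in msupp p)%MM) => [/p_homog|/memN_msupp_eq0 ->].
  by move=> /= e _; apply/eqP; rewrite -eqSS -e mdegD mdeg1 addn1.
by rewrite mul0rn eqxx.
Qed.

(** The operator x_i d/dx_i multiplies a monomial by its exponent of x_i, and these exponents add up
    to d. *)
Lemma euler d p : p \is d.-homog -> \sum_i 'X_i * p^`M(i) = d%:R * p.
Proof.
move=> /dhomogP p_homog; rewrite [in RHS](mpolyE p) mulr_sumr.
under eq_bigr => i _ do rewrite {1}(mpolyE p) raddf_sum mulr_sumr.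
rewrite exchange_big /= big_seq [RHS]big_seq; apply: eq_bigr => m /p_homog /= <-.
rewrite mdegE natr_sum mulr_suml; apply: eq_bigr => i _ /=.
rewrite mderivZ mderivX scalerA -scalerAr.
have [->|mi_neq0] := eqVneq (m i) 0%N; first by rewrite mulr0 scale0r mul0r.
by rewrite -mpolyXD addmC submK ?lep1mP // mulrC -scalerA scaler_nat mulr_natl.
Qed.

End Generalities.

(** * Elimination of a variable *)

Section Elimination.

Variables (K : fieldType) (n : nat).
Implicit Types (p q : {mpoly K[n]}) (i j : 'I_n).

Definition subst_var i (b p : {mpoly K[n]}) : {mpoly K[n]} :=
  p \mPo [tuple if j == i then b else 'X_j | j < n].

HB.instance Definition _ i b := GRing.RMorphism.copy (subst_var i b)
  (comp_mpoly [tuple if j == i then b else 'X_j | j < n]).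

Lemma subst_varC i b c : subst_var i b c%:MP = c%:MP.
Proof. exact: comp_mpolyC. Qed.

Lemma subst_varX i b j : subst_var i b 'X_j = if j == i then b else 'X_j.
Proof. exact: comp_mpoly_var. Qed.

(** Absence of x_i is encoded as a fixed-point equation of a ring morphism, which makes closure
    under the ring operations immediate; [varfreeP] translates it back to exponents. *)
Definition varfree i p : Prop := subst_var i 0 p = p.

Lemma subst_free i b p : varfree i p -> subst_var i b p = p.
Proof.
move=> <-; rewrite /subst_var comp_mpoly_comp; apply: eq_comp_mpoly => j.
by case: ifP => [|neq]; rewrite ?comp_mpoly0 // comp_mpoly_var neq.
Qed.

Lemma free_subst i p : varfree i (subst_var i 0 p).
Proof.
rewrite /varfree /subst_var comp_mpoly_comp; apply: eq_comp_mpoly => j.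
by case: ifP => [|neq]; rewrite ?comp_mpoly0 // comp_mpoly_var neq.
Qed.

Lemma freeC i c : varfree i c%:MP. Proof. exact: subst_varC. Qed.
Lemma free0 i : varfree i 0. Proof. exact: rmorph0. Qed.
Lemma freeX i j : j != i -> varfree i 'X_j.
Proof. by move=> /negPf neq; rewrite /varfree subst_varX neq. Qed.
Lemma freeD i p q : varfree i p -> varfree i q -> varfree i (p + q).
Proof. by rewrite /varfree rmorphD /= => -> ->. Qed.
Lemma freeM i p q : varfree i p -> varfree i q -> varfree i (p * q).
Proof. by rewrite /varfree rmorphM /= => -> ->. Qed.
Lemma freeN i p : varfree i p -> varfree i (- p).
Proof. by rewrite /varfree rmorphN /= => ->. Qed.
Lemma freeE i p k : varfree i p -> varfree i (p ^+ k).
Proof. by rewrite /varfree rmorphXn /= => ->. Qed.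
Lemma free_nat i k : varfree i k%:R.
Proof. exact: rmorph_nat. Qed.

Lemma varfreeP i p : varfree i p <-> forall m, m \in msupp p -> m i = 0%N.
Proof.
split=> [<- m|p_free].
  rewrite /subst_var comp_mpolyEX => /msupp_sum_le /flatten_mapP[m' _].
  move=> /msuppZ_le; rewrite comp_mpolyX (bigD1 i) //= tnth_mktuple eqxx.
  rewrite expr0n; case: eqP => [m'i0|_]; last by rewrite mul0r msupp0.
  rewrite mul1r.
  have -> : \prod_(j < n | j != i)
     tnth [tuple if j == i then 0 else 'X_j | j < n] j ^+ m' j =
     'X_[m'] :> {mpoly K[n]}.
    rewrite [RHS]mpolyXE_id [RHS](bigD1 i) //= m'i0 expr0 mul1r.
    by apply: eq_bigr => j /negPf neq; rewrite tnth_mktuple neq.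
  by rewrite msuppX inE => /eqP ->.
rewrite /varfree /subst_var comp_mpolyEX [RHS]mpolyE big_seq [RHS]big_seq.
apply: eq_bigr => m /p_free mi0; congr (_ *: _).
rewrite comp_mpolyX mpolyXE_id; apply: eq_bigr => j _; rewrite tnth_mktuple.
by case: eqP => // ->; rewrite mi0 !expr0.
Qed.

Lemma mderiv_free i p : varfree i p -> p^`M(i) = 0.
Proof.
move=> /varfreeP p_free; apply/mpolyP => m; rewrite mcoeff_mderiv mcoeff0.
rewrite memN_msupp_eq0 ?mul0rn //; apply/negP => /p_free.
by rewrite mnmDE mnm1E eqxx addn1.
Qed.

Lemma free_mderiv i j p : varfree i p -> varfree i p^`M(j).
Proof.
move=> /varfreeP p_free; apply/varfreeP => m; rewrite mcoeff_msupp mcoeff_mderiv.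
have [/p_free|/memN_msupp_eq0 ->] := boolP ((m + U_(j))%MM \in msupp p).
  by rewrite mnmDE => /eqP; rewrite addn_eq0 => /andP[/eqP].
by rewrite mul0rn eqxx.
Qed.

Lemma dhomog_subst i d b p :
  b \is 1.-homog -> p \is d.-homog -> subst_var i b p \is d.-homog.
Proof.
move=> b1; apply: dhomog_comp => j; case: ifP => // _.
by rewrite dhomogX /= mdeg1.
Qed.

(** Division by x_i with remainder: [g] collects the monomials in which x_i occurs. It is again
    homogeneous, so the division can be repeated, as in [cubic_split]. *)
Lemma split_var i d p : p \is d.+1.-homog ->
  exists2 g, g \is d.-homog & p = subst_var i 0 p + 'X_i * g.
Proof.
move=> /dhomogP p_homog.
exists (\sum_(m <- msupp p | m i != 0%N) p@_m *: 'X_[m - U_(i)]).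
  rewrite big_seq_cond; apply: rpred_sum => m /andP[/p_homog /= mdeg_m mi].
  apply: dhomogZ; rewrite dhomogX /=; apply/eqP/eqP.
  by rewrite -eqSS -mdeg_m -{2}(submK (_ : U_(i) <= m)%MM) ?lep1mP // mdegD mdeg1 addn1.
rewrite /subst_var comp_mpolyEX {1}(mpolyE p) (bigID (fun m : 'X_{1..n} => m i == 0%N)) /=.
rewrite [in RHS](bigID (fun m : 'X_{1..n} => m i == 0%N)) /= -addrA; congr (_ + _).
  apply: eq_bigr => m /eqP mi0; congr (_ *: _).
  rewrite comp_mpolyX mpolyXE_id; apply: eq_bigr => j _; rewrite tnth_mktuple.
  by case: eqP => // ->; rewrite mi0 !expr0.
rewrite [X in _ = X + _]big1 ?add0r => [|m mi].
  rewrite mulr_sumr; apply: eq_bigr => m mi; rewrite -scalerAr -mpolyXD addmC.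
  by rewrite submK // lep1mP.
rewrite comp_mpolyX (bigD1 i) //= tnth_mktuple eqxx expr0n (negPf mi) mul0r.
by rewrite scaler0.
Qed.

Lemma mpolyXU_neq0 i : ('X_i : {mpoly K[n]}) != 0.
Proof. by rewrite -msupp_eq0 msuppX. Qed.

Lemma dhomogXU i : ('X_i : {mpoly K[n]}) \is 1.-homog.
Proof. by rewrite dhomogX /= mdeg1. Qed.

(* The coefficients of a power series in [x_i + b] are determined by its sum. *)
Lemma extract_coef i b (c : seq {mpoly K[n]}) : varfree i b ->
  (forall k, varfree i c`_k) ->
  \sum_(k < size c) c`_k * ('X_i + b) ^+ k = 0 -> forall k, c`_k = 0.
Proof.
move=> b_free; elim: c => [|c0 c IHc] c_free sum0 k; first by rewrite nth_nil.
(* Substituting [- b] for x_i isolates the first coefficient; the remaining factor x_i + b, whose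
   derivative in x_i is 1, is then cancelled. *)
have c00 : c0 = 0.
  move: (congr1 (subst_var i (- b)) sum0); rewrite rmorph0 big_ord_recl /=.
  rewrite expr0 mulr1 rmorphD rmorph_sum /= big1 => [|j _].
    by rewrite addr0 subst_free //; apply: (c_free 0%N).
  rewrite rmorphM rmorphXn rmorphD /= subst_varX eqxx (subst_free _ b_free).
  by rewrite addNr expr0n mulr0.
case: k => [//|k] /=; apply: IHc => [l|]; first exact: (c_free l.+1).
move: sum0; rewrite big_ord_recl /= c00 mul0r add0r.
under eq_bigr => l _ do rewrite exprS mulrCA.
rewrite -mulr_sumr => /eqP; rewrite mulf_eq0 => /orP[/eqP Xb0|/eqP //].
have := congr1 (mderiv i) Xb0.
rewrite mderivD mderivXU eqxx mderiv_free // mderiv0 addr0 => /eqP.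
by rewrite oner_eq0.
Qed.

(** Six coefficients, because the minors to be expanded have degree at most 5 in x_i; shorter
    expansions are padded with zeros. *)
Lemma extract4 i b c0 c1 c2 c3 c4 c5 : varfree i b ->
  varfree i c0 -> varfree i c1 -> varfree i c2 -> varfree i c3 -> varfree i c4 -> varfree i c5 ->
  c0 + c1 * ('X_i + b) + c2 * ('X_i + b) ^+ 2 + c3 * ('X_i + b) ^+ 3
    + c4 * ('X_i + b) ^+ 4 + c5 * ('X_i + b) ^+ 5 = 0 ->
  [/\ c0 = 0, c1 = 0 & c2 = 0] /\ [/\ c3 = 0, c4 = 0 & c5 = 0].
Proof.
move=> fb f0 f1 f2 f3 f4 f5 sum0.
have c_free k : varfree i [:: c0; c1; c2; c3; c4; c5]`_k.
  by do 6![case: k => [//|k] /=]; rewrite nth_nil; apply: free0.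
have c_eq0 := extract_coef fb c_free.
have {}c_eq0 k : [:: c0; c1; c2; c3; c4; c5]`_k = 0.
  apply: c_eq0; rewrite -[RHS]sum0 !big_ord_recl big_ord0 /=.
  ring.
by split; split; [apply: (c_eq0 0%N)|apply: (c_eq0 1%N)|apply: (c_eq0 2%N)
  |apply: (c_eq0 3%N)|apply: (c_eq0 4%N)|apply: (c_eq0 5%N)].
Qed.

End Elimination.

(** * Homogeneous polynomials in characteristic prime to 6 *)

Section Characteristic.

Variables (K : fieldType) (n : nat).
Hypothesis char_K : (6%:R : K) \is a GRing.unit.
Implicit Types (p q f g : {mpoly K[n]}) (i j : 'I_n).

Lemma nat2_neq0 : (2%:R : K) != 0.
Proof. by move: char_K; rewrite unitfE (natrM _ 2 3) mulf_eq0 => /norP[]. Qed.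

Lemma nat3_neq0 : (3%:R : K) != 0.
Proof. by move: char_K; rewrite unitfE (natrM _ 2 3) mulf_eq0 => /norP[]. Qed.

(** The bound is sharp: 2, 3 and 4 are units because 6 is, while 5 vanishes in characteristic 5. *)
Lemma nat_lt5_neq0 k : (0 < k < 5)%N -> (k%:R : K) != 0.
Proof.
case: k => [//|[|[|[|[|//]]]]] _.
- exact: oner_neq0.
- exact: nat2_neq0.
- exact: nat3_neq0.
- by rewrite (natrM _ 2 2) mulf_neq0 ?nat2_neq0.
Qed.

Lemma nat_lt5_inj k l : (k < 5)%N -> (l < 5)%N -> (k%:R : K) = l%:R -> k = l.
Proof.
wlog le_kl: k l / (k <= l)%N => [wlog_le k5 l5 eq_kl|k5 l5 eq_kl].
  case: (leqP k l) => [le|/ltnW le]; first exact: wlog_le.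
  by apply/esym; apply: wlog_le.
apply/eqP; rewrite eqn_leq le_kl /= leqNgt; apply/negP => lt_kl.
have: ((l - k)%:R : K) != 0 by apply: nat_lt5_neq0; lia.
by rewrite natrB // eq_kl subrr eqxx.
Qed.

Lemma mpoly_nat_neq0 k : (k%:R : K) != 0 -> (k%:R : {mpoly K[n]}) != 0.
Proof. by move=> k_neq0; rewrite -mpolyC_nat mpolyC_eq0. Qed.

Lemma dhomog0C p : p \is 0.-homog -> exists c, p = c%:MP.
Proof.
move=> /dhomogP p_homog; exists p@_0; rewrite {1}(mpolyE p).
apply/mpolyP => m; rewrite mcoeffC -mpolyE.
case: eqP => [<-|/eqP m_neq0]; first by rewrite mulr1.
rewrite mulr0 memN_msupp_eq0 //; apply/negP => /p_homog /= /eqP.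
by rewrite mdeg_eq0 (negPf m_neq0).
Qed.

Lemma mderiv_linear p i : p \is 1.-homog -> exists c, p^`M(i) = c%:MP.
Proof. by move=> p1; apply: dhomog0C; apply: mderiv_dhomog. Qed.

(** Differentiation multiplies the coefficient of a monomial by its exponent at i, which is at most
    d and hence nonzero in K unless it is 0. *)
Lemma deriv0_free d p i : (d < 5)%N ->
  p \is d.-homog -> p^`M(i) = 0 -> varfree i p.
Proof.
move=> d_lt5 /dhomogP p_homog dp0; apply/varfreeP => m m_p.
apply/eqP; apply/contraT; rewrite -lt0n => mi_gt0.
move: (congr1 (mcoeff (m - U_(i))%MM) dp0).
rewrite mcoeff_mderiv submK ?lep1mP -?lt0n // mcoeff0 -mulr_natr => /eqP.
have pm_neq0 : p@_m != 0 by rewrite -mcoeff_msupp.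
rewrite mulf_eq0 (negPf pm_neq0) /=; apply/contraLR => _; apply: nat_lt5_neq0.
have: (m i <= mdeg m)%N by rewrite mdegE (bigD1 i) //= leq_addr.
by rewrite mnmBE mnm1E eqxx (p_homog _ m_p); lia.
Qed.

Lemma dhomog_deriv0 d p : (0 < d < 5)%N ->
  p \is d.-homog -> (forall i, p^`M(i) = 0) -> p = 0.
Proof.
move=> /nat_lt5_neq0 d_neq0 /euler; move: (mpoly_nat_neq0 d_neq0) => d_neq0' eul dp0.
move: eul; rewrite big1 => [/esym/eqP|i _]; last by rewrite dp0 mulr0.
by rewrite mulf_eq0 (negPf d_neq0') => /eqP.
Qed.

Lemma dhomog_one_var d p i : (d < 5)%N ->
  p \is d.-homog -> (forall j, j != i -> p^`M(j) = 0) ->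
  exists c, p = c *: 'X_i ^+ d.
Proof.
move=> d_lt5 p_homog dp0; exists p@_(U_(i) *+ d); rewrite mpolyXn.
apply/mpolyP => m; rewrite mcoeffZ mcoeffX.
case: eqP => [<-|m_neq]; first by rewrite mulr1.
rewrite mulr0; apply: memN_msupp_eq0; apply/negP => m_p; apply: m_neq.
have m_j j : j != i -> m j = 0%N.
  move=> neq; apply: (proj1 (varfreeP j p)) => //.
  by apply: (deriv0_free d_lt5 p_homog); apply: dp0.
apply/mnmP => j; rewrite mulmnE mnm1E eq_sym.
have [->|neq] := eqVneq j i; last by rewrite m_j.
rewrite mul1n -(dhomog_mf p_homog m_p) /= mdegE (bigD1 i) //= big1 ?addn0 //.
Qed.

Lemma euler_op_coef k p m : ('X_k * p^`M(k))@_m = (m k)%:R * p@_m.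
Proof.
elim/mpolyind: p => [|c m' p _ _ IHp]; first by rewrite mderiv0 mulr0 mcoeff0 mulr0.
rewrite mderivD mulrDr !mcoeffD mulrDr IHp; congr (_ + _).
rewrite mderivZ mderivX -scalerAr -scalerAr !mcoeffZ.
have [mk0|mk] := eqVneq (m' k) 0%N.
  rewrite mk0 mul0r mulr0 mcoeffX; case: eqP => [<-|_]; first by rewrite mk0 mul0r.
  by rewrite !mulr0.
rewrite -mpolyXD addmC submK ?lep1mP // mcoeffX; case: eqP => [->|_].
  by rewrite mulrCA.
by rewrite !mulr0.
Qed.

(* On leading monomials the operators x_k d/dx_k act by their exponents, and
   exponents below 5 are determined by their images in K. *)
Lemma wronskian_dep d f g : (d < 5)%N -> f \is d.-homog -> g \is d.-homog ->
  f != 0 -> (forall k, f * g^`M(k) = g * f^`M(k)) -> exists c, g = c *: f.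
Proof.
move=> d_lt5 f_homog g_homog f_neq0 wr.
exists (g@_(mlead f) / f@_(mlead f)); set c := _ / _; apply/eqP.
rewrite -subr_eq0; set h := g - _; apply/contraT => h_neq0.
have h_homog : h \is d.-homog by rewrite rpredB // dhomogZ.
have wrh k : f * h^`M(k) = h * f^`M(k).
  by rewrite /h mderivB mderivZ mulrBr mulrBl wr -scalerAl -scalerAr [f * _]mulrC.
have fm_neq0 : f@_(mlead f) != 0 by rewrite mleadc_eq0.
have hm_neq0 : h@_(mlead h) != 0 by rewrite mleadc_eq0.
(* [c] was chosen for this: the leading monomials of [f] and [h] then differ in the exponent of some
   x_k. *)
have hf0 : h@_(mlead f) = 0 by rewrite mcoeffB mcoeffZ divfK // subrr.
have mf_neq : mlead f != mlead h by apply: contraNneq hm_neq0 => <-; rewrite hf0.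
have [k neq_k] : exists k, mlead f k != mlead h k.
  apply/existsP; apply: contraNT mf_neq; rewrite negb_exists => /forallP eq_m.
  by apply/eqP/mnmP => k; apply/eqP; move: (eq_m k); rewrite negbK.
have le_lead q : (mlead ('X_k * q^`M(k)) <= mlead q)%O.
  have [->|q_neq0] := eqVneq ('X_k * q^`M(k)) 0; first by rewrite mlead0 le0x.
  apply: msupp_le_mlead; move: (mlead_supp q_neq0).
  by rewrite !mcoeff_msupp euler_op_coef mulf_eq0 => /norP[].
(* The Wronskian identity for k, multiplied by x_k and compared at the product of the two leading
   monomials, makes their exponents at k equal in K. *)
have : (f * ('X_k * h^`M(k)))@_(mlead f + mlead h)%MM =
       (('X_k * f^`M(k)) * h)@_(mlead f + mlead h)%MM.
  by rewrite mulrCA wrh [h * _]mulrC mulrA.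
rewrite (mleadcMW (lexx _) (le_lead h)) (mleadcMW (le_lead f) (lexx _)).
rewrite !euler_op_coef mulrCA -mulrA => /eqP; rewrite -subr_eq0 -mulrBl mulf_eq0.
rewrite mulf_eq0 (negPf fm_neq0) (negPf hm_neq0) !orbF subr_eq0 => /eqP.
have deg_le q : q \is d.-homog -> q != 0 -> (mlead q k < 5)%N.
  move=> q_homog /mlead_supp /(dhomog_mf q_homog) /= mdeg_q.
  have: (mlead q k <= mdeg (mlead q))%N by rewrite mdegE (bigD1 k) //= leq_addr.
  by rewrite mdeg_q; lia.
move=> /(nat_lt5_inj (deg_le _ h_homog h_neq0) (deg_le _ f_homog f_neq0)) eq_k.
by rewrite eq_k eqxx in neq_k.
Qed.

(* 0, ..., 4 are distinct in K, so inverting a Vandermonde matrix recovers the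
   coefficients of p from its values on the grid {0, ..., 4}^n. *)
Lemma nonvanishing_point p : p != 0 ->
  (forall m, m \in msupp p -> forall i, (m i < 5)%N) ->
  exists a : 'I_n -> K, p.@[a] != 0.
Proof.
move=> p_neq0 p_exp.
suff /existsP[a pa_neq0] :
    [exists a : {ffun 'I_n -> 'I_5}, p.@[fun i => (a i)%:R] != 0].
  by exists (fun i => (a i)%:R).
apply: contraT; rewrite negb_exists => /forallP p_eq0.
pose V := Vandermonde 5 (\row_(c < 5) (c%:R : K)).
have V_unit : V \in unitmx.
  rewrite unitmxE det_Vandermonde unitfE; apply/prodf_neq0 => i _.
  apply/prodf_neq0 => j lt_ij; rewrite !mxE subr_eq0.
  apply/eqP => /(nat_lt5_inj (ltn_ord j) (ltn_ord i)) eq_ij.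
  by rewrite eq_ij ltnn in lt_ij.
pose m := mlead p; pose d i : 'I_5 := inord (m i).
have m_p : m \in msupp p by apply: mlead_supp.
have pm_neq0 : p@_m != 0 by rewrite -mcoeff_msupp.
(* Column [d i] of the inverse matrix is the functional that sends the values of t^e on 0, ..., 4 to
   1 if e = m i and to 0 otherwise; the product of these functionals over all variables reads off
   the coefficient of [m]. *)
have dual e i : (e < 5)%N ->
    \sum_(c < 5) (c%:R ^+ e * invmx V c (d i)) = (e == m i)%:R.
  move=> lt_e; move: (congr1 (fun A : 'M_5 => A (Ordinal lt_e) (d i)) (mulmxV V_unit)).
  rewrite !mxE -val_eqE /= inordK ?p_exp // => <-.
  by apply: eq_bigr => c _; rewrite !mxE.
have : \sum_(a : {ffun 'I_n -> 'I_5})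
    p.@[fun i => (a i)%:R] * \prod_i invmx V (a i) (d i) = p@_m.
  under eq_bigr => a _ do rewrite mevalE mulr_suml.
  rewrite exchange_big /= (bigD1_seq m) ?msupp_uniq //=.
  have sum_m m' : m' \in msupp p ->
      \sum_(a : {ffun 'I_n -> 'I_5}) p@_m' * (\prod_i (a i)%:R ^+ m' i) *
         (\prod_i invmx V (a i) (d i)) = p@_m' * (m' == m)%:R.
    move=> m'_p; under eq_bigr => a _ do rewrite -mulrA -big_split /=.
    rewrite -mulr_sumr; congr (_ * _).
    rewrite -(bigA_distr_bigA (fun i c => (nat_of_ord c)%:R ^+ m' i * invmx V c (d i))).
    under eq_bigr => i _ do rewrite dual ?p_exp //.
    have [->|neq_m] := eqVneq m' m; first by rewrite big1 // => i _; rewrite eqxx.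
    have [i neq_i] : exists i, m' i != m i.
      apply/existsP; apply: contraNT neq_m; rewrite negb_exists => /forallP eq_m.
      by apply/eqP/mnmP => i; apply/eqP; move: (eq_m i); rewrite negbK.
    by rewrite (bigD1 i) //= (negPf neq_i) mul0r.
  rewrite sum_m // eqxx mulr1 big_seq_cond big1 ?addr0 // => m' /andP[m'_p neq].
  by rewrite sum_m // (negPf neq) mulr0.
rewrite big1 => [/esym pm0|a _]; first by rewrite pm0 eqxx in pm_neq0.
by move: (p_eq0 a); rewrite negbK => /eqP ->; rewrite mul0r.
Qed.

End Characteristic.

(** * Spaces of cubic forms with vanishing Jacobian minors *)

Definition det3 (R : comRingType) (a1 a2 a3 b1 b2 b3 c1 c2 c3 : R) : R :=
  a1 * (b2 * c3 - b3 * c2) - a2 * (b1 * c3 - b3 * c1) + a3 * (b1 * c2 - b2 * c1).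

(** The rows are the gradients in x1, x2, xj of T^3 + T A + C, T^2 S + T B + D and T q + E, where T
    = x1, S = x2 and the other letters are free of x1; the suffixes 2 and j mark derivatives. The
    right side is sorted by powers of T. *)
Lemma det3_expand (R : comRingType) (T S A A2 Aj B B2 Bj C2 Cj D2 Dj q q2 qj E2 Ej : R) :
  det3 (3%:R * T ^+ 2 + A) (T * A2 + C2) (T * Aj + Cj)
       (2%:R * T * S + B) (T ^+ 2 + T * B2 + D2) (T * Bj + Dj)
       q (T * q2 + E2) (T * qj + Ej) =
  (A * D2 * Ej - A * Dj * E2 - B * C2 * Ej + C2 * Dj * q + B * Cj * E2 - Cj * D2 * q)
  + (A * B2 * Ej + A * D2 * qj - A * Bj * E2 - A * Dj * q2 - A2 * B * Ej
     + A2 * Dj * q - 2%:R * C2 * Ej * S - B * C2 * qj + Bj * C2 * q + Aj * B * E2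
     - Aj * D2 * q + 2%:R * Cj * E2 * S + B * Cj * q2 - B2 * Cj * q) * T
  + (3%:R * D2 * Ej - 3%:R * Dj * E2 + A * Ej + A * B2 * qj - A * Bj * q2
     - 2%:R * A2 * Ej * S - A2 * B * qj + A2 * Bj * q - 2%:R * C2 * S * qj
     + 2%:R * Aj * E2 * S + Aj * B * q2 - Aj * B2 * q + 2%:R * Cj * S * q2
     - Cj * q) * T ^+ 2
  + (3%:R * B2 * Ej + 3%:R * D2 * qj - 3%:R * Bj * E2 - 3%:R * Dj * q2 + A * qj
     - 2%:R * A2 * S * qj + 2%:R * Aj * S * q2 - Aj * q) * T ^+ 3
  + (3%:R * Ej + 3%:R * B2 * qj - 3%:R * Bj * q2) * T ^+ 4
  + (3%:R * qj) * T ^+ 5.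
Proof. by rewrite /det3; ring. Qed.

Definition mderivE := (mderivD, mderivB, mderivN, mderivM, mderivC, mderivXU).

Section Cubics.

Variables (K : fieldType) (n : nat).
Hypothesis char_K : (6%:R : K) \is a GRing.unit.
Implicit Types (p q f g h : {mpoly K[n]}) (i j k : 'I_n).

Definition jac3 f g h i j k : {mpoly K[n]} :=
  det3 f^`M(i) f^`M(j) f^`M(k) g^`M(i) g^`M(j) g^`M(k) h^`M(i) h^`M(j) h^`M(k).

Definition jac_dep f g h := forall i j k, jac3 f g h i j k = 0.

Lemma extract_var i (c0 c1 c2 c3 c4 c5 : {mpoly K[n]}) :
  varfree i c0 -> varfree i c1 -> varfree i c2 ->
  varfree i c3 -> varfree i c4 -> varfree i c5 ->
  c0 + c1 * 'X_i + c2 * 'X_i ^+ 2 + c3 * 'X_i ^+ 3 + c4 * 'X_i ^+ 4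
    + c5 * 'X_i ^+ 5 = 0 ->
  [/\ c0 = 0, c1 = 0 & c2 = 0] /\ [/\ c3 = 0, c4 = 0 & c5 = 0].
Proof.
move=> f0 f1 f2 f3 f4 f5 sum0.
by move: (extract4 (free0 K i) f0 f1 f2 f3 f4 f5) => /=; rewrite addr0; apply.
Qed.

Lemma nat2R_neq0 : (2%:R : {mpoly K[n]}) != 0.
Proof. exact/mpoly_nat_neq0/nat2_neq0. Qed.

Lemma nat3R_neq0 : (3%:R : {mpoly K[n]}) != 0.
Proof. exact/mpoly_nat_neq0/nat3_neq0. Qed.

Lemma mulf_eq0l p q : p != 0 -> p * q = 0 -> q = 0.
Proof. by move=> /negPf p0 /eqP; rewrite mulf_eq0 p0 => /eqP. Qed.

Lemma mderiv_subst i j d p : p \is d.+1.-homog -> j != i ->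
  (subst_var i 0 p)^`M(j) = subst_var i 0 p^`M(j).
Proof.
move=> p_homog neq; have [g _ p_eq] := split_var i p_homog.
have p_free := @free_subst _ _ i p.
rewrite {2}p_eq mderivD mderivM mderivXU (negPf neq) mul0r add0r.
rewrite rmorphD rmorphM /= subst_varX eqxx mul0r addr0.
by rewrite [RHS]free_mderiv.
Qed.

Variables i1 i2 : 'I_n.
Hypothesis neq12 : i1 != i2.

Let T : {mpoly K[n]} := 'X_i1.
Let S : {mpoly K[n]} := 'X_i2.

Let freeS : varfree i1 S. Proof. by apply: freeX; rewrite eq_sym. Qed.
Let S_neq0 : S != 0. Proof. exact: mpolyXU_neq0. Qed.

(** The three conclusions are the coefficients of T^5, T^4 and T^3 in [det3_expand], the first two
    divided by 3 and the others simplified by the first. *)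
Lemma dep_columns (A B C D q E : {mpoly K[n]}) j : j != i1 -> j != i2 ->
  varfree i1 A -> varfree i1 B -> varfree i1 C -> varfree i1 D ->
  varfree i1 q -> varfree i1 E ->
  jac_dep (T * T * T + T * A + C) (T * T * S + T * B + D) (T * q + E) ->
  [/\ q^`M(j) = 0,
      E^`M(j) = B^`M(j) * q^`M(i2) &
      3%:R * B^`M(i2) * E^`M(j) - 3%:R * B^`M(j) * E^`M(i2)
        - 3%:R * D^`M(j) * q^`M(i2) + 2%:R * A^`M(j) * S * q^`M(i2)
        - A^`M(j) * q = 0].
Proof.
move=> neq1 neq2 fA fB fC fD fq fE /(_ i1 i2 j).
have [neq21 j1 j2] : [/\ (i1 == i2) = false, (i1 == j) = false & (j == i2) = false].
  by rewrite (negPf neq12) [i1 == j]eq_sym (negPf neq1) (negPf neq2).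
rewrite /jac3 !mderivE !eqxx (eq_sym i2 i1) neq21 j2 (eq_sym j i1) j1.
rewrite (mderiv_free fA) (mderiv_free fB) (mderiv_free fC) (mderiv_free fD).
rewrite (mderiv_free fq) (mderiv_free fE) !(mulr1n, mulr0n).
set A2 := A^`M(i2); set Aj := A^`M(j); set B2 := B^`M(i2); set Bj := B^`M(j).
set C2 := C^`M(i2); set Cj := C^`M(j); set D2 := D^`M(i2); set Dj := D^`M(j).
set q2 := q^`M(i2); set qj := q^`M(j); set E2 := E^`M(i2); set Ej := E^`M(j).
move=> det0.
have := det3_expand T S A A2 Aj B B2 Bj C2 Cj D2 Dj q q2 qj E2 Ej.
rewrite [LHS](_ : _ = 0); last by rewrite -[RHS]det0 /det3; ring.
have fS := freeS.
move=> /esym /extract_var; case; do ?[exact: freeC|exact: free_nat|exact: free_mderiv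
  |assumption|apply: freeD|apply: freeN|apply: freeM].
move=> _ [c3 c4 c5].
have qj0 : qj = 0 by apply: (mulf_eq0l nat3R_neq0).
have Ej_eq : Ej = Bj * q2.
  apply/eqP; rewrite -subr_eq0; apply/eqP; apply: (mulf_eq0l nat3R_neq0).
  by rewrite -[RHS]c4 qj0; ring.
by split=> //; rewrite -[RHS]c3 qj0; ring.
Qed.

(** The gradient of a cube of x2 lies along x2, so the minor reduces to the 2 x 2 minor of the other
    two forms in the columns x1 and xj, and its powers of T can be compared. *)
Lemma dep_cube (A B C D : {mpoly K[n]}) e j : e != 0 -> j != i1 -> j != i2 ->
  varfree i1 A -> varfree i1 B -> varfree i1 C -> varfree i1 D ->
  jac_dep (T * T * T + T * A + C) (T * T * S + T * B + D) (e *: (S * S * S)) ->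
  [/\ A^`M(j) = 0, B^`M(j) = 0, C^`M(j) = 0 & D^`M(j) = 0].
Proof.
move=> e_neq0 neq1 neq2 fA fB fC fD /(_ i1 i2 j).
have [neq21 j1 j2] : [/\ (i1 == i2) = false, (i1 == j) = false & (j == i2) = false].
  by rewrite (negPf neq12) [i1 == j]eq_sym (negPf neq1) (negPf neq2).
rewrite /jac3 -mul_mpolyC !mderivE !eqxx (eq_sym i2 i1) neq21 j2 (eq_sym j i1) j1.
rewrite (mderiv_free fA) (mderiv_free fB) (mderiv_free fC) (mderiv_free fD).
rewrite !(mulr1n, mulr0n).
move Aj_def : (A^`M(j)) => Aj; move Bj_def : (B^`M(j)) => Bj.
move Cj_def : (C^`M(j)) => Cj; move Dj_def : (D^`M(j)) => Dj.
have fAj : varfree i1 Aj by rewrite -Aj_def; apply: free_mderiv.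
have fBj : varfree i1 Bj by rewrite -Bj_def; apply: free_mderiv.
have fCj : varfree i1 Cj by rewrite -Cj_def; apply: free_mderiv.
have fDj : varfree i1 Dj by rewrite -Dj_def; apply: free_mderiv.
move=> det0; have fS := freeS; have f0 := free0 K i1.
have e3S2_neq0 : 3%:R * e%:MP * (S * S) != 0.
  by rewrite !mulf_neq0 ?nat3R_neq0 ?mpolyC_eq0.
have sum0 : (A * Dj - Cj * B) + (A * Bj - Aj * B - 2%:R * S * Cj) * T
    + (3%:R * Dj - 2%:R * S * Aj) * T ^+ 2 + (3%:R * Bj) * T ^+ 3
    + 0 * T ^+ 4 + 0 * T ^+ 5 = 0.
  by apply: (mulf_eq0l e3S2_neq0); rewrite -[RHS]oppr0 -[X in _ = - X]det0 /det3; ring.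
move: sum0 => /extract_var; case; do ?[exact: freeC|exact: free_nat
  |assumption|apply: freeD|apply: freeN|apply: freeM].
move=> [c0 c1 c2] [c3 _ _].
have Bj0 : Bj = 0 by apply: (mulf_eq0l nat3R_neq0).
(* [Cj] and [Dj] are eliminated from the coefficients of 1, T and T^2. *)
have AjR : Aj * (2%:R * 2%:R * S * S * A + 3%:R * B * B) = 0.
  have -> : Aj * (2%:R * 2%:R * S * S * A + 3%:R * B * B) =
     2%:R * 3%:R * S * (A * Dj - Cj * B)
       - 2%:R * S * A * (3%:R * Dj - 2%:R * S * Aj)
       - 3%:R * B * (A * Bj - Aj * B - 2%:R * S * Cj) + 3%:R * A * B * Bj by ring.
  by rewrite c0 c1 c2 Bj0 !mulr0; ring.
have Aj0 : Aj = 0.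
  have [->//|Aj_neq0] := eqVneq Aj 0.
  (* For nonzero [Aj] the other factor vanishes, and with it its derivative 4 S^2 [Aj], because [Bj]
     = 0. *)
  have /(congr1 (mderiv j)) := mulf_eq0l Aj_neq0 AjR.
  rewrite -!(mpolyC_nat n K) !mderivE j2 Aj_def Bj_def Bj0 ?mderiv0 !mpolyC_nat !mulr0n => R0.
  have : 2%:R * 2%:R * (S * S) * Aj = 0 by rewrite -[RHS]R0; ring.
  by apply: mulf_eq0l; rewrite !mulf_neq0 ?nat2R_neq0.
have Dj0 : Dj = 0 by apply: (mulf_eq0l nat3R_neq0); rewrite -[RHS]c2 Aj0; ring.
split=> //; have : 2%:R * S * Cj = 0.
  by rewrite -[RHS]oppr0 -[X in _ = - X]c1 Aj0 Bj0; ring.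
by apply: mulf_eq0l; rewrite !mulf_neq0 ?nat2R_neq0.
Qed.

End Cubics.

(** * Dependent cubics with leading terms x1^3, x1^2 x2 and x1 x2^2 *)

Section Classification.

Variables (K : fieldType) (n : nat).
Hypothesis char_K : (6%:R : K) \is a GRing.unit.
Implicit Types (p q f g h : {mpoly K[n]}) (i j k : 'I_n).

Lemma jac3_row_ops f g h a b c i j k :
  jac3 (f + a%:MP * g + b%:MP * h) (c%:MP * g) h i j k =
  c%:MP * jac3 f g h i j k.
Proof. by rewrite /jac3 !mderivE /det3; ring. Qed.

(** Weighting the minors with first column i by x_i and summing, Euler's identity replaces the
    derivatives in that column by the forms themselves, up to the factor d. *)
Lemma jac3_euler d f g h j k :
  f \is d.-homog -> g \is d.-homog -> h \is d.-homog -> jac_dep f g h ->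
  d%:R * det3 f f^`M(j) f^`M(k) g g^`M(j) g^`M(k) h h^`M(j) h^`M(k) = 0.
Proof.
move=> /euler f_eul /euler g_eul /euler h_eul dep.
have : \sum_i 'X_i * jac3 f g h i j k = 0.
  by apply: big1 => i _; rewrite dep mulr0.
rewrite /jac3 /det3.
set x1 := g^`M(j) * h^`M(k) - g^`M(k) * h^`M(j).
set x2 := f^`M(k) * h^`M(j) - f^`M(j) * h^`M(k).
set x3 := f^`M(j) * g^`M(k) - f^`M(k) * g^`M(j).
move=> sum0; transitivity (x1 * (d%:R * f) + x2 * (d%:R * g) + x3 * (d%:R * h)).
  by rewrite /x1 /x2 /x3; ring.
rewrite -f_eul -g_eul -h_eul !mulr_sumr -!big_split /= -[RHS]sum0.
by apply: eq_bigr => i _; rewrite /x1 /x2 /x3; ring.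
Qed.

Lemma div_var i d p : p \is d.+1.-homog -> subst_var i 0 p = 0 ->
  exists2 l, l \is d.-homog & p = 'X_i * l.
Proof.
move=> p_homog p0; have [l l_homog p_eq] := split_var i p_homog.
by exists l => //; rewrite {1}p_eq p0 add0r.
Qed.

Variables i1 i2 : 'I_n.
Hypothesis neq12 : i1 != i2.

Let T : {mpoly K[n]} := 'X_i1.
Let S : {mpoly K[n]} := 'X_i2.

Let freeS : varfree i1 S. Proof. by apply: freeX; rewrite eq_sym. Qed.
Let S_neq0 : S != 0. Proof. exact: mpolyXU_neq0. Qed.

(** Setting x2 = 0 in the hypothesis leaves 2 B_j B = 0: a nonzero restriction of B would have only
    zero derivatives. Hence x2 divides B. *)
Lemma quad_factor A B D mu :
  A \is 2.-homog -> B \is 2.-homog -> D \is 3.-homog -> varfree i1 B ->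
  (forall j, j != i1 -> j != i2 ->
     B^`M(j) * (2%:R * B + 3%:R * mu%:MP * (S * S)) =
     S * (S * A^`M(j) - 2%:R * D^`M(j))) ->
  exists l, [/\ l \is 1.-homog, varfree i1 l & B = S * l].
Proof.
move=> A2 B2 D3 fB eqB.
have eps_eq j : j != i1 -> j != i2 ->
    (subst_var i2 0 B)^`M(j) * subst_var i2 0 B = 0.
  move=> neq1 neq2; rewrite (mderiv_subst B2 neq2).
  have := congr1 (subst_var i2 0) (eqB j neq1 neq2).
  rewrite !(rmorphM, rmorphD, rmorphB, rmorph_nat) /= subst_varX eqxx.
  rewrite !mul0r mulr0 addr0 => eq0.
  by apply: (mulf_eq0l (nat2R_neq0 n char_K)); rewrite -[RHS]eq0; ring.
have epsB0 : subst_var i2 0 B = 0.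
  have [//|epsB_neq0] := eqVneq (subst_var i2 0 B) 0.
  have eps_homog : subst_var i2 0 B \is 2.-homog.
    by apply: dhomog_subst => //; apply: dhomog0.
  apply: (dhomog_deriv0 char_K _ eps_homog) => // j.
  have [->|neq2] := eqVneq j i2; first by apply: mderiv_free; apply: free_subst.
  have [->|neq1] := eqVneq j i1; last first.
    by apply: (mulf_eq0l epsB_neq0); rewrite mulrC eps_eq.
  by rewrite (mderiv_subst B2) // (mderiv_free fB) rmorph0.
have [l l_homog B_eq] := div_var B2 epsB0; exists l; split=> //.
apply/eqP; rewrite -subr_eq0; apply/eqP; apply: (mulf_eq0l S_neq0).
rewrite mulrBr -/S -B_eq; move: fB; rewrite B_eq /varfree rmorphM /= => <-.
by rewrite freeS subrr.
Qed.

(** For W = c = 0 the three forms are Z (Z - k)^2, 2 x2 Z (Z - k) and x2^2 Z, the shape aimed at; W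
    and c measure the deviation from it. In the identity of [jac3_euler] a factor x2^3 splits off,
    and the conclusions come from the coefficients of Z^2, Z and 1. *)
Lemma pencil_eqs (b k W c L : {mpoly K[n]}) j :
  j != i1 -> j != i2 ->
  varfree i1 b -> varfree i1 k -> varfree i1 W -> varfree i1 c -> varfree i1 L ->
  b^`M(j) = 2%:R * L -> k^`M(j) = 3%:R * L ->
  let Z := T + b in
  let f := Z * Z * Z - (2%:R)%:MP * k * Z * Z + (k * k + W) * Z + c in
  let g := S * ((2%:R)%:MP * Z * Z - (2%:R)%:MP * k * Z + W) in
  f \is 3.-homog -> g \is 3.-homog -> S * S * Z \is 3.-homog ->
  jac_dep f g (S * S * Z) ->
  [/\ c^`M(j) + k * W^`M(j) + k^`M(j) * W = 0,
      2%:R * c * k^`M(j) + W * (2%:R * k * k^`M(j) + W^`M(j)) = 0 &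
      c * W^`M(j) = W * c^`M(j)].
Proof.
move=> neq1 neq2 fb fk fW fc fL bj kj Z f g f3 g3 h3 dep.
have neq21 : (i1 == i2) = false by apply: negbTE.
have [j1 j2] : ((j == i1) = false) * ((j == i2) = false) by rewrite !(negbTE neq1, negbTE neq2).
have := jac3_euler i1 j f3 g3 h3 dep.
have Z1 : Z^`M(i1) = 1 by rewrite mderivD mderivXU eqxx (mderiv_free fb) addr0.
have Zj : Z^`M(j) = 2%:R * L by rewrite mderivD mderivXU j1 bj add0r.
have S1 : S^`M(i1) = 0 by rewrite mderivXU neq21.
have Sj : S^`M(j) = 0 by rewrite mderivXU j2.
have Z_def : Z = 'X_i1 + b by [].
clearbody Z; rewrite /g /f !(mderivD, mderivN, mderivM, mderivC) Z1 Zj S1 Sj kj.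
rewrite (mderiv_free fk) (mderiv_free fW) (mderiv_free fc) ?mpolyC_nat.
clear f g f3 g3 dep.
have fWj := free_mderiv j fW; have fcj := free_mderiv j fc.
move: (W^`M(j)) (c^`M(j)) fWj fcj => Wj cj fWj fcj det0.
have sum0 : (3%:R * (W * cj - c * Wj)) +
    (3%:R * (2%:R * c * (3%:R * L) + W * (2%:R * k * (3%:R * L) + Wj))) * Z
    + (- (3%:R * 2%:R * (cj + k * Wj + 3%:R * L * W))) * Z ^+ 2
    + 0 * Z ^+ 3 + 0 * Z ^+ 4 + 0 * Z ^+ 5 = 0.
  have S3_neq0 : S * S * S != 0 by rewrite !mulf_neq0.
  by apply: (mulf_eq0l S3_neq0); rewrite -[RHS]det0 /det3; ring.
rewrite Z_def in sum0; have f0 := free0 K i1; have fn := @free_nat K _ i1.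
move: sum0 => /(extract4 fb); case; do ?[exact: freeC|exact: free_nat
  |assumption|apply: freeD|apply: freeN|apply: freeM].
move=> [/(mulf_eq0l (nat3R_neq0 n char_K)) c0 c1 c2] _; split.
- have n6 : 3%:R * 2%:R != 0 :> {mpoly K[n]} by rewrite mulf_neq0 ?nat2R_neq0 ?nat3R_neq0.
  by apply: (mulf_eq0l n6); rewrite -[RHS]oppr0 -[X in _ = - X]c2; ring.
- exact: (mulf_eq0l (nat3R_neq0 n char_K) c1).
- by apply/eqP; rewrite eq_sym -subr_eq0 c0.
Qed.

(** The relations of [dep_columns] express E and B by a linear form l and a constant, and D by A, l
    and another constant; [pencil_eqs] then controls A and C. The alternative is decided by whether
    l involves a variable besides x1 and x2. *)
Lemma pencil_normal_form (A B C D E : {mpoly K[n]}) :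
  A \is 2.-homog -> B \is 2.-homog ->
  C \is 3.-homog -> D \is 3.-homog -> E \is 3.-homog ->
  varfree i1 A -> varfree i1 B -> varfree i1 C -> varfree i1 D -> varfree i1 E ->
  jac_dep (T * T * T + T * A + C) (T * T * S + T * B + D) (T * (S * S) + E) ->
  (forall j, j != i1 -> j != i2 ->
     [/\ A^`M(j) = 0, B^`M(j) = 0, C^`M(j) = 0, D^`M(j) = 0 & E^`M(j) = 0]) \/
  (exists l mu a b j0,
     [/\ l \is 1.-homog, varfree i1 l, j0 != i1, j0 != i2 & l^`M(j0) != 0] /\
     let z := T + 2%:R * l + mu%:MP * S in
     let l1 := T - l - mu%:MP * S in
     [/\ T * (S * S) + E = S * S * z,
         T * T * S + T * B + D = S * z * l1 &
         T * T * T + T * A + C = z * l1 * l1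
           + a%:MP * (T * T * S + T * B + D) + b%:MP * (T * (S * S) + E)]).
Proof.
move=> A2 B2 C3 D3 E3 fA fB fC fD fE dep.
have fS := freeS; have T1 : T \is 1.-homog := dhomogXU _ i1.
have S1 : S \is 1.-homog := dhomogXU _ i2.
have S2 : S * S \is 2.-homog := dhomogM S1 S1.
have S3 : S * S * S \is 3.-homog := dhomogM S2 S1.
have dS j : j != i2 -> S^`M(j) = 0 by move=> /negPf neq; rewrite mderivXU neq.
have dS2 : S^`M(i2) = 1 by rewrite mderivXU eqxx.
have cols j (neq1 : j != i1) (neq2 : j != i2) :=
  dep_columns char_K neq12 neq1 neq2 fA fB fC fD (freeM fS fS) fE dep.
have dS22 : (S * S)^`M(i2) = 2%:R * S by rewrite mderivM dS2; ring.
(* By the second relation of [dep_columns], E - 2 x2 B has no derivative outside x2, so it is a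
   multiple of x2^3. *)
have [mu E_eq] : exists mu, E = 2%:R * S * B + mu%:MP * (S * S * S).
  have R3 : E - (2%:R)%:MP * (S * B) \is 3.-homog.
    by rewrite rpredB // mul_mpolyC dhomogZ //; apply: (dhomogM S1 B2).
  have dR j : j != i2 -> (E - (2%:R)%:MP * (S * B))^`M(j) = 0.
    move=> neq2; rewrite !mderivE (negPf neq2) mulr0n.
    have [->|neq1] := eqVneq j i1.
      by rewrite (mderiv_free fE) (mderiv_free fB); ring.
    by have [_ -> _] := cols _ neq1 neq2; rewrite dS22 mpolyC_nat; ring.
  have [mu mu_eq] := dhomog_one_var char_K (isT : (3 < 5)%N) R3 dR; exists mu.
  rewrite -[LHS](subrK ((2%:R)%:MP * (S * B))) mu_eq -mul_mpolyC mpolyC_nat /S.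
  ring.
have E2_eq : E^`M(i2) = 2%:R * B + 2%:R * S * B^`M(i2) + 3%:R * mu%:MP * (S * S).
  by rewrite E_eq -mpolyC_nat !mderivE eqxx mulr1n !mpolyC_nat; ring.
have colB j : j != i1 -> j != i2 -> B^`M(j) * (2%:R * B + 3%:R * mu%:MP * (S * S)) =
     S * (S * A^`M(j) - 2%:R * D^`M(j)).
  move=> neq1 neq2; have [_ Ej] := cols _ neq1 neq2; rewrite dS22 in Ej *.
  rewrite E2_eq Ej => col3; apply/eqP; rewrite -subr_eq0; apply/eqP.
  by apply: (mulf_eq0l (nat3R_neq0 n char_K)); rewrite -[RHS]oppr0 -[X in _ = - X]col3 -/S; ring.
have [l [l1 fl B_eq]] := quad_factor A2 B2 D3 fB colB.
have dB j : j != i2 -> B^`M(j) = S * l^`M(j).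
  by move=> neq2; rewrite B_eq mderivM (dS _ neq2) mul0r add0r.
have colD j : j != i1 -> j != i2 ->
    2%:R * D^`M(j) = S * A^`M(j) - l^`M(j) * (2%:R * S * l + 3%:R * mu%:MP * (S * S)).
  move=> neq1 neq2; have := colB j neq1 neq2; rewrite dB // B_eq => eqS.
  apply/eqP; rewrite -subr_eq0; apply/eqP; apply: (mulf_eq0l S_neq0).
  rewrite -[RHS](subrr (S * l^`M(j) * (2%:R * (S * l) + 3%:R * mu%:MP * (S * S)))).
  by rewrite [X in _ = _ - X]eqS; ring.
(* Likewise, the difference [R] of the two sides without the nu term depends on x2 alone, by
   [colD]. *)
have [nu D_eq] : exists nu, 2%:R * D =
    S * (A - l * l - 3%:R * mu%:MP * S * l) + nu%:MP * (S * S * S).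
  pose R := (2%:R)%:MP * D - S * (A - l * l - (3%:R * mu)%:MP * (S * l)).
  have R3 : R \is 3.-homog.
    rewrite rpredB // ?mul_mpolyC ?dhomogZ //; apply: (dhomogM S1).
    by rewrite rpredB ?dhomogZ ?(dhomogM S1 l1) // rpredB // (dhomogM l1 l1).
  have dR j : j != i2 -> R^`M(j) = 0.
    move=> neq2; rewrite /R !mderivE (negPf neq2) mulr0n.
    have [->|neq1] := eqVneq j i1.
      by rewrite (mderiv_free fD) (mderiv_free fA) (mderiv_free fl); ring.
    rewrite mpolyC_nat colD // mpolyCM mpolyC_nat; ring.
  have [nu nu_eq] := dhomog_one_var char_K (isT : (3 < 5)%N) R3 dR; exists nu.
  rewrite -mpolyC_nat -[LHS](subrK (S * (A - l * l - (3%:R * mu)%:MP * (S * l)))).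
  rewrite -/R nu_eq -mul_mpolyC mpolyCM !mpolyC_nat /S; ring.
pose m := mu%:MP : {mpoly K[n]}; pose v := nu%:MP : {mpoly K[n]}.
have fm : varfree i1 m := freeC i1 mu.
have fv : varfree i1 v := freeC i1 nu.
have fN e : varfree i1 (e%:R : {mpoly K[n]}) := free_nat K i1 e.
(* [T + b] is the factor z of the third form, and [k] is z - l1. [W] and [c] are the deviations left
   when f1 - mu f2 + (nu + mu^2) f3 and 2 f2 are written in powers of z as in [pencil_eqs]. *)
pose b := 2%:R * l + m * S; pose k := 3%:R * l + 2%:R * m * S.
pose W := A + 3%:R * l * l + 3%:R * m * S * l + (v + 2%:R * m * m) * S * S.
pose c := - b * b * b - b * A + C - m * (b * b * S - b * B + D)
   + (v + m * m) * (- b * S * S + E).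
have fb : varfree i1 b := freeD (freeM (fN 2%N) fl) (freeM fm fS).
have fk : varfree i1 k := freeD (freeM (fN 3%N) fl) (freeM (freeM (fN 2%N) fm) fS).
have fW : varfree i1 W :=
  freeD (freeD (freeD fA (freeM (freeM (fN 3%N) fl) fl))
    (freeM (freeM (freeM (fN 3%N) fm) fS) fl))
    (freeM (freeM (freeD fv (freeM (freeM (fN 2%N) fm) fm)) fS) fS).
have fc : varfree i1 c :=
  freeD (freeD (freeD (freeD (freeM (freeM (freeN fb) fb) fb) (freeN (freeM fb fA))) fC)
    (freeN (freeM fm (freeD (freeD (freeM (freeM fb fb) fS) (freeN (freeM fb fB))) fD))))
    (freeM (freeD fv (freeM fm fm)) (freeD (freeM (freeM (freeN fb) fS) fS) fE)).
have f1_eq : T * T * T + T * A + C + (- mu)%:MP * (T * T * S + T * B + D) +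
    (nu + mu * mu)%:MP * (T * (S * S) + E) =
  (T + b) * (T + b) * (T + b) - (2%:R)%:MP * k * (T + b) * (T + b)
    + (k * k + W) * (T + b) + c.
  rewrite mpolyCN mpolyCD mpolyCM mpolyC_nat -/m -/v /c /W /k /b E_eq B_eq -/m.
  ring.
have f2_eq : (2%:R)%:MP * (T * T * S + T * B + D) =
    S * ((2%:R)%:MP * (T + b) * (T + b) - (2%:R)%:MP * k * (T + b) + W).
  rewrite mpolyC_nat mulrDr D_eq /W /k /b B_eq -/m -/v.
  ring.
have f3_eq : T * (S * S) + E = S * S * (T + b).
  by rewrite E_eq B_eq /b -/m; ring.
have T2 : T * T \is 2.-homog := dhomogM T1 T1.
have f1_homog : T * T * T + T * A + C \is 3.-homog.
  by do 2!apply: rpredD => //; [apply: (dhomogM T2 T1)|apply: (dhomogM T1 A2)].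
have f2_homog : T * T * S + T * B + D \is 3.-homog.
  by do 2!apply: rpredD => //; [apply: (dhomogM T2 S1)|apply: (dhomogM T1 B2)].
have f3_homog : T * (S * S) + E \is 3.-homog.
  by apply: rpredD => //; apply: (dhomogM T1 S2).
have eqs j : j != i1 -> j != i2 ->
  [/\ c^`M(j) + k * W^`M(j) + k^`M(j) * W = 0,
      2%:R * c * k^`M(j) + W * (2%:R * k * k^`M(j) + W^`M(j)) = 0 &
      c * W^`M(j) = W * c^`M(j)].
  move=> neq1 neq2; have [L lj] := mderiv_linear j l1.
  apply: (pencil_eqs neq1 neq2 fb fk fW fc (freeC i1 L)).
  - rewrite /b -mpolyC_nat !mderivE (negPf neq2) lj mpolyC_nat mulr0n; ring.
  - rewrite /k -!mpolyC_nat !mderivE (negPf neq2) lj !mpolyC_nat mulr0n; ring.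
  - by rewrite -/T -f1_eq; apply: rpredD; first apply: rpredD => //; rewrite mul_mpolyC dhomogZ.
  - by rewrite -/T -/S -f2_eq mul_mpolyC dhomogZ.
  - by rewrite -/T -/S -f3_eq.
  - by rewrite -/T -/S -f1_eq -f2_eq -f3_eq => x y z; rewrite jac3_row_ops dep mulr0.
have kj j : j != i2 -> k^`M(j) = 3%:R * l^`M(j).
  move=> neq2; rewrite /k /m -!mpolyC_nat !mderivE (negPf neq2) !mpolyC_nat mulr0n; ring.
have [/existsP[j0 /and3P[neq1 neq2 lj0]]|] :=
    boolP [exists j, [&& j != i1, j != i2 & l^`M(j) != 0]].
  right; have [e1 e2 e3] := eqs _ neq1 neq2.
  have kj0_neq0 : k^`M(j0) != 0 by rewrite kj // mulf_neq0 ?nat3R_neq0.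
  (* The first equation says that [u] is constant in x_j0. *)
  pose u := c + k * W.
  have uj : u^`M(j0) = 0 by rewrite mderivD mderivM -[RHS]e1; ring.
  (* Multiplied by k_j0, this relation is a combination of the three equations. Differentiating it
     in x_j0 gives W_j0 = 0 unless W = 0, and the first and third equations then give W^2 k_j0 =
     0. *)
  have u2W3 : 2%:R * u * u - W * W * W = 0.
    apply: (mulf_eq0l kj0_neq0); have e3' : c * W^`M(j0) - W * c^`M(j0) = 0 by rewrite e3 subrr.
    rewrite /u.
    transitivity ((c + k * W) * (2%:R * c * k^`M(j0) + W * (2%:R * k * k^`M(j0) + W^`M(j0)))
      - W * W * (c^`M(j0) + k * W^`M(j0) + k^`M(j0) * W)
      - W * (c * W^`M(j0) - W * c^`M(j0))); first by ring.
    by rewrite e1 e2 e3'; ring.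
  have W0 : W = 0.
    have [//|W_neq0] := eqVneq W 0.
    have := congr1 (mderiv j0) u2W3; clearbody u c W.
    rewrite -mpolyC_nat !mderivE uj ?mderiv0 => dW.
    have Wj0 : W^`M(j0) = 0.
      apply: (mulf_eq0l W_neq0); apply: (mulf_eq0l W_neq0).
      apply: (mulf_eq0l (nat3R_neq0 n char_K)); rewrite -[RHS]oppr0 -[X in _ = - X]dW; ring.
    have W2k : W * W * k^`M(j0) = 0.
      transitivity (W * (c^`M(j0) + k * W^`M(j0) + k^`M(j0) * W) - c * W^`M(j0)
        - k * W * W^`M(j0)); first by rewrite e3; ring.
      by rewrite e1 Wj0; ring.
    by apply: (mulf_eq0l kj0_neq0); apply: (mulf_eq0l W_neq0); rewrite -[RHS]W2k; ring.
  have c0 : c = 0.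
    have : 2%:R * (c * c) = 0 by rewrite -[RHS]u2W3 /u W0; ring.
    by move=> /(mulf_eq0l (nat2R_neq0 n char_K)) /eqP; rewrite mulf_eq0 orbb => /eqP.
  (* These coefficients undo the combination f1 - mu f2 + (nu + mu^2) f3, which has become z
     l1^2. *)
  exists l, mu, mu, (- (nu + mu * mu)), j0; split=> // z l1'.
  have z_eq : z = T + b by rewrite /z /b /m; ring.
  have l1_eq : l1' = T + b - k by rewrite /l1' /b /k /m; ring.
  split; first by rewrite z_eq.
    apply/eqP; rewrite -subr_eq0; apply/eqP; apply: (mulf_eq0l (nat2R_neq0 n char_K)).
    by rewrite mulrBr -mpolyC_nat f2_eq W0 z_eq l1_eq mpolyC_nat; ring.
  rewrite z_eq l1_eq; apply/eqP; rewrite -subr_eq0; apply/eqP.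
  move: f1_eq; rewrite W0 c0 => /eqP; rewrite -subr_eq0 => /eqP eq0.
  by rewrite -[RHS]eq0 !mpolyCN mpolyC_nat; ring.
(* Here l depends on x2 only, and so do b and k; the equations then make W and c constant in x_j,
   and A, B, C, D, E follow. *)
rewrite negb_exists => /forallP l_free; left=> j neq1 neq2.
have lj : l^`M(j) = 0.
  by apply/eqP; move: (l_free j); rewrite neq1 neq2 negbK.
have kj0 : k^`M(j) = 0 by rewrite kj // lj mulr0.
have [e1 e2 e3] := eqs _ neq1 neq2.
have Wj : W^`M(j) = 0.
  have [W0|W_neq0] := eqVneq W 0; first by rewrite W0 mderiv0.
  by apply: (mulf_eq0l W_neq0); rewrite -[RHS]e2 kj0; ring.
have cj : c^`M(j) = 0 by rewrite -[RHS]e1 Wj kj0; ring.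
have Aj : A^`M(j) = 0.
  move: Wj; rewrite /W /m /v -!mpolyC_nat !mderivE lj (negPf neq2) mulr0n !mpolyC_nat => dW.
  by rewrite -[RHS]dW; ring.
have Bj : B^`M(j) = 0 by rewrite dB // lj mulr0.
have Dj : D^`M(j) = 0.
  by apply: (mulf_eq0l (nat2R_neq0 n char_K)); rewrite colD // Aj lj; ring.
have Ej : E^`M(j) = 0.
  by have [_ -> _] := cols _ neq1 neq2; rewrite Bj mul0r.
have bj : b^`M(j) = 0.
  rewrite /b /m -!mpolyC_nat !mderivE lj (negPf neq2) mulr0n; ring.
split=> //; clearbody b; move: cj; rewrite /c /m /v !mderivE bj Aj Bj Dj Ej (negPf neq2) mulr0n.
by move=> dc; rewrite -[RHS]dc; ring.
Qed.

End Classification.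

(** * Spaces of cubics normalized by gradients at a basis vector *)

Section CubicSpaces.

Variables (K : fieldType) (n : nat).
Hypothesis char_K : (6%:R : K) \is a GRing.unit.
Implicit Types (p q f g h : {mpoly K[n]}) (i j k : 'I_n).

Definition unit_point i : 'I_n -> K := fun j => (j == i)%:R.

Lemma meval_unit_free i d p : (0 < d < 5)%N -> p \is d.-homog ->
  varfree i p -> p.@[unit_point i] = 0.
Proof.
move=> d_bnd p_homog <-; rewrite /subst_var comp_mpoly_meval.
have -> : p.@[fun j => (tnth [tuple if j == i then 0 else 'X_j | j < n] j).@[unit_point i]]
    = p.@[fun _ => 0].
  apply: meval_eq => j; rewrite tnth_mktuple; case: ifP => [_|neq].
    by rewrite meval0.
  by rewrite mevalXU /unit_point neq.
have := congr1 (meval (fun _ => 0)) (euler p_homog).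
rewrite mevalM -mpolyC_nat mevalC raddf_sum big1 /= => [/esym/eqP|j _].
  by rewrite mulf_eq0 (negPf (nat_lt5_neq0 char_K d_bnd)) => /eqP.
by rewrite mevalM mevalXU mul0r.
Qed.

Lemma cubic_split i f : f \is 3.-homog ->
  exists a b c d, [/\ f = a%:MP * ('X_i * 'X_i * 'X_i) + 'X_i * 'X_i * b + 'X_i * c + d,
    [/\ b \is 1.-homog, c \is 2.-homog & d \is 3.-homog] &
    [/\ varfree i b, varfree i c & varfree i d]].
Proof.
move=> f3; have [g g2 f_eq] := split_var i f3; have [h h1 g_eq] := split_var i g2.
have [e e0 h_eq] := split_var i h1; have [a a_eq] := dhomog0C e0.
exists a, (subst_var i 0 h), (subst_var i 0 g), (subst_var i 0 f); split.
- by rewrite {1}f_eq {1}g_eq {1}h_eq a_eq; ring.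
- by split; apply: dhomog_subst => //; apply: dhomog0.
- by split; apply: free_subst.
Qed.

(** Forms of positive degree without x_i vanish at the basis vector of x_i, so only the x_i^3 and
    x_i^2 parts contribute to the gradient there. *)
Lemma cubic_split_grad i a b c d j :
  b \is 1.-homog -> c \is 2.-homog -> d \is 3.-homog ->
  varfree i b -> varfree i c -> varfree i d ->
  (a%:MP * ('X_i * 'X_i * 'X_i) + 'X_i * 'X_i * b + 'X_i * c + d)^`M(j).@[unit_point i]
  = (if j == i then 3%:R * a else b^`M(j).@[unit_point i]) :> K.
Proof.
move=> b1 c2 d3 fb fc fd; have mb := meval_unit_free _ b1 fb.
have mc := meval_unit_free _ c2 fc; have md := meval_unit_free _ d3 fd.
have mcj := meval_unit_free _ (mderiv_dhomog j c2) (free_mderiv j fc).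
have mdj := meval_unit_free _ (mderiv_dhomog j d3) (free_mderiv j fd).
rewrite !mderivE !(mevalD, mevalM, mevalC) !mevalXU mb // mc // mcj // mdj //.
have -> : unit_point i i = 1 by rewrite /unit_point eqxx.
have [->|neq] := eqVneq j i.
  by rewrite !(mderiv_free fb) mulr1n meval1 meval0; ring.
by rewrite mulr0n meval0; ring.
Qed.

Lemma linear_grad_eq i p q : p \is 1.-homog -> q \is 1.-homog ->
  (forall j, p^`M(j).@[unit_point i] = q^`M(j).@[unit_point i]) -> p = q.
Proof.
move=> p1 q1 eq_grad; apply/eqP; rewrite -subr_eq0; apply/eqP.
have r1 : p - q \is 1.-homog by rewrite rpredB.
apply: (dhomog_deriv0 char_K _ r1) => // j; have [c c_eq] := mderiv_linear j r1.
have := eq_grad j; move/eqP; rewrite -subr_eq0 -mevalB -mderivB c_eq mevalC.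
by move=> /eqP ->.
Qed.

Lemma jac3_meval f g h i j k v : (jac3 f g h i j k).@[v] =
  det3 f^`M(i).@[v] f^`M(j).@[v] f^`M(k).@[v] g^`M(i).@[v] g^`M(j).@[v]
    g^`M(k).@[v] h^`M(i).@[v] h^`M(j).@[v] h^`M(k).@[v].
Proof. by rewrite /jac3 /det3 !(mevalD, mevalN, mevalM). Qed.

Variables i1 i2 : 'I_n.
Hypothesis neq12 : i1 != i2.

Variables (V : {mpoly K[n]} -> Prop) (H : 'I_n -> {mpoly K[n]}).
Hypothesis V_comb : forall a b f g, V f -> V g -> V (a%:MP * f + b%:MP * g).
Hypothesis V_cubic : forall f, V f -> f \is 3.-homog.
Hypothesis V_dep : forall f g h, V f -> V g -> V h -> jac_dep f g h.
Hypothesis V_H : forall i, V (H i).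

(** Modulo f1 and f2 each H_i has zero gradient at the point, since f1 and f2 already attain the
    rank there; it is then la_i x1 x2^2 + E_i with E_i free of x1. The cases are: all la_i and E_i
    vanish; all la_i vanish and some E_i is a nonzero multiple of x2^3; some la_i is nonzero, and
    [pencil_normal_form] applies. *)
Lemma cubic_space_classification f1 f2 : V f1 -> V f2 ->
  (forall j, f1^`M(j).@[unit_point i1] = if j == i1 then 3%:R else 0) ->
  (forall j, f2^`M(j).@[unit_point i1] = (j == i2)%:R) ->
  [\/ exists a b, forall i, H i = a i *: f1 + b i *: f2,
      forall i j, j != i1 -> j != i2 -> (H i)^`M(j) = 0 |
      exists l mu j0 a b c,
        [/\ l \is 1.-homog, varfree i1 l, j0 != i1, j0 != i2 & l^`M(j0) != 0] /\
        let z := 'X_i1 + 2%:R * l + mu%:MP * 'X_i2 in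
        let l1 := 'X_i1 - l - mu%:MP * 'X_i2 in
        forall i, H i = z * ((a i)%:MP * (l1 * l1) + (b i)%:MP * (l1 * 'X_i2)
                             + (c i)%:MP * ('X_i2 * 'X_i2))].
Proof.
move=> V1 V2 g1 g2; set T : {mpoly K[n]} := 'X_i1; set S : {mpoly K[n]} := 'X_i2.
have T1 : T \is 1.-homog := dhomogXU _ i1.
have S1 : S \is 1.-homog := dhomogXU _ i2.
have S2 : S * S \is 2.-homog := dhomogM S1 S1.
have fS : varfree i1 S by apply: freeX; rewrite eq_sym.
have neq21 : i2 != i1 by rewrite eq_sym.
have hom01 : (0 : {mpoly K[n]}) \is 1.-homog by apply: dhomog0.
have [A [C [A2 C3 fA fC f1_eq]]] : exists A C, [/\ A \is 2.-homog, C \is 3.-homog,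
    varfree i1 A, varfree i1 C & f1 = T * T * T + T * A + C].
  have [a [b [A [C [f1_eq [b1 A2 C3] [fb fA fC]]]]]] := cubic_split i1 (V_cubic V1).
  have grad j := cubic_split_grad a j b1 A2 C3 fb fA fC.
  rewrite -f1_eq in grad; exists A, C; split=> //.
  have b0 : b = 0.
    apply: (linear_grad_eq (i := i1)) => // j; rewrite mderiv0 meval0.
    have [->|neq] := eqVneq j i1; first by rewrite mderiv_free // meval0.
    by move: (grad j); rewrite g1 (negPf neq).
  have a1 : a = 1.
    move: (grad i1); rewrite g1 eqxx -{1}[3%:R]mulr1 => /(mulfI (nat3_neq0 char_K)).
    by [].
  by rewrite f1_eq b0 a1 /T; ring.
have [B [D [B2 D3 fB fD f2_eq]]] : exists B D, [/\ B \is 2.-homog, D \is 3.-homog,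
    varfree i1 B, varfree i1 D & f2 = T * T * S + T * B + D].
  have [a [b [B [D [f2_eq [b1 B2 D3] [fb fB fD]]]]]] := cubic_split i1 (V_cubic V2).
  have grad j := cubic_split_grad a j b1 B2 D3 fb fB fD.
  rewrite -f2_eq in grad; exists B, D; split=> //.
  have b0 : b = S.
    apply: (linear_grad_eq (i := i1)) => // j; rewrite mderivXU -mpolyC_nat mevalC.
    have [->|neq] := eqVneq j i1; first by rewrite mderiv_free // meval0 (negPf neq12).
    by move: (grad j); rewrite g2 (negPf neq).
  have a0 : a = 0.
    move: (grad i1); rewrite g2 eqxx (negPf neq12) => /esym/eqP.
    by rewrite mulf_eq0 (negPf (nat3_neq0 char_K)) => /eqP.
  by rewrite f2_eq b0 a0 /T; ring.
have /fin_all_exists[x x_spec] : forall i, exists x : K * K * K * {mpoly K[n]},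
    let: (a, b, la, E) := x in
    [/\ H i = a *: f1 + b *: f2 + la *: (T * (S * S)) + E,
        E \is 3.-homog, varfree i1 E, V (la%:MP * (T * (S * S)) + E) &
        forall j, j != i1 -> j != i2 -> E^`M(j) = B^`M(j) * (la%:MP * (S * S))^`M(i2)].
  (* [a] and [b] cancel the derivatives in x1 and x2 at the point. The minor of f1, f2, [g] in the
     columns x1, x2, xj, evaluated there, is then 3 times the derivative of [g] in xj. *)
  move=> i; pose a := (H i)^`M(i1).@[unit_point i1] / 3%:R.
  pose b := (H i)^`M(i2).@[unit_point i1]; pose g := H i - a *: f1 - b *: f2.
  have Vg : V g.
    have -> : g = 1%:MP * (1%:MP * H i + (- a)%:MP * f1) + (- b)%:MP * f2.
      by rewrite /g -!mul_mpolyC !mpolyCN mpolyC1; ring.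
    by do !apply: V_comb.
  have [a' [b' [q [E [g_eq [b1 q2 E3] [fb fq fE]]]]]] := cubic_split i1 (V_cubic Vg).
  have grad j := cubic_split_grad a' j b1 q2 E3 fb fq fE.
  rewrite -g_eq in grad.
  have gradg j : g^`M(j).@[unit_point i1] = (H i)^`M(j).@[unit_point i1]
     - a * (if j == i1 then 3%:R else 0) - b * (j == i2)%:R.
    by rewrite /g !mderivB !mderivZ !mevalB !mevalZ g1 g2.
  have a'0 : a' = 0.
    move: (grad i1); rewrite gradg eqxx (negPf neq12) mulr0 subr0 divfK ?nat3_neq0 //.
    by rewrite subrr => /esym/eqP; rewrite mulf_eq0 (negPf (nat3_neq0 char_K)) => /eqP.
  have g_i2 : g^`M(i2).@[unit_point i1] = 0.
    by rewrite gradg eqxx (negPf neq21) mulr0 subr0 mulr1 subrr.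
  have b'0 : b' = 0.
    apply: (linear_grad_eq (i := i1)) => // j; rewrite mderiv0 meval0.
    have [->|neq1] := eqVneq j i1; first by rewrite mderiv_free // meval0.
    have := grad j; rewrite (negPf neq1) => <-.
    have [->//|neq2] := eqVneq j i2.
    have := congr1 (meval (unit_point i1)) (V_dep V1 V2 Vg i1 i2 j).
    rewrite jac3_meval !g1 !g2 !eqxx (negPf neq12) (negPf neq21) (negPf neq1) (negPf neq2).
    rewrite g_i2 meval0 /det3 /= mulr1n => det0; have n3 := nat3_neq0 char_K.
    by apply: (mulfI n3); rewrite mulr0 -[RHS]det0; ring.
  have {}g_eq : g = T * q + E by rewrite g_eq a'0 b'0 /T; ring.
  have dep := V_dep V1 V2 Vg; rewrite f1_eq f2_eq g_eq in dep.
  have cols j (neq1 : j != i1) (neq2 : j != i2) :=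
    dep_columns char_K neq12 neq1 neq2 fA fB fC fD fq fE dep.
  have dq j : j != i2 -> q^`M(j) = 0.
    move=> neq2; have [->|neq1] := eqVneq j i1; first exact: mderiv_free.
    by have [] := cols _ neq1 neq2.
  have [la la_eq] := dhomog_one_var char_K (isT : (2 < 5)%N) q2 dq.
  have q_eq : q = la%:MP * (S * S) by rewrite la_eq mul_mpolyC.
  exists (a, b, la, E); split=> //.
  - have -> : H i = g + a *: f1 + b *: f2 by rewrite /g -!mul_mpolyC; ring.
    by rewrite g_eq q_eq -!mul_mpolyC; ring.
  - by have -> : la%:MP * (T * (S * S)) + E = g by rewrite g_eq q_eq; ring.
  - by move=> j neq1 neq2; have [_ -> _] := cols _ neq1 neq2; rewrite q_eq.
pose a i := (x i).1.1.1; pose b i := (x i).1.1.2; pose la i := (x i).1.2.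
pose E i := (x i).2.
have spec i : [/\ H i = a i *: f1 + b i *: f2 + la i *: (T * (S * S)) + E i,
    E i \is 3.-homog, varfree i1 (E i), V ((la i)%:MP * (T * (S * S)) + E i) &
    forall j, j != i1 -> j != i2 ->
      (E i)^`M(j) = B^`M(j) * ((la i)%:MP * (S * S))^`M(i2)].
  by move: (x_spec i); rewrite /a /b /la /E; case: (x i) => [[[? ?] ?] ?].
clearbody a b la E => {x x_spec}.
have dT j : j != i1 -> T^`M(j) = 0 by move=> /negPf neq; rewrite mderivXU neq.
have dS j : j != i2 -> S^`M(j) = 0 by move=> /negPf neq; rewrite mderivXU neq.
have all_free : (forall j, j != i1 -> j != i2 ->
     [/\ A^`M(j) = 0, B^`M(j) = 0, C^`M(j) = 0 & D^`M(j) = 0]) ->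
   forall i j, j != i1 -> j != i2 -> (H i)^`M(j) = 0.
  move=> ABCD i j neq1 neq2; have [-> _ _ _ dE] := spec i.
  have [Aj Bj Cj Dj] := ABCD _ neq1 neq2.
  rewrite !(mderivD, mderivZ) dE // Bj mul0r f1_eq f2_eq.
  rewrite !(mderivD, mderivM) (dT _ neq1) (dS _ neq2) Aj Bj Cj Dj.
  by rewrite !(mul0r, mulr0, addr0, scaler0).
(* Such an element of V is a nonzero multiple of x2^3, the situation of [dep_cube]. *)
have cube g : V g -> varfree i1 g -> (forall j, j != i1 -> j != i2 -> g^`M(j) = 0) ->
    g != 0 -> forall j, j != i1 -> j != i2 ->
     [/\ A^`M(j) = 0, B^`M(j) = 0, C^`M(j) = 0 & D^`M(j) = 0].
  move=> Vg fg dg g_neq0 j neq1 neq2.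
  have dg' k : k != i2 -> g^`M(k) = 0.
    by move=> neq; have [->|neq'] := eqVneq k i1; [exact: mderiv_free|exact: dg].
  have [e g_eq] := dhomog_one_var char_K (isT : (3 < 5)%N) (V_cubic Vg) dg'.
  have e_neq0 : e != 0 by apply: contraNneq g_neq0 => e0; rewrite g_eq e0 scale0r.
  have dep := V_dep V1 V2 Vg; rewrite f1_eq f2_eq g_eq in dep.
  apply: (dep_cube char_K neq12 e_neq0 neq1 neq2 fA fB fC fD).
  by rewrite (_ : 'X_i2 * 'X_i2 * 'X_i2 = 'X_i2 ^+ 3) //; ring.
have [/existsP[i0 la0]|] := boolP [exists i, la i != 0]; last first.
  rewrite negb_exists => /forallP la0.
  have {}la0 i : la i = 0 by apply/eqP; move: (la0 i); rewrite negbK.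
  have [/existsP[i0 E0]|] := boolP [exists i, E i != 0]; last first.
    rewrite negb_exists => /forallP E0; constructor 1; exists a, b => i.
    have [-> _ _ _ _] := spec i; move: (E0 i); rewrite negbK => /eqP ->.
    by rewrite la0 scale0r !addr0.
  constructor 2; apply: all_free; have [_ _ fE VE dE] := spec i0.
  apply: (cube (E i0)) => //; first by move: VE; rewrite la0 mpolyC0 mul0r add0r.
  by move=> j neq1 neq2; rewrite dE // la0 mpolyC0 mul0r mderiv0 mulr0.
have [_ E3 fE VE dE] := spec i0.
pose E' := (la i0)^-1%:MP * E i0.
have E'3 : E' \is 3.-homog by rewrite /E' mul_mpolyC dhomogZ.
have fE' : varfree i1 E' by apply: freeM => //; apply: freeC.
have la_inv : (la i0)^-1%:MP * (la i0)%:MP = 1 :> {mpoly K[n]}.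
  by rewrite -mpolyCM mulVf // mpolyC1.
have VE' : V (T * (S * S) + E').
  have -> : T * (S * S) + E' = (la i0)^-1%:MP * ((la i0)%:MP * (T * (S * S)) + E i0)
     + 0%:MP * f1.
    transitivity ((la i0)^-1%:MP * (la i0)%:MP * (T * (S * S)) + E').
      by rewrite la_inv mul1r.
    by rewrite /E' mpolyC0; ring.
  exact: V_comb.
have dep := V_dep V1 V2 VE'; rewrite f1_eq f2_eq in dep.
have := pencil_normal_form char_K neq12 A2 B2 C3 D3 E'3 fA fB fC fD fE' dep.
case=> [ABCDE|[l [mu [al [be [j0 [[l1 fl neq1 neq2 lj0] /= [f3_eq f2_eq' f1_eq']]]]]]]].
  by constructor 2; apply: all_free => j neq1 neq2; have [] := ABCDE _ neq1 neq2.
(* Otherwise the difference is a nonzero multiple of x2^3 in V, and [cube] gives B_j0 = 0, hence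
   E'_j0 = 0. This contradicts E' = x2^2 (z - x1), because l_j0 is nonzero. *)
have Ei i : E i = (la i)%:MP * E'.
  have [_ Ei3 fEi VEi dEi] := spec i.
  apply/eqP; rewrite -subr_eq0; apply/contraT => R_neq0.
  have VR : V (E i - (la i)%:MP * E').
    have -> : E i - (la i)%:MP * E' = 1%:MP * ((la i)%:MP * (T * (S * S)) + E i)
       + (- la i)%:MP * (T * (S * S) + E').
      by rewrite mpolyC1 mpolyCN; ring.
    exact: V_comb.
  have fR : varfree i1 (E i - (la i)%:MP * E').
    by apply: freeD => //; apply: freeN; apply: freeM => //; apply: freeC.
  have dR j : j != i1 -> j != i2 -> (E i - (la i)%:MP * E')^`M(j) = 0.
    move=> neqj1 neqj2; rewrite /E' !mderivE dEi // dE // !mderivE eqxx.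
    transitivity (B^`M(j) * (S * S)^`M(i2) * (la i)%:MP * (1 - (la i0)^-1%:MP * (la i0)%:MP)).
      by rewrite /S !mderivE eqxx; ring.
    by rewrite la_inv subrr mulr0.
  have [_ Bj0 _ _] := cube _ VR fR dR R_neq0 j0 neq1 neq2.
  have E'j0 : E'^`M(j0) = 0.
    by rewrite /E' !mderivE dE // Bj0; ring.
  clearbody E'; move: f3_eq; rewrite -mpolyC_nat => /(congr1 (mderiv j0)).
  rewrite !(mderivD, mderivM, mderivC) (dT _ neq1) (dS _ neq2) E'j0.
  rewrite mpolyC_nat => dz.
  have : 2%:R * (S * S) * l^`M(j0) = 0.
    transitivity (0 * (S * S) + T * (0 * S + S * 0) + 0 : {mpoly K[n]}).
      by rewrite dz /S; ring.
    by ring.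
  move=> /eqP; rewrite !mulf_eq0 (negPf lj0) (negPf (nat2R_neq0 n char_K)).
  by rewrite (negPf (mpolyXU_neq0 K i2)).
constructor 3; exists l, mu, j0, a, (fun i => a i * al + b i), (fun i => a i * be + la i).
split=> //= i; have [-> _ _ _ _] := spec i.
rewrite Ei -!mul_mpolyC f1_eq f2_eq f1_eq' !mpolyCD !mpolyCM.
transitivity ((a i)%:MP * (('X_i1 + 2%:R * l + mu%:MP * 'X_i2) *
   ('X_i1 - l - mu%:MP * 'X_i2) * ('X_i1 - l - mu%:MP * 'X_i2)) +
   ((a i)%:MP * al%:MP + (b i)%:MP) * (T * T * S + T * B + D) +
   ((a i)%:MP * be%:MP + (la i)%:MP) * (T * (S * S) + E')).
  by rewrite /T /S; ring.
by rewrite f3_eq f2_eq' /T /S; ring.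
Qed.

End CubicSpaces.

(** Since x - A divides x^k - A^k = x^k, taking determinants shows that the characteristic
    polynomial divides a power of X. It is then itself a power of X, and its coefficient below the
    leading one, minus the trace, vanishes. *)
Lemma nilpotent_trace0 (F : fieldType) (n k : nat) (A : 'M[F]_n) :
  A ^+ k = 0 -> \tr A = 0.
Proof.
case: n A => [|n] A Ak0; first by rewrite /mxtrace big_ord0.
pose B := map_mx (@polyC F) A; pose x : 'M[{poly F}]_n.+1 := 'X%:M.
have comm_xB : GRing.comm x B by apply/esym; apply: scalar_mxC.
have Bk0 : B ^+ k = 0 by rewrite -(rmorphXn (map_mx (@polyC F))) Ak0 rmorph0.
have : char_poly A %| 'X^(k * n.+1).
  have := subrXX_comm k comm_xB; rewrite Bk0 subr0 => xk.
  rewrite exprM -det_scalar rmorphXn -/x xk det_mulmx; exact: dvdp_mulIl.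
rewrite -[X in _ %| X ^+ _]subr0 -polyC0 => /dvdp_exp_XsubCP[m _].
rewrite polyC0 subr0 => eqp_char.
have char_eq : char_poly A = 'X^m.
  by apply/eqP; rewrite -eqp_monic ?char_poly_monic ?monicXn.
have m_eq : m = n.+1.
  by have := size_char_poly A; rewrite char_eq size_polyXn => -[].
have := char_poly_trace A (ltn0Sn n); rewrite char_eq m_eq coefXn /= => /eqP.
by rewrite ltn_eqF //= eq_sym oppr_eq0 => /eqP.
Qed.

(** * Linear changes of coordinates *)

Section LinearChange.

Variables (K : fieldType) (n : nat).
Implicit Types (p q : {mpoly K[n]}) (i j k : 'I_n) (T U : 'M[K]_n).

Definition lin_subst T p : {mpoly K[n]} :=
  p \mPo [tuple (constmx n T *m vars) i 0 | i < n].

HB.instance Definition _ T := GRing.RMorphism.copy (lin_subst T)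
  (comp_mpoly [tuple (constmx n T *m vars) i 0 | i < n]).

Lemma constmxE (m p : nat) (A : 'M[K]_(m, p)) a b : constmx n A a b = (A a b)%:MP.
Proof. by rewrite mxE. Qed.

Lemma lin_formE T i : (constmx n T *m vars) i 0 = \sum_j (T i j)%:MP * 'X_j.
Proof. by rewrite mxE; apply: eq_bigr => j _; rewrite !mxE. Qed.

Lemma lin_subst_var T i : lin_subst T 'X_i = \sum_j (T i j)%:MP * 'X_j.
Proof. by rewrite /lin_subst comp_mpoly_var lin_formE. Qed.

Lemma lin_substC T c : lin_subst T c%:MP = c%:MP.
Proof. exact: comp_mpolyC. Qed.

Lemma lin_subst_comp T U p : lin_subst T (lin_subst U p) = lin_subst (U *m T) p.
Proof.
rewrite /lin_subst comp_mpoly_comp; apply: eq_comp_mpoly => i.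
rewrite !lin_formE raddf_sum /=.
under eq_bigr => j _ do rewrite comp_mpolyM comp_mpolyC -/(lin_subst T 'X_j)
  lin_subst_var mulr_sumr.
rewrite exchange_big /=; apply: eq_bigr => j _; rewrite mxE raddf_sum mulr_suml.
by apply: eq_bigr => k _; rewrite mulrA -mpolyCM.
Qed.

Lemma lin_subst1 p : lin_subst 1%:M p = p.
Proof.
rewrite -[RHS]comp_mpoly_id; apply: eq_comp_mpoly => i.
rewrite lin_formE (bigD1 i) //= mxE eqxx mul1r big1 ?addr0 // => j neq.
by rewrite mxE eq_sym (negPf neq) mpolyC0 mul0r.
Qed.

Lemma lin_subst_homog d T p : p \is d.-homog -> lin_subst T p \is d.-homog.
Proof.
apply: dhomog_comp => i; rewrite lin_formE; apply: rpred_sum => j _.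
by rewrite mul_mpolyC dhomogZ // dhomogXU.
Qed.

Lemma mderiv_lin_subst T p j :
  (lin_subst T p)^`M(j) = \sum_i lin_subst T p^`M(i) * (T i j)%:MP.
Proof.
rewrite /lin_subst mderiv_comp; apply: eq_bigr => i _; congr (_ * _).
rewrite lin_formE raddf_sum /= (bigD1 j) //= mderiv_mulC mderivXU eqxx mulr1.
by rewrite big1 ?addr0 // => k neq; rewrite mderiv_mulC mderivXU eq_sym (negPf neq) mulr0.
Qed.

Lemma constmxM (a b c : nat) (A : 'M[K]_(a, b)) (B : 'M[K]_(b, c)) :
  constmx n (A *m B) = constmx n A *m constmx n B.
Proof. exact: map_mxM. Qed.

Lemma constmx1 (a : nat) : constmx n (1%:M : 'M[K]_a) = 1%:M.
Proof. exact: map_mx1. Qed.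

Lemma lin_conjE T (H : polymap K n) i :
  lin_conj T H i 0 = \sum_j (invmx T i j)%:MP * lin_subst T (H j 0).
Proof. by rewrite mxE; apply: eq_bigr => j _; rewrite !mxE. Qed.

Lemma pcomp_constmx (A : 'M[K]_n) (F G : polymap K n) :
  pcomp (constmx n A *m F) G = constmx n A *m pcomp F G.
Proof.
apply/matrixP => i j; rewrite !mxE raddf_sum; apply: eq_bigr => k _ /=.
by rewrite comp_mpolyM !mxE comp_mpolyC.
Qed.

Lemma pcompA (F G E : polymap K n) : pcomp (pcomp F G) E = pcomp F (pcomp G E).
Proof.
apply/matrixP => i j; rewrite !mxE comp_mpoly_comp; apply: eq_comp_mpoly => k.
by rewrite mxE.
Qed.

Lemma pcomp_var (F : polymap K n) : pcomp vars F = F.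
Proof. by apply/matrixP => i j; rewrite !mxE comp_mpoly_var ord1. Qed.

Lemma lin_conj_mapE T (H : polymap K n) :
  lin_conj T H = constmx n (invmx T) *m map_mx (lin_subst T) H.
Proof. by []. Qed.

Lemma map_lin_subst_constmx (a b : nat) T (A : 'M[K]_(a, b)) :
  map_mx (lin_subst T) (constmx n A) = constmx n A.
Proof. by apply/matrixP => i j; rewrite !mxE lin_substC. Qed.

Lemma map_lin_substM (a b c : nat) T (A : 'M[{mpoly K[n]}]_(a, b)) (B : 'M_(b, c)) :
  map_mx (lin_subst T) (A *m B) = map_mx (lin_subst T) A *m map_mx (lin_subst T) B.
Proof. exact: (map_mxM (lin_subst T)). Qed.

Lemma lin_conj_comp T U (H : polymap K n) : T \in unitmx -> U \in unitmx ->
  lin_conj T (lin_conj U H) = lin_conj (U *m T) H.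
Proof.
move=> Tu Uu; have UTu : U *m T \in unitmx by rewrite unitmx_mul Uu.
have inv_eq : invmx T *m invmx U = invmx (U *m T).
  rewrite -[LHS]mulmx1 -(mulmxV UTu) !mulmxA (mulmxKV Uu) mulVmx //.
  by rewrite mul1mx.
have subst_eq : map_mx (lin_subst T) (map_mx (lin_subst U) H) =
    map_mx (lin_subst (U *m T)) H.
  by apply/matrixP => i j; rewrite [RHS]mxE mxE mxE; apply: lin_subst_comp.
rewrite lin_conj_mapE [RHS]lin_conj_mapE -inv_eq (constmxM (invmx T)) -mulmxA.
have subst_prod := map_lin_substM T (constmx n (invmx U)) (map_mx (lin_subst U) H).
have factors := congr2 (fun A B => A *m B) (map_lin_subst_constmx T (invmx U)) subst_eq.
exact: congr1 (etrans subst_prod factors).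
Qed.

Lemma jacobian_lin_conj T (H : polymap K n) :
  jacobian (lin_conj T H) =
  constmx n (invmx T) *m map_mx (lin_subst T) (jacobian H) *m constmx n T.
Proof.
apply/matrixP => i j; rewrite mxE lin_conjE raddf_sum mxE /=.
under eq_bigr => k _ do rewrite mderiv_mulC mderiv_lin_subst mulr_sumr.
rewrite exchange_big; apply: eq_bigr => l _ /=; rewrite mxE mulr_suml !mxE.
by apply: eq_bigr => k _; rewrite !mxE mulrA.
Qed.

Lemma cubic_lin_conj T (H : polymap K n) :
  cubic_homogeneous H -> cubic_homogeneous (lin_conj T H).
Proof.
move=> H_cubic i; rewrite lin_conjE; apply: rpred_sum => j _.
by rewrite mul_mpolyC dhomogZ // lin_subst_homog.
Qed.

(** Arbitrary polynomial factors A and B, instead of selections of rows and columns, make the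
    condition stable under multiplication on either side. *)
Definition rank_le2 (J : 'M[{mpoly K[n]}]_n) : Prop :=
  forall (A : 'M_(3, n)) (B : 'M_(n, 3)), \det (A *m J *m B) = 0.

Lemma rank_le2_lin_conj T (H : polymap K n) : T \in unitmx ->
  rank_le2 (jacobian H) -> rank_le2 (jacobian (lin_conj T H)).
Proof.
move=> Tu J2 A B; rewrite jacobian_lin_conj.
(* The factors around the substituted Jacobian are themselves images under the substitution, since
   [invmx T] inverts it. *)
have subK (a b : nat) (M : 'M[{mpoly K[n]}]_(a, b)) :
    M = map_mx (lin_subst T) (map_mx (lin_subst (invmx T)) M).
  by apply/matrixP => x y; rewrite !mxE lin_subst_comp mulVmx // lin_subst1.
rewrite !mulmxA -(mulmxA _ (constmx n T)) (subK _ _ (A *m _)) (subK _ _ (_ *m B)).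
by rewrite -!map_lin_substM (det_map_mx (lin_subst T)) J2 rmorph0.
Qed.

Lemma det_minor_eq0 r (H : polymap K n) (A : 'M_(r, n)) (B : 'M_(n, r)) :
  (rkJ H < r)%N -> \det (A *m jacobian H *m B) = 0.
Proof.
move=> rk_lt; apply/eqP; rewrite -tofrac_eq0 -det_map_mx !map_mxM.
apply/contraT; rewrite -unitfE -unitmxE => /mxrank_unit.
set FA := map_mx _ A; set FB := map_mx _ B => rk_eq.
have := leq_trans (mxrankM_maxl (FA *m ratmx (jacobian H)) FB)
  (mxrankM_maxr FA (ratmx (jacobian H))).
by rewrite rk_eq leqNgt rk_lt.
Qed.

Lemma rkJ_rank_le2 (H : polymap K n) : (rkJ H <= 2)%N -> rank_le2 (jacobian H).
Proof. by move=> rk2 A B; apply: det_minor_eq0. Qed.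

Lemma nilpotent_trace_jac (J : 'M[{mpoly K[n]}]_n) : nilpotent_mx J ->
  \tr J = 0 /\ \tr (J *m J) = 0.
Proof.
case=> k Jk0; pose F := map_mx (@tofrac {mpoly K[n]}) J.
have Fk0 : F ^+ k = 0.
  have map_exp e : map_mx (@tofrac {mpoly K[n]}) (J ^+ e) = F ^+ e.
    elim: e => [|e IHe]; first exact: map_mx1.
    rewrite !exprS -IHe; exact: map_mxM.
  by rewrite -map_exp Jk0; exact: map_mx0.
have tr_eq0 (M : 'M[{mpoly K[n]}]_n) : \tr (map_mx (@tofrac _) M) = 0 -> \tr M = 0.
  by rewrite trace_map_mx => /eqP; rewrite tofrac_eq0 => /eqP.
split; apply: tr_eq0; first exact: (nilpotent_trace0 Fk0).
apply: (@nilpotent_trace0 _ _ k); rewrite map_mxM -/F.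
have -> : F *m F = F ^+ 2 by [].
by rewrite -exprM mulnC exprM Fk0 expr0n.
Qed.

Lemma trace_lin_conj T (H : polymap K n) : T \in unitmx ->
  \tr (jacobian H) = 0 -> \tr (jacobian H *m jacobian H) = 0 ->
  \tr (jacobian (lin_conj T H)) = 0 /\
  \tr (jacobian (lin_conj T H) *m jacobian (lin_conj T H)) = 0.
Proof.
move=> Tu tr1 tr2; rewrite jacobian_lin_conj.
set J := map_mx _ _; set C := constmx n T; set D := constmx n (invmx T).
have CD : C *m D = 1%:M by rewrite -constmxM mulmxV // constmx1.
split; first by rewrite mxtrace_mulC mulmxA CD mul1mx (trace_map_mx (lin_subst T)) tr1 rmorph0.
rewrite !mulmxA -(mulmxA _ C) CD mulmx1 mxtrace_mulC !mulmxA CD mul1mx -map_lin_substM.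
by rewrite (trace_map_mx (lin_subst T)) tr2 rmorph0.
Qed.

End LinearChange.

(** Forms A and vectors B in duality are moved simultaneously to the first coordinates and the first
    basis vectors: [T1] straightens A and leaves the vectors as (1, nu), and the lower shear [S]
    absorbs nu without disturbing A. *)
Lemma complete_dual_pair (F : fieldType) (r k : nat) (A : 'M[F]_(r, r + k))
    (B : 'M_(r + k, r)) : A *m B = 1%:M ->
  exists2 T, T \in unitmx & A *m T = row_mx 1%:M 0 /\ T *m col_mx 1%:M 0 = B.
Proof.
move=> AB1.
have rkA : \rank A = r.
  apply/eqP; rewrite eqn_leq rank_leq_row /=.
  by rewrite -[X in (X <= _)%N](mxrank1 F r) -AB1 mxrankM_maxl.
pose L := col_ebase A; pose R := row_ebase A.
have Lu : L \in unitmx by apply: col_ebase_unit.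
have Ru : R \in unitmx by apply: row_ebase_unit.
have A_eq : A = L *m row_mx 1%:M 0 *m R.
  rewrite -[LHS]mulmx_ebase rkA; congr (_ *m _ *m _).
  apply/matrixP => i j; rewrite !mxE; case: splitP => l l_eq; rewrite mxE.
    by rewrite l_eq ltn_ord andbT.
  have neq : (i == j :> nat) = false by rewrite l_eq; apply/ltn_eqF/ltn_addr.
  by rewrite neq.
pose T1 := invmx R *m block_mx (invmx L) 0 0 1%:M.
have AT1 : A *m T1 = row_mx 1%:M 0.
  rewrite A_eq /T1 mulmxA (mulmxK Ru) -mulmxA mul_row_block.
  by rewrite !(mul1mx, mul0mx, mulmx0, addr0) mul_mx_row mulmxV // mulmx0.
have T1u : T1 \in unitmx.
  rewrite unitmx_mul unitmx_inv Ru /= unitmxE det_ublock det1 mulr1 -unitmxE.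
  by rewrite unitmx_inv.
pose X := invmx T1 *m B; pose nu := dsubmx X.
have X_eq : X = col_mx 1%:M nu.
  rewrite -[LHS]vsubmxK; congr col_mx.
  have : A *m T1 *m X = 1%:M by rewrite -mulmxA mulKVmx.
  by rewrite AT1 -{1}[X]vsubmxK mul_row_col mul1mx mul0mx addr0.
pose S := block_mx (1%:M : 'M[F]_r) 0 nu (1%:M : 'M_k).
exists (T1 *m S); first by rewrite unitmx_mul T1u unitmxE det_lblock !det1 mulr1 unitr1.
split; first by rewrite mulmxA AT1 mul_row_block !(mul1mx, mul0mx, mulmx0, addr0).
rewrite -mulmxA mul_block_col !(mul1mx, mulmx1, mul0mx, mulmx0, addr0) -X_eq.
by rewrite mulKVmx.
Qed.

Lemma det_mx22 (R : comRingType) (M : 'M[R]_2) :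
  \det M = M 0 0 * M 1 1 - M 0 1 * M 1 0.
Proof.
rewrite (expand_det_row _ 0) !big_ord_recl big_ord0 /cofactor !det_mx11 !mxE /=.
have -> : lift 0 0 = 1 :> 'I_2 by apply: val_inj.
have -> : lift 1 0 = 0 :> 'I_2 by apply: val_inj.
have -> : ord0 = 0 :> 'I_2 by [].
by rewrite /bump /= expr0 expr1; ring.
Qed.

Lemma det_mx33 (R : comRingType) (f : nat -> nat -> R) :
  \det (\matrix_(i < 3, j < 3) f i j) =
  det3 (f 0%N 0%N) (f 0%N 1%N) (f 0%N 2%N) (f 1%N 0%N) (f 1%N 1%N) (f 1%N 2%N)
    (f 2%N 0%N) (f 2%N 1%N) (f 2%N 2%N).
Proof.
rewrite (expand_det_row _ ord0) !big_ord_recl big_ord0 /cofactor.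
rewrite !(expand_det_row _ ord0) !big_ord_recl !big_ord0 /cofactor !det_mx11 !mxE.
rewrite /det3 /= /bump /= !(expr0, expr1, exprS, addn0, add0n).
by ring.
Qed.

(** * Coordinates at a point of rank two *)

Section Coordinates.

Variable K : fieldType.
Hypothesis char_K : (6%:R : K) \is a GRing.unit.

Lemma meval_unit_homog n d (p : {mpoly K[n]}) i : p \is d.-homog ->
  p.@[unit_point K i] = p@_(U_(i) *+ d).
Proof.
move=> p_homog; rewrite mevalE (mpolyE p) raddf_sum /= -mpolyE !big_seq.
apply: eq_bigr => m m_p; rewrite mcoeffZ mcoeffX; congr (_ * _).
have [->|m_neq] := eqVneq m (U_(i) *+ d)%MM.
  rewrite big1 // => j _; rewrite mulmnE mnm1E /unit_point eq_sym.
  by case: eqP => _; rewrite ?expr1n // mul0n expr0.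
have [j neq_j m_j] : exists2 j, j != i & m j != 0%N.
  apply/exists_inP; apply: contraNT m_neq; rewrite negb_exists_in => /forall_inP m0.
  have {}m0 j : j != i -> m j = 0%N by move=> /m0; rewrite negbK => /eqP.
  apply/eqP/mnmP => j; rewrite mulmnE mnm1E eq_sym.
  have [->|neq] := eqVneq j i; last by rewrite m0.
  by rewrite mul1n -(dhomog_mf p_homog m_p) /= mdegE (bigD1 i) //= big1 ?addn0 //.
by rewrite (bigD1 j) //= /unit_point (negPf neq_j) expr0n (negPf m_j) mul0r.
Qed.

(** If all these Wronskians vanish, a nonzero H_j times the Jacobian is the column H times a single
    row, so the rank is at most 1. A nonzero one has degree 5, and the exponent 5 needs separate
    care. *)
Lemma rank_ge2_point n (H : polymap K n) : cubic_homogeneous H ->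
  (2 <= rkJ H)%N ->
  exists i j m (a : 'I_n -> K),
    (H i 0 * (H j 0)^`M(m) - H j 0 * (H i 0)^`M(m)).@[a] != 0.
Proof.
move=> H_cubic rk_ge2; pose W i j m := H i 0 * (H j 0)^`M(m) - H j 0 * (H i 0)^`M(m).
have [/existsP[i /existsP[j /existsP[m W_neq0]]]|W_eq0] :=
    boolP [exists i, exists j, exists m, W i j m != 0]; last first.
  have {}W_eq0 i j m : H i 0 * (H j 0)^`M(m) = H j 0 * (H i 0)^`M(m).
    move: W_eq0; rewrite negb_exists => /forallP/(_ i).
    rewrite negb_exists => /forallP/(_ j); rewrite negb_exists => /forallP/(_ m).
    by rewrite negbK subr_eq0 => /eqP.
  move: rk_ge2; rewrite leqNgt ltnS => /negP[].
  have [/existsP[j Hj]|] := boolP [exists j, H j 0 != 0].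
    pose h : {fraction {mpoly K[n]}} := tofrac (H j 0).
    have h_neq0 : h != 0 by rewrite tofrac_eq0.
    have -> : rkJ H = \rank (h *: ratmx (jacobian H)).
      by rewrite /rkJ (eqmx_scale _ h_neq0).
    have -> : h *: ratmx (jacobian H) =
       map_mx (@tofrac _) H *m row j (ratmx (jacobian H)).
      apply/matrixP => i m; rewrite !mxE big_ord1 !mxE -!rmorphM /=.
      by congr tofrac; rewrite W_eq0.
    exact: leq_trans (mxrankM_maxr _ _) (rank_leq_row _).
  rewrite negb_exists => /forallP H0.
  suff -> : rkJ H = 0%N by [].
  rewrite /rkJ (_ : ratmx _ = 0) ?mxrank0 //; apply/matrixP => i j; rewrite !mxE.
  by have := H0 i; rewrite negbK => /eqP ->; rewrite mderiv0 rmorph0.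
have W5 : W i j m \is 5.-homog.
  rewrite rpredB // ?(@dhomogM _ _ _ 3 _ 2) //; try exact: H_cubic;
  exact: mderiv_dhomog (H_cubic _).
exists i, j, m; have [/existsP[k Wk]|] := boolP [exists k, (W i j m).@[unit_point K k] != 0].
  by exists (unit_point K k).
rewrite negb_exists => /forallP Wk0; apply: (nonvanishing_point char_K W_neq0).
(* An exponent 5 leaves only the monomial x_k^5, whose coefficient is the value of the Wronskian at
   a basis vector. *)
move=> e e_W k; rewrite ltnNge; apply/negP => e_ge5.
have mdeg_e := dhomog_mf W5 e_W.
have e_eq : e = (U_(k) *+ 5)%MM.
  apply/mnmP => l; rewrite mulmnE mnm1E eq_sym.
  move: mdeg_e; rewrite /= mdegE (bigD1 k) //=.
  have [->|neq] := eqVneq l k; first by rewrite mul1n; lia.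
  by rewrite (bigD1 l) //= mul0n; lia.
have := Wk0 k; rewrite negbK (meval_unit_homog _ W5) -e_eq.
by apply/negP; rewrite -mcoeff_msupp.
Qed.

Definition span n (H : polymap K n) (f : {mpoly K[n]}) : Prop :=
  exists c : 'I_n -> K, f = \sum_i (c i)%:MP * H i 0.

Lemma span_comb n (H : polymap K n) a b f g :
  span H f -> span H g -> span H (a%:MP * f + b%:MP * g).
Proof.
move=> [c ->] [d ->]; exists (fun i => a * c i + b * d i).
rewrite !mulr_sumr -big_split /=; apply: eq_bigr => i _.
by rewrite mpolyCD !mpolyCM mulrDl !mulrA.
Qed.

Lemma span_entry n (H : polymap K n) i : span H (H i 0).
Proof.
exists (fun j => (j == i)%:R); rewrite (bigD1 i) //= eqxx mpolyC1 mul1r.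
by rewrite big1 ?addr0 // => j /negPf ->; rewrite mpolyC0 mul0r.
Qed.

Lemma span_homog n (H : polymap K n) f : cubic_homogeneous H -> span H f ->
  f \is 3.-homog.
Proof.
move=> H_cubic [c ->]; apply: rpred_sum => i _.
by rewrite mul_mpolyC dhomogZ.
Qed.

Lemma span_dep n (H : polymap K n) f g h : rank_le2 (jacobian H) ->
  span H f -> span H g -> span H h -> jac_dep f g h.
Proof.
move=> rk2 [c1 ->] [c2 ->] [c3 ->] i j k.
pose c (r : nat) := nth c1 [:: c1; c2; c3] r; pose u (r : nat) := nth i [:: i; j; k] r.
rewrite -[RHS](rk2 (\matrix_(r < 3, l < n) (c r l)%:MP) (\matrix_(l < n, r < 3) (l == u r)%:R)).
pose F (r s : nat) := (\sum_l (c r l)%:MP * H l 0)^`M(u s).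
rewrite (_ : _ *m _ *m _ = \matrix_(r < 3, s < 3) F r s) ?det_mx33 //.
apply/matrixP => r s; rewrite !mxE (bigD1 (u s)) //= big1 ?addr0 => [|l neq].
  rewrite !mxE eqxx mulr1 /F raddf_sum; apply: eq_bigr => l _ /=.
  by rewrite !mxE mderiv_mulC.
by rewrite !mxE (negPf neq) mulr0.
Qed.

Lemma span_lin_conj n (H : polymap K n) T i : T \in unitmx ->
  span (lin_conj T H) (lin_subst T (H i 0)).
Proof.
move=> Tu; exists (T i); have : constmx n T *m lin_conj T H = map_mx (lin_subst T) H.
  by rewrite lin_conj_mapE mulmxA -constmxM mulmxV // constmx1 mul1mx.
move=> /matrixP/(_ i 0); rewrite !mxE => <-.
by apply: eq_bigr => j _; rewrite constmxE.
Qed.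

Lemma lin_subst_meval n T (p : {mpoly K[n]}) i :
  (lin_subst T p).@[unit_point K i] = p.@[fun l => T l i].
Proof.
rewrite /lin_subst comp_mpoly_meval; apply: meval_eq => l.
rewrite tnth_mktuple lin_formE raddf_sum (bigD1 i) //=.
rewrite mevalM mevalC mevalXU /unit_point eqxx mulr1 big1 ?addr0 // => j /negPf neq.
by rewrite mevalM mevalXU neq mulr0.
Qed.

(** The gradients of H_i and H_j at the point, paired with the vectors a and e_m, give a 2 x 2
    matrix whose determinant is 3 times the Wronskian, by Euler's identity. Its inverse provides the
    duality for [complete_dual_pair]. *)
Lemma rank2_coordinates k (H : polymap K (2 + k)) :
  cubic_homogeneous H -> rkJ H = 2%N ->
  exists2 T, T \in unitmx &
  exists f1 f2, [/\ span (lin_conj T H) f1, span (lin_conj T H) f2,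
   forall j, f1^`M(j).@[unit_point K (lshift k 0)] =
     if j == lshift k 0 then 3%:R else 0 &
   forall j, f2^`M(j).@[unit_point K (lshift k 0)] = (j == lshift k 1)%:R].
Proof.
move=> H_cubic rk2; have rk_ge2 : (2 <= rkJ H)%N by rewrite rk2.
have [i [j [m [a Wa]]]] := rank_ge2_point H_cubic rk_ge2.
pose s (r : 'I_2) := if r == 0 then i else j.
pose A0 : 'M_(2, 2 + k) := \matrix_(r, l) (H (s r) 0)^`M(l).@[a].
pose B : 'M_(2 + k, 2) := \matrix_(l, r) if r == 0 then a l else (l == m)%:R.
pose M := A0 *m B.
have M0 r : M r 0 = 3%:R * (H (s r) 0).@[a].
  have := congr1 (meval a) (euler (H_cubic (s r))).
  rewrite mevalM -mpolyC_nat mevalC raddf_sum /= => <-.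
  by rewrite mxE; apply: eq_bigr => l _; rewrite !mxE eqxx mevalM mevalXU mulrC.
have M1 r : M r 1 = (H (s r) 0)^`M(m).@[a].
  rewrite mxE (bigD1 m) //= !mxE eqxx mulr1 big1 ?addr0 // => l /negPf neq.
  by rewrite !mxE neq mulr0.
have Mu : M \in unitmx.
  rewrite unitmxE unitfE det_mx22 !M0 !M1 /s /=.
  have -> : 3%:R * (H i 0).@[a] * ((H j 0)^`M(m)).@[a] -
      ((H i 0)^`M(m)).@[a] * (3%:R * (H j 0).@[a]) =
     3%:R * (H i 0 * (H j 0)^`M(m) - H j 0 * (H i 0)^`M(m)).@[a].
    by rewrite mevalB !mevalM; ring.
  by rewrite mulf_neq0 // nat3_neq0.
have AB1 : invmx M *m A0 *m B = 1%:M by rewrite -mulmxA mulVmx.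
have [T Tu [AT TB]] := complete_dual_pair AB1; exists T => //.
have Ta l : T l (lshift k 0) = a l.
  have := congr1 (fun X : 'M_(2 + k, 2) => X l 0) TB.
  rewrite /= !mxE big_split_ord /= big_ord_recl big1 => [|q _].
    rewrite big1 => [|q _]; last by rewrite col_mxEd mxE mulr0.
    by rewrite col_mxEu mxE eqxx mulr1 !addr0.
  by rewrite col_mxEu mxE mulr0.
pose g r : {mpoly K[2 + k]} := \sum_q (invmx M r q)%:MP * H (s q) 0.
have span_g r : span (lin_conj T H) (lin_subst T (g r)).
  rewrite /g rmorph_sum; apply: (big_ind (span (lin_conj T H))).
  - by exists (fun=> 0); rewrite big1 // => l _; rewrite mpolyC0 mul0r.
  - move=> x y sx sy; have := span_comb 1 1 sx sy.
    by rewrite mpolyC1 !mul1r.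
  move=> q _; rewrite /= rmorphM /= lin_substC.
  have := span_comb (invmx M r q) 0 (span_lin_conj H (s q) Tu) (span_lin_conj H (s q) Tu).
  by rewrite mpolyC0 mul0r addr0.
have grad r l : (lin_subst T (g r))^`M(l).@[unit_point K (lshift k 0)] =
    (row_mx 1%:M 0 : 'M_(2, 2 + k)) r l.
  rewrite -AT mderiv_lin_subst raddf_sum mxE; apply: eq_bigr => p _ /=.
  rewrite mevalM mevalC lin_subst_meval (meval_eq _ Ta); congr (_ * _).
  rewrite /g (raddf_sum (mderiv p)) (raddf_sum (meval a)) mxE; apply: eq_bigr => q _ /=.
  by rewrite mderiv_mulC mevalM mevalC mxE.
(* The factor 3 makes the coefficient of x1^3 in f1 equal to 1. *)
exists ((3%:R)%:MP * lin_subst T (g 0)), (lin_subst T (g 1)); split=> //.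
- have := span_comb 3%:R 0 (span_g 0) (span_g 0).
  by rewrite mpolyC0 mul0r addr0.
- move=> l; rewrite mderiv_mulC mevalM mevalC grad.
  case: (splitP l) => q l_eq.
    have -> : l = lshift k q by apply: val_inj.
    by rewrite row_mxEl mxE (inj_eq (@lshift_inj _ _)) eq_sym; case: eqP => _; rewrite ?mulr1 ?mulr0.
  have -> : l = rshift 2 q by apply: val_inj.
  by rewrite row_mxEr mxE mulr0 eq_rlshift.
- move=> l; rewrite grad; case: (splitP l) => q l_eq.
    have -> : l = lshift k q by apply: val_inj.
    by rewrite row_mxEl mxE (inj_eq (@lshift_inj _ _)) eq_sym.
  have -> : l = rshift 2 q by apply: val_inj.
  by rewrite row_mxEr mxE eq_rlshift.
Qed.

End Coordinates.

(** * Binary forms with vanishing Hessian *)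

Section SquareRelations.

Variables (K : fieldType) (n : nat).
Hypothesis char_K : (6%:R : K) \is a GRing.unit.
Implicit Types (p q f g : {mpoly K[n]}) (i j : 'I_n).

Lemma sqr_eq0 f : f * f = 0 -> f = 0.
Proof. by move=> /eqP; rewrite mulf_eq0 orbb => /eqP. Qed.

(** Let a and a' be the derivatives of v in x_j0 and x_j. The derivation D = a d_j - a' d_j0 kills
    v, and applied twice to u^2 = v w it gives 2 (D u)^2 = 0. Hence the gradients of u and v are
    proportional. *)
Lemma linear_square u v w : u \is 1.-homog -> v \is 1.-homog -> w \is 1.-homog ->
  v != 0 -> u * u = v * w -> exists rho : K, u = rho%:MP * v :> {mpoly K[n]}.
Proof.
move=> u1 v1 w1 v_neq0 uu.
have [j0 vj0] : exists j, v^`M(j) != 0.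
  apply/existsP; apply: contraNT v_neq0; rewrite negb_exists => /forallP dv0.
  apply/eqP/(dhomog_deriv0 char_K _ v1) => // j.
  by have := dv0 j; rewrite negbK => /eqP.
have [a va] := mderiv_linear j0 v1; have [b ub] := mderiv_linear j0 u1.
have [e we] := mderiv_linear j0 w1.
have a_neq0 : a != 0 by move: vj0; rewrite va mpolyC_eq0.
exists (b / a); apply/eqP; rewrite -subr_eq0; apply/eqP.
have ba : (b / a)%:MP * a%:MP = b%:MP :> {mpoly K[n]} by rewrite -mpolyCM divfK.
have r1 : u - (b / a)%:MP * v \is 1.-homog by rewrite rpredB // mul_mpolyC dhomogZ.
apply: (dhomog_deriv0 char_K _ r1) => // j.
have [a' va'] := mderiv_linear j v1; have [b' ub'] := mderiv_linear j u1.
have [e' we'] := mderiv_linear j w1.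
have Du0 : a%:MP * b'%:MP - a'%:MP * b%:MP = 0 :> {mpoly K[n]}.
  have D1 := congr1 (mderiv j) uu; have D2 := congr1 (mderiv j0) uu.
  rewrite !mderivM va' ub' we' in D1; rewrite !mderivM va ub we in D2.
  have D3 : 2%:R * (a%:MP * b'%:MP - a'%:MP * b%:MP) * u =
      v * (a%:MP * e'%:MP - a'%:MP * e%:MP).
    transitivity (a%:MP * (b'%:MP * u + u * b'%:MP) - a'%:MP * (b%:MP * u + u * b%:MP)).
      by ring.
    by rewrite D1 D2; ring.
  rewrite -mpolyC_nat -!mpolyCM -!mpolyCB -!mpolyCM in D3 *.
  have D4 := congr1 (mderiv j) D3; have D5 := congr1 (mderiv j0) D3.
  rewrite !mderivM !mderivC va' ub' in D4; rewrite !mderivM !mderivC va ub in D5.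
  rewrite !(mul0r, mulr0, add0r, addr0) -!mpolyCM in D4 D5.
  move/eqP: D4; rewrite mpolyC_eq => /eqP D4; move/eqP: D5; rewrite mpolyC_eq => /eqP D5.
  have : 2%:R * ((a * b' - a' * b) * (a * b' - a' * b)) = 0.
    transitivity (a * (2%:R * (a * b' - a' * b) * b') - a' * (2%:R * (a * b' - a' * b) * b)).
      by ring.
    by rewrite D4 D5; ring.
  move=> /eqP; rewrite mulf_eq0 (negPf (nat2_neq0 char_K)) /= mulf_eq0 orbb => /eqP ->.
  by rewrite mpolyC0.
rewrite mderivB mderiv_mulC va' ub'.
have a_neq0' : a%:MP != 0 :> {mpoly K[n]} by rewrite mpolyC_eq0.
apply: (mulf_eq0l a_neq0'); rewrite -[RHS]Du0.
transitivity (a%:MP * b'%:MP - a'%:MP * ((b / a)%:MP * a%:MP) : {mpoly K[n]}); first by ring.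
by rewrite ba.
Qed.

Definition dir_deriv (v : 'I_n -> K) f : {mpoly K[n]} := \sum_i (v i)%:MP * f^`M(i).

Lemma dir_derivM v f g : dir_deriv v (f * g) = dir_deriv v f * g + f * dir_deriv v g.
Proof.
rewrite /dir_deriv mulr_suml mulr_sumr -big_split /=; apply: eq_bigr => i _.
by rewrite mderivM; ring.
Qed.

Lemma dir_derivD v f g : dir_deriv v (f + g) = dir_deriv v f + dir_deriv v g.
Proof.
by rewrite /dir_deriv -big_split /=; apply: eq_bigr => i _; rewrite mderivD mulrDr.
Qed.

Lemma dir_derivC v c : dir_deriv v c%:MP = 0.
Proof. by rewrite /dir_deriv big1 // => i _; rewrite mderivC mulr0. Qed.

Lemma dir_deriv_homog v d f : f \is d.+1.-homog -> dir_deriv v f \is d.-homog.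
Proof.
by move=> f_homog; apply: rpred_sum => i _; rewrite mul_mpolyC dhomogZ // mderiv_dhomog.
Qed.

Lemma dir_deriv_linear v f : f \is 1.-homog -> dir_deriv v f = (f.@[v])%:MP.
Proof.
move=> f1; have := euler f1; rewrite mul1r => f_eq.
rewrite -{2}f_eq (raddf_sum (meval v)) (raddf_sum (@mpolyC n K)).
apply: eq_bigr => i _ /=; have [c ->] := mderiv_linear i f1.
by rewrite mevalM mevalXU mevalC mpolyCM.
Qed.

Lemma dir_deriv_quad v f : f \is 2.-homog ->
  dir_deriv v (dir_deriv v f) = (2%:R * f.@[v])%:MP.
Proof.
move=> f2; rewrite (dir_deriv_linear v (dir_deriv_homog v f2)); congr mpolyC.
have := congr1 (meval v) (euler f2); rewrite mevalM -mpolyC_nat mevalC => <-.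
rewrite /dir_deriv !(raddf_sum (meval v)); apply: eq_bigr => i _ /=.
by rewrite !mevalM mevalC mevalXU.
Qed.

(* Differentiating [p r = q^2] along a vector where [p] does not vanish, after
   subtracting a multiple of [p] from [q] to make [q] vanish there. *)
Lemma quadratic_square p q r : p \is 2.-homog -> q \is 2.-homog -> r \is 2.-homog ->
  p != 0 -> q * q = p * r ->
  (exists rho : K, q = rho%:MP * p) \/
  (exists c y m, [/\ c != 0, y \is 1.-homog, m \is 1.-homog &
     [/\ p = c%:MP * (y * y), q = c%:MP * (y * m) & r = c%:MP * (m * m)]]).
Proof.
move=> p2 q2 r2 p_neq0 qq.
have [v pv] : exists v : 'I_n -> K, p.@[v] != 0.
  apply: (nonvanishing_point char_K p_neq0) => m m_p i.
  have := dhomog_mf p2 m_p; rewrite /= mdegE (bigD1 i) //=; lia.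
pose a := p.@[v]; pose rho := q.@[v] / a.
have a_neq0 : a != 0 by [].
have [q' q'_def] : exists q', q' = q - rho%:MP * p by exists (q - rho%:MP * p).
have [r' r'_def] : exists r', r' = r - (2%:R * rho)%:MP * q + (rho * rho)%:MP * p.
  by exists (r - (2%:R * rho)%:MP * q + (rho * rho)%:MP * p).
have q'2 : q' \is 2.-homog by rewrite q'_def rpredB // mul_mpolyC dhomogZ.
have r'2 : r' \is 2.-homog by rewrite r'_def rpredD ?rpredB // mul_mpolyC dhomogZ.
have qq' : q' * q' = p * r'.
  transitivity (q * q - p * r + p * r'); last by rewrite qq subrr add0r.
  by rewrite q'_def r'_def !mpolyCM mpolyC_nat; ring.
have q'v : q'.@[v] = 0 by rewrite q'_def mevalB mevalM mevalC divfK // subrr.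
have r'v : r'.@[v] = 0.
  have := congr1 (meval v) qq'; rewrite !mevalM q'v mul0r => /esym/eqP.
  by rewrite mulf_eq0 (negPf pv) => /eqP.
pose lp := dir_deriv v p; pose lq := dir_deriv v q'; pose lr := dir_deriv v r'.
have dlp : dir_deriv v lp = (2%:R * a)%:MP by apply: dir_deriv_quad.
have dlq : dir_deriv v lq = 0 by rewrite dir_deriv_quad // q'v mulr0 mpolyC0.
have dlr : dir_deriv v lr = 0 by rewrite dir_deriv_quad // r'v mulr0 mpolyC0.
have D1 : lq * q' + q' * lq = lp * r' + p * lr.
  by have := congr1 (dir_deriv v) qq'; rewrite !dir_derivM.
have D2 : 2%:R * (lq * lq) = (2%:R * a)%:MP * r' + 2%:R * lp * lr.
  have := congr1 (dir_deriv v) D1; rewrite !(dir_derivD, dir_derivM) -/lp -/lq -/lr.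
  rewrite dlp dlq dlr => eqD.
  transitivity (0 * q' + lq * lq + (lq * lq + q' * 0)); first by ring.
  by rewrite eqD; ring.
(* A third derivative of the relation reads 6 a [lr] = 0. *)
have lr0 : lr = 0.
  rewrite -mpolyC_nat in D2; have := congr1 (dir_deriv v) D2.
  rewrite !(dir_derivD, dir_derivM, dir_derivC) -/lp -/lq -/lr dlp dlq dlr => eqD.
  have n6a : (2%:R * 3%:R * a)%:MP != 0 :> {mpoly K[n]}.
    by rewrite mpolyC_eq0 !mulf_neq0 ?nat2_neq0 ?nat3_neq0.
  apply: (mulf_eq0l n6a); rewrite mpolyCM mpolyCM !mpolyC_nat.
  rewrite mpolyCM !mpolyC_nat in eqD.
  set L := (X in X = _) in eqD; have L0 : L = 0 by rewrite /L; ring.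
  by rewrite -[RHS]L0 eqD; ring.
have aI : a%:MP != 0 :> {mpoly K[n]} by rewrite mpolyC_eq0.
have n2 := nat2R_neq0 n char_K.
have r'_eq : a%:MP * r' = lq * lq.
  apply/eqP; rewrite -subr_eq0; apply/eqP; apply: (mulf_eq0l n2).
  by rewrite mulrBr D2 lr0 mpolyCM mpolyC_nat; ring.
have [lq0|lq_neq0] := eqVneq lq 0.
  left; exists rho; apply/eqP; rewrite -subr_eq0; apply/eqP.
  apply: sqr_eq0; rewrite -q'_def qq'; apply: (mulf_eq0l aI).
  by rewrite mulrCA r'_eq lq0 !mulr0.
have q'_eq : 2%:R * a%:MP * q' = lp * lq.
  apply/eqP; rewrite -subr_eq0; apply/eqP; apply: (mulf_eq0l lq_neq0).
  transitivity (a%:MP * (lq * q' + q' * lq) - lp * (lq * lq)); first by ring.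
  by rewrite D1 lr0 -r'_eq; ring.
have p_eq : 2%:R * 2%:R * a%:MP * p = lp * lp.
  apply/eqP; rewrite -subr_eq0; apply/eqP; apply: (mulf_eq0l lq_neq0).
  apply: (mulf_eq0l lq_neq0).
  transitivity (2%:R * 2%:R * a%:MP * p * (lq * lq) - (lp * lq) * (lp * lq)); first by ring.
  rewrite -r'_eq -q'_eq.
  transitivity (2%:R * 2%:R * a%:MP * a%:MP * (p * r' - q' * q')); first by ring.
  by rewrite qq' subrr mulr0.
(* From 4 a p = lp^2, 2 a q' = lp lq and q = q' + rho p one reads off c = 1 / (4 a), y = lp and m =
   rho lp + 2 lq. *)
right; pose c := (2%:R * 2%:R * a)^-1.
have c_neq0 : c != 0 by rewrite invr_neq0 // !mulf_neq0 ?nat2_neq0.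
have cI : c%:MP * (2%:R * 2%:R * a%:MP) = 1 :> {mpoly K[n]}.
  by rewrite -mpolyC_nat -!mpolyCM mulVf ?mpolyC1 // !mulf_neq0 ?nat2_neq0.
have lp1 : lp \is 1.-homog by apply: dir_deriv_homog.
have lq1 : lq \is 1.-homog by apply: dir_deriv_homog.
pose m := rho%:MP * lp + (2%:R)%:MP * lq.
have p_eq' : p = c%:MP * (lp * lp) by rewrite -p_eq mulrA cI mul1r.
have q_eq' : q = c%:MP * (lp * m).
  transitivity (q' + rho%:MP * p); first by rewrite q'_def subrK.
  transitivity (c%:MP * (2%:R * 2%:R * a%:MP) * q' + rho%:MP * p).
    by rewrite cI mul1r.
  rewrite p_eq' /m mpolyC_nat.
  transitivity (c%:MP * 2%:R * (2%:R * a%:MP * q') + rho%:MP * (c%:MP * (lp * lp))).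
    by ring.
  by rewrite q'_eq; ring.
exists c, lp, m; split=> //; first by rewrite rpredD // mul_mpolyC dhomogZ.
split=> //; apply/eqP; rewrite -subr_eq0; apply/eqP; apply: (mulf_eq0l p_neq0).
by rewrite mulrBr -qq p_eq' q_eq'; ring.
Qed.

End SquareRelations.

(** * Solving the coefficient equations of a vanishing Hessian *)

Section DegenerateHessian.

Variables (K : fieldType) (n : nat).
Hypothesis char_K : (6%:R : K) \is a GRing.unit.
Implicit Types (p q f g : {mpoly K[n]}) (i j : 'I_n).

(* Coefficients of [f_xx f_yy = f_xy^2] for
   [f = (a x^4 + 4 b x^3 y + 6 c x^2 y^2 + 4 d x y^3 + e y^4) / 4
        + (p0 x^3 + 3 p1 x^2 y + 3 p2 x y^2 + p3 y^3) / 3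
        + (q0 x^2 + 2 q1 x y + q2 y^2) / 2]. *)
Definition hessian_eqs (a b c d e p0 p1 p2 p3 q0 q1 q2 : {mpoly K[n]}) : Prop :=
  [/\ [/\ a * c = b * b, a * d = b * c, a * e + 2%:R * b * d = 3%:R * c * c,
          b * e = c * d & c * e = d * d],
      [/\ c * p0 + a * p2 = 2%:R * b * p1,
          2%:R * d * p0 + a * p3 = 3%:R * c * p1,
          e * p0 + 2%:R * b * p3 = 3%:R * c * p2 &
          e * p1 + c * p3 = 2%:R * d * p2],
      [/\ 2%:R * 2%:R * (p0 * p2 - p1 * p1) + 3%:R * (c * q0 + a * q2 - 2%:R * b * q1) = 0,
          2%:R * (p0 * p3 - p1 * p2) + 3%:R * (d * q0 + b * q2 - 2%:R * c * q1) = 0 &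
          2%:R * 2%:R * (p1 * p3 - p2 * p2) + 3%:R * (e * q0 + c * q2 - 2%:R * d * q1) = 0],
      p2 * q0 + p0 * q2 = 2%:R * p1 * q1 /\ p3 * q0 + p1 * q2 = 2%:R * p2 * q1 &
      q0 * q2 = q1 * q1].

(* A binary form with these coefficients is a multiple of a power of [x + r y]. *)
Definition geometric (r : {mpoly K[n]}) (a b c d e p0 p1 p2 p3 q0 q1 q2 : {mpoly K[n]}) : Prop :=
  [/\ [/\ b = r * a, c = r * b, d = r * c & e = r * d],
      [/\ p1 = r * p0, p2 = r * p1 & p3 = r * p2] & q1 = r * q0 /\ q2 = r * q1].

(** Exchanging x and y reverses each string of coefficients. *)
Lemma hessian_eqs_rev a b c d e p0 p1 p2 p3 q0 q1 q2 :
  hessian_eqs a b c d e p0 p1 p2 p3 q0 q1 q2 ->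
  hessian_eqs e d c b a p3 p2 p1 p0 q2 q1 q0.
Proof.
case=> [[e1 e2 e3 e4 e5] [f1 f2 f3 f4] [g1 g2 g3] [h1 h2] k].
do ![split].
- by rewrite mulrC.
- by rewrite mulrC e4 mulrC.
- by rewrite -e3; ring.
- by rewrite mulrC e2 mulrC.
- by rewrite mulrC.
- by rewrite -f4; ring.
- by rewrite -f3; ring.
- by rewrite -f2; ring.
- by rewrite -f1; ring.
- by rewrite -[RHS]g3; ring.
- by rewrite -[RHS]g2; ring.
- by rewrite -[RHS]g1; ring.
- by rewrite -h2; ring.
- by rewrite -h1; ring.
- by rewrite mulrC.
Qed.

(** The quartic part is a (x + r y)^4 / 4 with r = b / a. [E] and [F] measure how far the lower
    parts are from following this ratio; the equations give E F = 0 and 3 a F = 4 E^2, so E^3 =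
    0. *)
Lemma hessian_quartic (a b c d e : K) p0 p1 p2 p3 q0 q1 q2 : a != 0 ->
  hessian_eqs a%:MP b%:MP c%:MP d%:MP e%:MP p0 p1 p2 p3 q0 q1 q2 ->
  geometric (b / a)%:MP a%:MP b%:MP c%:MP d%:MP e%:MP p0 p1 p2 p3 q0 q1 q2.
Proof.
move=> a_neq0 [[e1 e2 e3 e4 e5] [f1 f2 f3 f4] [g1 g2 g3] [h1 h2] k].
have aI : a%:MP != 0 :> {mpoly K[n]} by rewrite mpolyC_eq0.
pose r := (b / a)%:MP : {mpoly K[n]}.
have n3 := nat3R_neq0 n char_K; have n2 := nat2R_neq0 n char_K.
have eq_of_mul x y z : x != 0 -> x * y = x * z -> y = z :> {mpoly K[n]}.
  by move=> /mulfI inj /inj.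
have b_eq : b%:MP = r * a%:MP by rewrite /r -mpolyCM divfK.
have c_eq : c%:MP = r * b%:MP.
  by apply: (eq_of_mul a%:MP) => //; rewrite e1 {1}b_eq; ring.
have d_eq : d%:MP = r * c%:MP.
  by apply: (eq_of_mul a%:MP) => //; rewrite e2 {1}b_eq; ring.
have e_eq : e%:MP = r * d%:MP.
  apply: (eq_of_mul a%:MP) => //.
  transitivity (3%:R * c%:MP * c%:MP - 2%:R * b%:MP * d%:MP : {mpoly K[n]}).
    by rewrite -e3; ring.
  by rewrite d_eq c_eq b_eq; ring.
have p2_eq : p2 = 2%:R * r * p1 - r * r * p0.
  apply: (eq_of_mul a%:MP) => //.
  transitivity (2%:R * b%:MP * p1 - c%:MP * p0); first by rewrite -f1; ring.
  by rewrite c_eq b_eq; ring.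
have p3_eq : p3 = 3%:R * r * r * p1 - 2%:R * r * r * r * p0.
  apply: (eq_of_mul a%:MP) => //.
  transitivity (3%:R * c%:MP * p1 - 2%:R * d%:MP * p0); first by rewrite -f2; ring.
  by rewrite d_eq c_eq b_eq; ring.
pose E := p1 - r * p0; pose F := q2 - 2%:R * r * q1 + r * r * q0.
have EF : E * F = 0.
  transitivity (p3 * q0 + p1 * q2 - 2%:R * p2 * q1
    - r * (p2 * q0 + p0 * q2 - 2%:R * p1 * q1)).
    by rewrite /E /F p3_eq p2_eq; ring.
  by rewrite h1 h2; ring.
have FE : 3%:R * a%:MP * F = 2%:R * 2%:R * E * E.
  apply/eqP; rewrite -subr_eq0; apply/eqP; rewrite -[RHS]g1 /E /F p2_eq c_eq b_eq.
  by ring.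
have E0 : E = 0.
  apply: sqr_eq0; apply: sqr_eq0.
  have E3 : 2%:R * 2%:R * (E * E * E) = 0.
    transitivity (E * (2%:R * 2%:R * E * E)); first by ring.
    rewrite -FE; transitivity (3%:R * a%:MP * (E * F)); first by ring.
    by rewrite EF mulr0.
  have {}E3 : E * E * E = 0 by apply: mulf_eq0l E3; rewrite mulf_neq0.
  by rewrite mulrA E3 mul0r.
have F0 : F = 0.
  by apply: (@mulf_eq0l _ _ (3%:R * a%:MP)); rewrite ?mulf_neq0 // FE E0 mulr0.
have p1_eq : p1 = r * p0 by apply/eqP; rewrite -subr_eq0 -/E E0.
have q2_eq : q2 = 2%:R * r * q1 - r * r * q0.
  by apply/eqP; rewrite -subr_eq0 -[X in _ == X]F0 /F; apply/eqP; ring.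
have q1_eq : q1 = r * q0.
  apply/eqP; rewrite -subr_eq0; apply/eqP; apply: sqr_eq0.
  transitivity (q1 * q1 - q0 * q2); first by rewrite q2_eq; ring.
  by rewrite k subrr.
split; split=> //.
- by rewrite p2_eq p1_eq; ring.
- by rewrite p3_eq p2_eq p1_eq; ring.
- by rewrite q2_eq q1_eq; ring.
Qed.

(** Without a quartic part the cubic one satisfies p1^2 = p0 p2 and p0 p3 = p1 p2 in linear forms,
    and [linear_square] makes the ratio constant. *)
Lemma hessian_cubic p0 p1 p2 p3 q0 q1 q2 :
  p0 \is 1.-homog -> p1 \is 1.-homog -> p2 \is 1.-homog -> p0 != 0 ->
  hessian_eqs 0 0 0 0 0 p0 p1 p2 p3 q0 q1 q2 ->
  exists r : K, geometric r%:MP 0 0 0 0 0 p0 p1 p2 p3 q0 q1 q2.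
Proof.
move=> hp0 hp1 hp2 p0_neq0 [_ _ [g1 g2 g3] [h1 h2] k].
have n2 := nat2R_neq0 n char_K.
have eq_of_mul x y z : x != 0 -> x * y = x * z -> y = z :> {mpoly K[n]}.
  by move=> /mulfI inj /inj.
have {}g1 : p1 * p1 = p0 * p2.
  apply/eqP; rewrite eq_sym -subr_eq0; apply/eqP.
  have : 2%:R * 2%:R * (p0 * p2 - p1 * p1) = 0 by rewrite -[RHS]g1; ring.
  by apply: mulf_eq0l; rewrite mulf_neq0.
have {}g2 : p0 * p3 = p1 * p2.
  apply/eqP; rewrite -subr_eq0; apply/eqP.
  have : 2%:R * (p0 * p3 - p1 * p2) = 0 by rewrite -[RHS]g2; ring.
  by apply: mulf_eq0l.
have [r p1_eq] := linear_square char_K hp1 hp0 hp2 p0_neq0 g1.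
have p2_eq : p2 = r%:MP * p1.
  by apply: (eq_of_mul p0) => //; rewrite -g1 {1}p1_eq; ring.
have p3_eq : p3 = r%:MP * p2.
  by apply: (eq_of_mul p0) => //; rewrite g2 {1}p1_eq; ring.
have q2_eq : q2 = 2%:R * r%:MP * q1 - r%:MP * r%:MP * q0.
  apply: (eq_of_mul p0) => //.
  transitivity (2%:R * p1 * q1 - p2 * q0); first by rewrite -h1; ring.
  by rewrite p2_eq p1_eq; ring.
have q1_eq : q1 = r%:MP * q0.
  apply/eqP; rewrite -subr_eq0; apply/eqP; apply: sqr_eq0.
  transitivity (q1 * q1 - q0 * q2); first by rewrite q2_eq; ring.
  by rewrite k subrr.
exists r; split; split=> //; try by rewrite mulr0.
by rewrite q2_eq q1_eq; ring.
Qed.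

(** The constant vector (u, v) lies in the kernel of the Hessian matrix of the form f of
    [hessian_eqs], written coefficientwise. *)
Definition annihilated (u v a b c d e p0 p1 p2 p3 q0 q1 q2 : {mpoly K[n]}) : Prop :=
  [/\ [/\ u * a + v * b = 0, u * b + v * c = 0, u * c + v * d = 0 & u * d + v * e = 0],
      [/\ u * p0 + v * p1 = 0, u * p1 + v * p2 = 0 & u * p2 + v * p3 = 0] &
      u * q0 + v * q1 = 0 /\ u * q1 + v * q2 = 0].

Lemma geometric_annihilated r a b c d e p0 p1 p2 p3 q0 q1 q2 :
  geometric r a b c d e p0 p1 p2 p3 q0 q1 q2 ->
  annihilated (- r) 1 a b c d e p0 p1 p2 p3 q0 q1 q2.
Proof.
have cancel x y : y = r * x -> - r * x + 1 * y = 0 by move=> ->; ring.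
by case=> [[? ? ? ?] [? ? ?] [? ?]]; do ![split]; apply: cancel.
Qed.

Lemma annihilated_rev u v a b c d e p0 p1 p2 p3 q0 q1 q2 :
  annihilated u v a b c d e p0 p1 p2 p3 q0 q1 q2 ->
  annihilated v u e d c b a p3 p2 p1 p0 q2 q1 q0.
Proof.
have sym x y : u * x + v * y = 0 -> v * y + u * x = 0 by rewrite addrC.
by case=> [[? ? ? ?] [? ? ?] [? ?]]; do ![split]; apply: sym.
Qed.

Lemma linear_dep_dec (y m : {mpoly K[n]}) : y \is 1.-homog -> m \is 1.-homog -> y != 0 ->
  (exists r : K, m = r%:MP * y) \/
  (forall u v : K, u%:MP * y + v%:MP * m = 0 -> u = 0 /\ v = 0).
Proof.
move=> y1 m1 y_neq0.
have [j0 yj0] : exists j, y^`M(j) != 0.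
  apply/existsP; apply: contraNT y_neq0; rewrite negb_exists => /forallP dy0.
  apply/eqP/(dhomog_deriv0 char_K _ y1) => // j.
  by have := dy0 j; rewrite negbK => /eqP.
have [a ya] := mderiv_linear j0 y1; have [b mb] := mderiv_linear j0 m1.
have a_neq0 : a != 0 by move: yj0; rewrite ya mpolyC_eq0.
have [m_eq|m_neq] := eqVneq m ((b / a)%:MP * y); first by left; exists (b / a).
right=> u v uv0; have [v0|v_neq0] := eqVneq v 0.
  split=> //; move: uv0; rewrite v0 mpolyC0 mul0r addr0 => /eqP.
  by rewrite mulf_eq0 (negPf y_neq0) orbF mpolyC_eq0 => /eqP.
case/negP: m_neq; apply/eqP.
have vV : (v^-1)%:MP * v%:MP = 1 :> {mpoly K[n]} by rewrite -mpolyCM mulVf ?mpolyC1.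
have m_eq : m = (- (v^-1 * u))%:MP * y.
  transitivity ((v^-1)%:MP * v%:MP * m); first by rewrite vV mul1r.
  transitivity ((v^-1)%:MP * (u%:MP * y + v%:MP * m) - (v^-1)%:MP * u%:MP * y); first by ring.
  by rewrite uv0 mpolyCN mpolyCM; ring.
have b_eq : b = - (v^-1 * u) * a.
  apply/eqP; rewrite -(mpolyC_eq n) mpolyCM -mb -ya -mderiv_mulC -m_eq.
  exact: eqxx.
by rewrite {1}m_eq b_eq mulfK.
Qed.

(** The parts of f are examined from the top degree down. A nonzero end coefficient of the quartic
    or cubic part gives a constant ratio, directly or after reversal; if both ends vanish, the
    equations kill the whole part. Only the quadratic part admits a nonconstant ratio m / y, by
    [quadratic_square]. *)
Lemma hessian_cases (a b c d e : K) p0 p1 p2 p3 q0 q1 q2 :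
  p0 \is 1.-homog -> p1 \is 1.-homog -> p2 \is 1.-homog -> p3 \is 1.-homog ->
  q0 \is 2.-homog -> q1 \is 2.-homog -> q2 \is 2.-homog ->
  hessian_eqs a%:MP b%:MP c%:MP d%:MP e%:MP p0 p1 p2 p3 q0 q1 q2 ->
  (exists u v : K, (u != 0) || (v != 0) /\
    annihilated u%:MP v%:MP a%:MP b%:MP c%:MP d%:MP e%:MP p0 p1 p2 p3 q0 q1 q2) \/
  [/\ [/\ b = 0, c = 0, d = 0 & e = 0], [/\ p1 = 0, p2 = 0 & p3 = 0] &
      a = 0 /\ p0 = 0 /\
     exists k y m, [/\ k != 0, y \is 1.-homog, m \is 1.-homog,
       (forall u v : K, u%:MP * y + v%:MP * m = 0 -> u = 0 /\ v = 0) &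
       [/\ q0 = k%:MP * (y * y), q1 = k%:MP * (y * m) & q2 = k%:MP * (m * m)]]].
Proof.
move=> hp0 hp1 hp2 hp3 hq0 hq1 hq2 eqs.
have geo_left r a' b' c' d' e' x0 x1 x2 x3 y0 y1 y2 :
    geometric r%:MP a' b' c' d' e' x0 x1 x2 x3 y0 y1 y2 ->
    exists u v : K, (u != 0) || (v != 0) /\
    annihilated u%:MP v%:MP a' b' c' d' e' x0 x1 x2 x3 y0 y1 y2.
  move=> /geometric_annihilated ann; exists (- r), 1; rewrite oner_neq0 orbT.
  by rewrite mpolyCN mpolyC1.
have rev_left a' b' c' d' e' x0 x1 x2 x3 y0 y1 y2 :
    (exists u v : K, (u != 0) || (v != 0) /\
    annihilated u%:MP v%:MP a' b' c' d' e' x0 x1 x2 x3 y0 y1 y2) ->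
    exists u v : K, (u != 0) || (v != 0) /\
    annihilated u%:MP v%:MP e' d' c' b' a' x3 x2 x1 x0 y2 y1 y0.
  by move=> [u [v [uv /annihilated_rev ann]]]; exists v, u; rewrite orbC.
have [a0|a_neq0] := eqVneq a 0; last by left; apply/geo_left/(hessian_quartic a_neq0 eqs).
have [e0|e_neq0] := eqVneq e 0; last first.
  by left; apply/rev_left/geo_left/(hessian_quartic e_neq0 (hessian_eqs_rev eqs)).
have [[e1 e2 e3 e4 e5] _ _ _ _] := eqs.
have zeroC x : x%:MP = 0 :> {mpoly K[n]} -> x = 0 by move=> /eqP; rewrite mpolyC_eq0 => /eqP.
have b0 : b = 0 by apply/zeroC/sqr_eq0; rewrite -e1 a0 mpolyC0 mul0r.
have d0 : d = 0 by apply/zeroC/sqr_eq0; rewrite -e5 e0 mpolyC0 mulr0.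
have c0 : c = 0.
  apply/zeroC/sqr_eq0; apply: (mulf_eq0l (nat3R_neq0 n char_K)).
  by rewrite mulrA -e3 a0 b0 mpolyC0; ring.
rewrite {e1 e2 e3 e4 e5} a0 b0 c0 d0 e0 mpolyC0 in eqs *.
have [p00|p0_neq0] := eqVneq p0 0; last first.
  by left; have [r geo] := hessian_cubic hp0 hp1 hp2 p0_neq0 eqs; apply/geo_left/geo.
have [p30|p3_neq0] := eqVneq p3 0; last first.
  have [r geo] := hessian_cubic hp3 hp2 hp1 p3_neq0 (hessian_eqs_rev eqs).
  by left; apply/rev_left/geo_left/geo.
have [_ _ [g1 _ g3] _ k] := eqs.
have n4 : 2%:R * 2%:R != 0 :> {mpoly K[n]} by rewrite mulf_neq0 ?(nat2R_neq0 n char_K).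
have p10 : p1 = 0.
  apply/sqr_eq0/(mulf_eq0l n4); rewrite -[RHS]oppr0 -[X in _ = - X]g1 p00; ring.
have p20 : p2 = 0.
  apply/sqr_eq0/(mulf_eq0l n4); rewrite -[RHS]oppr0 -[X in _ = - X]g3 p30; ring.
rewrite {eqs g1 g3} p00 p10 p20 p30.
have geo_q r : q1 = r%:MP * q0 -> q0 != 0 ->
    geometric r%:MP 0 0 0 0 0 0 0 0 0 q0 q1 q2.
  move=> q1_eq q0_neq0; do ![split]; rewrite ?mulr0 //.
  by apply: (mulfI q0_neq0); rewrite k {1}q1_eq; ring.
have [q00|q0_neq0] := eqVneq q0 0.
  have q10 : q1 = 0 by apply: sqr_eq0; rewrite -k q00 mul0r.
  left; exists 1, 0; rewrite oner_neq0; split=> //.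
  by rewrite mpolyC0 mpolyC1 q00 q10; do ![split]; ring.
have [[r q1_eq]|[l [y [m [l_neq0 y1 m1 [q0_eq q1_eq q2_eq]]]]]] :=
    quadratic_square char_K hq0 hq1 hq2 q0_neq0 (esym k).
  by left; apply: (geo_left r); apply: geo_q.
have y_neq0 : y != 0.
  have [y0|//] := eqVneq y 0; case/negP: q0_neq0.
  by rewrite q0_eq y0 mul0r mulr0.
have [[r m_eq]|indep] := linear_dep_dec y1 m1 y_neq0.
  left; apply: (geo_left r); apply: geo_q => //.
  by rewrite q1_eq q0_eq m_eq; ring.
by right; do ![split] => //; exists l, y, m.
Qed.

End DegenerateHessian.

(** The left side is f_yy f_xx - f_xy^2 for the f of [hessian_eqs]; the rows on the right are padded
    to six terms to fit [row_poly]. *)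
Lemma hessian_expand (R : comRingType) (X Y a b c d e p0 p1 p2 p3 q0 q1 q2 : R) :
  (3%:R * c * X * X + X * (2%:R * 3%:R * d * Y + 2%:R * p2)
     + (3%:R * e * Y * Y + 2%:R * p3 * Y + q2)) *
  (3%:R * a * X * X + 2%:R * X * (3%:R * b * Y + p0)
     + (3%:R * c * Y * Y + 2%:R * p1 * Y + q0)) -
  (3%:R * b * X * X + 2%:R * X * (3%:R * c * Y + p1)
     + (3%:R * d * Y * Y + 2%:R * p2 * Y + q1)) *
  (3%:R * b * X * X + 2%:R * X * (3%:R * c * Y + p1)
     + (3%:R * d * Y * Y + 2%:R * p2 * Y + q1)) =
  ((q0 * q2 - q1 * q1) + (2%:R * (p3 * q0 + p1 * q2 - 2%:R * p2 * q1)) * Y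
    + (2%:R * 2%:R * (p1 * p3 - p2 * p2)
        + 3%:R * (e * q0 + c * q2 - 2%:R * d * q1)) * Y ^+ 2
    + (2%:R * 3%:R * (e * p1 + c * p3 - 2%:R * d * p2)) * Y ^+ 3
    + (3%:R * 3%:R * (c * e - d * d)) * Y ^+ 4 + 0 * Y ^+ 5)
  + ((2%:R * (p2 * q0 + p0 * q2 - 2%:R * p1 * q1))
    + (2%:R * (2%:R * (p0 * p3 - p1 * p2) + 3%:R * (d * q0 + b * q2 - 2%:R * c * q1))) * Y
    + (2%:R * 3%:R * (e * p0 + 2%:R * b * p3 - 3%:R * c * p2)) * Y ^+ 2
    + (2%:R * 3%:R * 3%:R * (b * e - c * d)) * Y ^+ 3 + 0 * Y ^+ 4 + 0 * Y ^+ 5) * X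
  + ((2%:R * 2%:R * (p0 * p2 - p1 * p1) + 3%:R * (c * q0 + a * q2 - 2%:R * b * q1))
    + (2%:R * 3%:R * (2%:R * d * p0 + a * p3 - 3%:R * c * p1)) * Y
    + (3%:R * 3%:R * (a * e + 2%:R * b * d - 3%:R * c * c)) * Y ^+ 2
    + 0 * Y ^+ 3 + 0 * Y ^+ 4 + 0 * Y ^+ 5) * X ^+ 2
  + ((2%:R * 3%:R * (c * p0 + a * p2 - 2%:R * b * p1))
    + (2%:R * 3%:R * 3%:R * (a * d - b * c)) * Y
    + 0 * Y ^+ 2 + 0 * Y ^+ 3 + 0 * Y ^+ 4 + 0 * Y ^+ 5) * X ^+ 3
  + ((3%:R * 3%:R * (a * c - b * b))
    + 0 * Y + 0 * Y ^+ 2 + 0 * Y ^+ 3 + 0 * Y ^+ 4 + 0 * Y ^+ 5) * X ^+ 4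
  + (0 + 0 * Y + 0 * Y ^+ 2 + 0 * Y ^+ 3 + 0 * Y ^+ 4 + 0 * Y ^+ 5) * X ^+ 5.
Proof. by ring. Qed.

(** * Nilpotent 2 x 2 blocks of cubic forms *)

Section NilpotentBlock.

Variables (K : fieldType) (n : nat).
Hypothesis char_K : (6%:R : K) \is a GRing.unit.
Implicit Types (p q f g : {mpoly K[n]}) (i j : 'I_n).

Lemma subst_subst_free i j p : i != j -> varfree i p -> varfree i (subst_var j 0 p).
Proof.
move=> neq fp; rewrite /varfree -{2}fp /subst_var !comp_mpoly_comp.
apply: eq_comp_mpoly => k; have [->|ki] := eqVneq k i.
  by rewrite (negPf neq) comp_mpoly0 comp_mpoly_var eqxx.
have [->|kj] := eqVneq k j; first by rewrite comp_mpoly0 comp_mpoly_var eqxx.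
by rewrite !comp_mpoly_var (negPf ki) (negPf kj).
Qed.

Lemma split_var_free i j d p : i != j -> p \is d.+1.-homog -> varfree i p ->
  exists p0 p1, [/\ p = p0 + 'X_j * p1, p0 \is d.+1.-homog, p1 \is d.-homog,
    varfree i p0 /\ varfree j p0 & varfree i p1].
Proof.
move=> neq p_homog fp; have [g g_homog p_eq] := split_var j p_homog.
exists (subst_var j 0 p), g; split=> //.
- by apply: dhomog_subst => //; apply: dhomog0.
- by split; [apply: subst_subst_free | apply: free_subst].
have fs := subst_subst_free neq fp; have fX := @freeX K n i j; rewrite eq_sym in fX.
apply/eqP; rewrite -subr_eq0; apply/eqP; apply: (mulf_eq0l (mpolyXU_neq0 K j)).
have : subst_var i 0 (subst_var j 0 p + 'X_j * g) = subst_var j 0 p + 'X_j * g.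
  by rewrite -p_eq.
rewrite rmorphD rmorphM /= fs (fX neq) => /addrI eqX.
by rewrite mulrBr eqX subrr.
Qed.

Lemma cubic_split2 i j f : i != j -> f \is 3.-homog ->
  exists (a30 a21 a12 a03 : K) (b20 b11 b02 c10 c01 d : {mpoly K[n]}),
  [/\ f = a30%:MP * ('X_i * 'X_i * 'X_i) + 'X_i * 'X_i * (a21%:MP * 'X_j + b20)
        + 'X_i * (a12%:MP * 'X_j * 'X_j + b11 * 'X_j + c10)
        + (a03%:MP * 'X_j * 'X_j * 'X_j + b02 * 'X_j * 'X_j + c01 * 'X_j + d),
      [/\ b20 \is 1.-homog, b11 \is 1.-homog & b02 \is 1.-homog],
      [/\ c10 \is 2.-homog, c01 \is 2.-homog & d \is 3.-homog],
      [/\ varfree i b20, varfree i b11, varfree i b02, varfree i c10 & varfree i c01]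
        /\ varfree i d &
      [/\ varfree j b20, varfree j b11, varfree j b02, varfree j c10 & varfree j c01]
        /\ varfree j d].
Proof.
move=> neq f3; have [a [b [c [d [f_eq [b1 c2 d3] [fb fc fd]]]]]] := cubic_split i f3.
have [b20 [b21 [b_eq h20 h21 [f20 g20] f21]]] := split_var_free neq b1 fb.
have [a21 a21_eq] := dhomog0C h21.
have [c10 [c11 [c_eq h10 h11 [f10 g10] f11]]] := split_var_free neq c2 fc.
have [b11 [b12 [c11_eq hb11 h12 [fb11 gb11] f12]]] := split_var_free neq h11 f11.
have [a12 a12_eq] := dhomog0C h12.
have [d0 [d1 [d_eq hd0 hd1 [fd0 gd0] fd1]]] := split_var_free neq d3 fd.
have [c01 [d2 [d1_eq hc01 hd2 [fc01 gc01] fd2]]] := split_var_free neq hd1 fd1.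
have [b02 [d3' [d2_eq hb02 hd3 [fb02 gb02] fd3]]] := split_var_free neq hd2 fd2.
have [a03 a03_eq] := dhomog0C hd3.
exists a, a21, a12, a03, b20, b11, b02, c10, c01, d0; split=> //.
rewrite {1}f_eq b_eq a21_eq c_eq c11_eq a12_eq d_eq d1_eq d2_eq a03_eq.
by ring.
Qed.

Variables i1 i2 : 'I_n.
Hypothesis neq12 : i1 != i2.

Let X : {mpoly K[n]} := 'X_i1.
Let Y : {mpoly K[n]} := 'X_i2.

Variant two_free p : Prop := TwoFree of varfree i1 p & varfree i2 p.

Lemma two_freeD p q : two_free p -> two_free q -> two_free (p + q).
Proof. by case=> ? ? [? ?]; split; apply: freeD. Qed.
Lemma two_freeN p : two_free p -> two_free (- p).
Proof. by case=> ? ?; split; apply: freeN. Qed.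
Lemma two_freeM p q : two_free p -> two_free q -> two_free (p * q).
Proof. by case=> ? ? [? ?]; split; apply: freeM. Qed.
Lemma two_free_nat k : two_free k%:R.
Proof. by split; apply: free_nat. Qed.
Lemma two_freeC c : two_free c%:MP.
Proof. by split; apply: freeC. Qed.
Lemma two_free0 : two_free 0.
Proof. by split; apply: free0. Qed.

Definition row_poly (c : nat -> {mpoly K[n]}) : {mpoly K[n]} :=
  c 0%N + c 1%N * Y + c 2%N * Y ^+ 2 + c 3%N * Y ^+ 3 + c 4%N * Y ^+ 4 + c 5%N * Y ^+ 5.

Lemma row_poly_free c : (forall k, two_free (c k)) -> varfree i1 (row_poly c).
Proof.
move=> c_free; have fY : varfree i1 Y by apply: freeX; rewrite eq_sym.
have f k l : varfree i1 (c k * Y ^+ l).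
  by apply: freeM; [case: (c_free k) | apply: freeE].
rewrite /row_poly; do 4![apply: freeD; last exact: f]; apply: freeD; last exact: (f 1%N 1%N).
by case: (c_free 0%N).
Qed.

Lemma row_poly_eq0 c : (forall k, two_free (c k)) -> row_poly c = 0 ->
  forall k, (k < 6)%N -> c k = 0.
Proof.
move=> c_free row0; have c2 k : varfree i2 (c k) by case: (c_free k).
have [[? ? ?] [? ? ?]] := extract_var (c2 _) (c2 _) (c2 _) (c2 _) (c2 _) (c2 _) row0.
by do 6![case=> [//|]].
Qed.

Lemma extract_grid (c : nat -> nat -> {mpoly K[n]}) : (forall k l, two_free (c k l)) ->
  row_poly (c 0%N) + row_poly (c 1%N) * X + row_poly (c 2%N) * X ^+ 2
    + row_poly (c 3%N) * X ^+ 3 + row_poly (c 4%N) * X ^+ 4 + row_poly (c 5%N) * X ^+ 5 = 0 ->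
  forall k l, (k < 6)%N -> (l < 6)%N -> c k l = 0.
Proof.
move=> c_free sum0; have rf k := row_poly_free (c_free k).
have [[? ? ?] [? ? ?]] := extract_var (rf _) (rf _) (rf _) (rf _) (rf _) (rf _) sum0.
by case=> [|[|[|[|[|[|k]]]]]] l // _ l_lt; apply: (row_poly_eq0 (c_free _)).
Qed.

(** Entry l of row k is the coefficient of X^k Y^l; absent entries count as 0. *)
Definition grid (s : seq (seq {mpoly K[n]})) (k l : nat) := nth 0 (nth [::] s k) l.

Definition all_free (s : seq (seq {mpoly K[n]})) : Prop :=
  foldr (fun r P => foldr (fun p Q => two_free p /\ Q) True r /\ P) True s.

Lemma grid_free s : all_free s -> forall k l, two_free (grid s k l).
Proof.
rewrite /grid; elim: s => [|r s IHs] /=; first by move=> _ k l; rewrite !nth_nil; apply: two_free0.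
case=> r_free /IHs s_free [|k] l //=; elim: r l r_free => [|p r IHr] l /=.
  by rewrite nth_nil => _; apply: two_free0.
by case=> fp /IHr r_free; case: l => [|l] /=.
Qed.

Lemma nilpotent_block h1 h2 : h1 \is 3.-homog -> h2 \is 3.-homog ->
  h1^`M(i1) + h2^`M(i2) = 0 -> h1^`M(i1) * h2^`M(i2) = h1^`M(i2) * h2^`M(i1) ->
  (exists u v : K, [/\ (u != 0) || (v != 0),
     u%:MP * h1^`M(i1) + v%:MP * h1^`M(i2) = 0 &
     u%:MP * h2^`M(i1) + v%:MP * h2^`M(i2) = 0]) \/
  exists k y m r1 r2,
    [/\ k != 0, y \is 1.-homog /\ m \is 1.-homog, two_free y /\ two_free m,
      (forall u v : K, u%:MP * y + v%:MP * m = 0 -> u = 0 /\ v = 0) &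
      [/\ h1 = k%:MP * m * (y * X + m * Y) + r1,
           h2 = - (k%:MP * y * (y * X + m * Y)) + r2,
           two_free r1 & two_free r2]].
Proof.
move=> h1_3 h2_3 tr0 det0.
(* The names anticipate the Hamiltonian f of [hessian_eqs]: h1 will be f_y and h2 will be - f_x, up
   to r1 and r2. Coefficients that do not yet carry their final name are numbered by the exponents
   of their monomials. *)
have [b [x21 [x12 [e [p1 [x11 [p3 [q1 [q2 [r1 [h1_eq [hp1 hx11 hp3] [hq1 hq2 hr1]]]]]]]]]]]] :=
  cubic_split2 neq12 h1_3.
move=> [[fp1 fx11 fp3 fq1 fq2] fr1] [[gp1 gx11 gp3 gq1 gq2] gr1].
have [y30 [y21 [y12 [y03 [y20 [y11 [y02 [y10 [y01 [r2 [h2_eq [hy20 hy11 hy02] [hy10 hy01 hr2]]]]]]]]]]]] :=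
  cubic_split2 neq12 h2_3.
move=> [[fy20 fy11 fy02 fy10 fy01] fr2] [[gy20 gy11 gy02 gy10 gy01] gr2].
have tC := two_freeC; have tN := two_free_nat.
have t0 := two_free0; have t1 : two_free 1 := two_free_nat 1.
have [tp1 tx11 tp3 tq1 tq2] : [/\ two_free p1, two_free x11, two_free p3,
  two_free q1 & two_free q2] by do ![split].
have [ty20 ty11 ty02 ty10 ty01] : [/\ two_free y20, two_free y11, two_free y02,
  two_free y10 & two_free y01] by do ![split].
have dXY : (X^`M(i1) = 1) * (X^`M(i2) = 0) * (Y^`M(i1) = 0) * (Y^`M(i2) = 1).
  by rewrite !mderivXU !eqxx (negPf neq12) eq_sym (negPf neq12).
have dfree p : two_free p -> (p^`M(i1) = 0) * (p^`M(i2) = 0).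
  by case=> /mderiv_free -> /mderiv_free ->.
have tr1 : two_free r1 by split.
have tr2 : two_free r2 by split.
have h1_1 : h1^`M(i1) = 3%:R * b%:MP * X * X + 2%:R * X * (x21%:MP * Y + p1)
    + (x12%:MP * Y * Y + x11 * Y + q1).
  by rewrite h1_eq !(mderivD, mderivM, mderivC) !dXY !dfree //; rewrite -/X -/Y; ring.
have h1_2 : h1^`M(i2) = x21%:MP * X * X + X * (2%:R * x12%:MP * Y + x11)
    + (3%:R * e%:MP * Y * Y + 2%:R * p3 * Y + q2).
  by rewrite h1_eq !(mderivD, mderivM, mderivC) !dXY !dfree //; rewrite -/X -/Y; ring.
have h2_1 : h2^`M(i1) = 3%:R * y30%:MP * X * X + 2%:R * X * (y21%:MP * Y + y20)
    + (y12%:MP * Y * Y + y11 * Y + y10).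
  by rewrite h2_eq !(mderivD, mderivM, mderivC) !dXY !dfree //; rewrite -/X -/Y; ring.
have h2_2 : h2^`M(i2) = y21%:MP * X * X + X * (2%:R * y12%:MP * Y + y11)
    + (3%:R * y03%:MP * Y * Y + 2%:R * y02 * Y + y01).
  by rewrite h2_eq !(mderivD, mderivM, mderivC) !dXY !dfree //; rewrite -/X -/Y; ring.
have n2 := nat2R_neq0 n char_K; have n3 := nat3R_neq0 n char_K.
have tr_grid := extract_grid (@grid_free
  [:: [:: q1 + y01; x11 + 2%:R * y02; x12%:MP + 3%:R * y03%:MP];
      [:: 2%:R * p1 + y11; 2%:R * (x21%:MP + y12%:MP)]; [:: 3%:R * b%:MP + y21%:MP]] _).
have {tr_grid} tr_eq : [/\ q1 + y01 = 0, x11 + 2%:R * y02 = 0,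
    x12%:MP + 3%:R * y03%:MP = 0 :> {mpoly K[n]}, 2%:R * p1 + y11 = 0 &
    2%:R * (x21%:MP + y12%:MP) = 0 :> {mpoly K[n]} /\ 3%:R * b%:MP + y21%:MP = 0 :> {mpoly K[n]}].
  have tr_sum : forall k l, (k < 6)%N -> (l < 6)%N -> grid
    [:: [:: q1 + y01; x11 + 2%:R * y02; x12%:MP + 3%:R * y03%:MP];
      [:: 2%:R * p1 + y11; 2%:R * (x21%:MP + y12%:MP)]; [:: 3%:R * b%:MP + y21%:MP]] k l = 0.
    apply: tr_grid => /=.
      by do ?[exact: I|exact: tC|exact: tN|assumption|apply: two_freeD|apply: two_freeM|apply: conj].
    rewrite /row_poly /grid /= -[RHS]tr0 h1_1 h2_2; ring.
  split; [exact: (tr_sum 0%N 0%N)|exact: (tr_sum 0%N 1%N)|exact: (tr_sum 0%N 2%N)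
    |exact: (tr_sum 1%N 0%N)|].
  by split; [exact: (tr_sum 1%N 1%N)|exact: (tr_sum 2%N 0%N)].
have [eq01 eq02 eq03 eq11 [eq12 eq21]] := tr_eq => {tr_eq}.
(* The vanishing trace identifies the coefficients of h1 and h2 in pairs, so both can be renamed as
   those of a single f. *)
pose c := 3%:R^-1 * x21; pose a := - y30; pose d := - y03.
have K3 : 3%:R * 3%:R^-1 = 1 :> K by rewrite mulfV ?nat3_neq0.
have x21_eq : x21%:MP = 3%:R * c%:MP :> {mpoly K[n]}.
  by rewrite -mpolyC_nat -mpolyCM mulrA K3 mul1r.
have x12_eq : x12%:MP = 3%:R * d%:MP :> {mpoly K[n]}.
  apply/eqP; rewrite -subr_eq0; apply/eqP; rewrite -[RHS]eq03 mpolyCN; ring.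
have y30_eq : y30%:MP = - a%:MP :> {mpoly K[n]} by rewrite mpolyCN opprK.
have y21_eq : y21%:MP = - (3%:R * b%:MP) :> {mpoly K[n]}.
  apply/eqP; rewrite -subr_eq0; apply/eqP; rewrite -[RHS]eq21; ring.
have y12_eq : y12%:MP = - (3%:R * c%:MP) :> {mpoly K[n]}.
  apply/eqP; rewrite -x21_eq -subr_eq0; apply/eqP.
  by rewrite -[RHS](mulf_eq0l n2 eq12); ring.
have y03_eq : y03%:MP = - d%:MP :> {mpoly K[n]} by rewrite mpolyCN opprK.
have [p2 p2_eq] : exists p2, p2 = - y02 by exists (- y02).
have [p0 p0_eq] : exists p0, p0 = - y20 by exists (- y20).
have [q0 q0_eq] : exists q0, q0 = - y10 by exists (- y10).
have x11_eq : x11 = 2%:R * p2.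
  apply/eqP; rewrite p2_eq -subr_eq0; apply/eqP; rewrite -[RHS]eq02; ring.
have y20_eq : y20 = - p0 by rewrite p0_eq opprK.
have y11_eq : y11 = - (2%:R * p1).
  apply/eqP; rewrite -subr_eq0; apply/eqP; rewrite -[RHS]eq11; ring.
have y02_eq : y02 = - p2 by rewrite p2_eq opprK.
have y10_eq : y10 = - q0 by rewrite q0_eq opprK.
have y01_eq : y01 = - q1.
  apply/eqP; rewrite -subr_eq0; apply/eqP; rewrite -[RHS]eq01; ring.
have hp0 : p0 \is 1.-homog by rewrite p0_eq rpredN.
have hp2 : p2 \is 1.-homog by rewrite p2_eq rpredN.
have hq0 : q0 \is 2.-homog by rewrite q0_eq rpredN.
have tp0 : two_free p0 by rewrite p0_eq; apply: two_freeN.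
have tp2 : two_free p2 by rewrite p2_eq; apply: two_freeN.
have tq0 : two_free q0 by rewrite q0_eq; apply: two_freeN.
rewrite x21_eq x12_eq x11_eq in h1_1 h1_2.
rewrite y30_eq y21_eq y12_eq y20_eq y11_eq y10_eq in h2_1.
rewrite x21_eq x12_eq x11_eq in h1_eq.
rewrite y30_eq y21_eq y12_eq y03_eq y20_eq y11_eq y02_eq y10_eq y01_eq in h2_eq.
clearbody a c d.
clear x21_eq x12_eq x11_eq y30_eq y21_eq y12_eq y03_eq y20_eq y11_eq y02_eq y10_eq y01_eq.
clear p0_eq p2_eq q0_eq eq01 eq02 eq03 eq11 eq12 eq21 h2_2.
have det_grid k l : (k < 6)%N -> (l < 6)%N -> grid
  [:: [:: q0 * q2 - q1 * q1; 2%:R * (p3 * q0 + p1 * q2 - 2%:R * p2 * q1);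
          2%:R * 2%:R * (p1 * p3 - p2 * p2)
            + 3%:R * (e%:MP * q0 + c%:MP * q2 - 2%:R * d%:MP * q1);
          2%:R * 3%:R * (e%:MP * p1 + c%:MP * p3 - 2%:R * d%:MP * p2);
          3%:R * 3%:R * (c%:MP * e%:MP - d%:MP * d%:MP)];
      [:: 2%:R * (p2 * q0 + p0 * q2 - 2%:R * p1 * q1);
          2%:R * (2%:R * (p0 * p3 - p1 * p2)
            + 3%:R * (d%:MP * q0 + b%:MP * q2 - 2%:R * c%:MP * q1));
          2%:R * 3%:R * (e%:MP * p0 + 2%:R * b%:MP * p3 - 3%:R * c%:MP * p2);
          2%:R * 3%:R * 3%:R * (b%:MP * e%:MP - c%:MP * d%:MP)];
      [:: 2%:R * 2%:R * (p0 * p2 - p1 * p1)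
            + 3%:R * (c%:MP * q0 + a%:MP * q2 - 2%:R * b%:MP * q1);
          2%:R * 3%:R * (2%:R * d%:MP * p0 + a%:MP * p3 - 3%:R * c%:MP * p1);
          3%:R * 3%:R * (a%:MP * e%:MP + 2%:R * b%:MP * d%:MP - 3%:R * c%:MP * c%:MP)];
      [:: 2%:R * 3%:R * (c%:MP * p0 + a%:MP * p2 - 2%:R * b%:MP * p1);
          2%:R * 3%:R * 3%:R * (a%:MP * d%:MP - b%:MP * c%:MP)];
      [:: 3%:R * 3%:R * (a%:MP * c%:MP - b%:MP * b%:MP)]] k l = 0.
  apply: extract_grid.
    apply: grid_free => /=.
    by do ?[exact: I|exact: tC|exact: tN|assumption|apply: two_freeD|apply: two_freeN
      |apply: two_freeM|apply: conj].
  rewrite /row_poly /grid /=; apply: etrans (esym (hessian_expand _ _ _ _ _ _ _ _ _ _ _ _ _ _)) _.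
  have h2_2 : h2^`M(i2) = - h1^`M(i1) by apply/eqP; rewrite -addr_eq0 addrC tr0.
  transitivity (- (h1^`M(i2) * h2^`M(i1)) - h1^`M(i1) * h1^`M(i1)).
    by rewrite h1_1 h1_2 h2_1; ring.
  by rewrite -det0 h2_2; ring.
have cancel x y z : x != 0 -> x * (y - z) = 0 -> y = z :> {mpoly K[n]}.
  by move=> x0 /(mulf_eq0l x0) /eqP; rewrite subr_eq0 => /eqP.
have n6 : 2%:R * 3%:R != 0 :> {mpoly K[n]} by rewrite mulf_neq0.
have n9 : 3%:R * 3%:R != 0 :> {mpoly K[n]} by rewrite mulf_neq0.
have n18 : 2%:R * 3%:R * 3%:R != 0 :> {mpoly K[n]} by rewrite mulf_neq0.
have eqs : hessian_eqs a%:MP b%:MP c%:MP d%:MP e%:MP p0 p1 p2 p3 q0 q1 q2.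
  split; [split|split|split|split|].
  - exact: (cancel _ _ _ n9 (det_grid 4%N 0%N _ _)).
  - exact: (cancel _ _ _ n18 (det_grid 3%N 1%N _ _)).
  - exact: (cancel _ _ _ n9 (det_grid 2%N 2%N _ _)).
  - exact: (cancel _ _ _ n18 (det_grid 1%N 3%N _ _)).
  - exact: (cancel _ _ _ n9 (det_grid 0%N 4%N _ _)).
  - exact: (cancel _ _ _ n6 (det_grid 3%N 0%N _ _)).
  - exact: (cancel _ _ _ n6 (det_grid 2%N 1%N _ _)).
  - exact: (cancel _ _ _ n6 (det_grid 1%N 2%N _ _)).
  - exact: (cancel _ _ _ n6 (det_grid 0%N 3%N _ _)).
  - exact: (det_grid 2%N 0%N).
  - exact: (mulf_eq0l n2 (det_grid 1%N 1%N _ _)).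
  - exact: (det_grid 0%N 2%N).
  - exact: (cancel _ _ _ n2 (det_grid 1%N 0%N _ _)).
  - exact: (cancel _ _ _ n2 (det_grid 0%N 1%N _ _)).
  - by apply: (cancel 1); rewrite ?oner_neq0 // mul1r; exact: (det_grid 0%N 0%N).
(* A constant kernel vector of the Hessian annihilates the gradients of f_y and - f_x, which are the
   rows of the block. *)
case: (hessian_cases char_K hp0 hp1 hp2 hp3 hq0 hq1 hq2 eqs).
  move=> [u [v [uv [[ab bc cd de] [p01 p12 p23] [q01 q12]]]]].
  left; exists u, v; split=> //.
    transitivity (3%:R * X * X * (u%:MP * b%:MP + v%:MP * c%:MP)
      + 2%:R * 3%:R * X * Y * (u%:MP * c%:MP + v%:MP * d%:MP)
      + 3%:R * Y * Y * (u%:MP * d%:MP + v%:MP * e%:MP)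
      + 2%:R * X * (u%:MP * p1 + v%:MP * p2) + 2%:R * Y * (u%:MP * p2 + v%:MP * p3)
      + (u%:MP * q1 + v%:MP * q2)); first by rewrite h1_1 h1_2; ring.
    by rewrite bc cd de p12 p23 q12; ring.
  have -> : h2^`M(i2) = - h1^`M(i1) by apply/eqP; rewrite -addr_eq0 addrC tr0.
  transitivity (- (3%:R * X * X * (u%:MP * a%:MP + v%:MP * b%:MP)
      + 2%:R * 3%:R * X * Y * (u%:MP * b%:MP + v%:MP * c%:MP)
      + 3%:R * Y * Y * (u%:MP * c%:MP + v%:MP * d%:MP)
      + 2%:R * X * (u%:MP * p0 + v%:MP * p1) + 2%:R * Y * (u%:MP * p1 + v%:MP * p2)
      + (u%:MP * q0 + v%:MP * q1))); first by rewrite h1_1 h2_1; ring.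
  by rewrite ab bc cd p01 p12 q01; ring.
case=> [[b0 c0 d0 e0] [p10 p20 p30] [a0 [p00 [k [y [m [k_neq0 y1 m1 indep [q0_eq q1_eq q2_eq]]]]]]]].
right; exists k, y, m, r1, r2; split=> //.
  (* [y] and [m] inherit the absence of x1 and x2 from q0 = k y^2 and q2 = k m^2. *)
  have tsq f q : f \is 1.-homog -> two_free q -> q = k%:MP * (f * f) -> two_free f.
    move=> f1 [fq gq] q_eq; have kI : k%:MP != 0 :> {mpoly K[n]} by rewrite mpolyC_eq0.
    have dq i : varfree i q -> varfree i f.
      move=> /mderiv_free; rewrite q_eq mderiv_mulC mderivM => /(mulf_eq0l kI) df0.
      apply: (deriv0_free char_K _ f1) => //.
      have [f0|f_neq0] := eqVneq f 0; first by rewrite f0 mderiv0.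
      by apply: (mulf_eq0l f_neq0); apply: (mulf_eq0l n2); rewrite -[RHS]df0; ring.
    by split; apply: dq.
  by split; [apply: (tsq y q0) | apply: (tsq m q2)].
split=> //.
  by rewrite h1_eq b0 c0 d0 e0 p10 p20 p30 q1_eq q2_eq !mpolyC0 -/X -/Y; ring.
by rewrite h2_eq a0 b0 c0 d0 p00 p10 p20 q0_eq q1_eq !mpolyC0 -/X -/Y; ring.
Qed.

End NilpotentBlock.

(** * Triangularizable maps and the rank two dichotomy *)

Section Triangularizable.

Variables (K : fieldType) (n : nat).
Hypothesis char_K : (6%:R : K) \is a GRing.unit.
Implicit Types (H : polymap K n) (i j : 'I_n).

(* Equal weights are allowed, and then force a zero entry: triangularity with
   respect to any order refining the weights. *)
Definition weight_triangular (rho : 'I_n -> nat) H : Prop :=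
  forall i j, (rho j <= rho i)%N -> (H i 0)^`M(j) = 0.

Definition triangularizable H : Prop :=
  exists2 T : 'M[K]_n, T \in unitmx & exists rho, weight_triangular rho (lin_conj T H).

Lemma lin_conj1 H : lin_conj 1%:M H = H.
Proof.
apply/matrixP => i j; rewrite ord1 lin_conjE invmx1 (bigD1 i) //= mxE eqxx mul1r.
rewrite lin_subst1 big1 ?addr0 // => l neq.
by rewrite mxE eq_sym (negPf neq) mpolyC0 mul0r.
Qed.

Lemma weight_triangularizable rho H : weight_triangular rho H -> triangularizable H.
Proof. by move=> rhoH; exists 1%:M; rewrite ?unitmx1 ?lin_conj1 //; exists rho. Qed.

Lemma triangularizable_lin_conj T H : T \in unitmx ->
  triangularizable (lin_conj T H) -> triangularizable H.
Proof.
move=> Tu [U Uu [rho rhoH]]; exists (T *m U); first by rewrite unitmx_mul Tu.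
by exists rho; rewrite -lin_conj_comp.
Qed.

(** The weights order the indices: variables absent from H, then [i1], then [i2], then zero
    components. Each component involves only variables of larger weight than its own. *)
Lemma block_weight H i1 i2 (Z : pred 'I_n) :
  (forall j, j != i1 -> j != i2 -> Z j -> H j 0 = 0) ->
  (forall j, j != i1 -> j != i2 -> ~~ Z j -> forall i, (H i 0)^`M(j) = 0) ->
  (H i1 0)^`M(i1) = 0 -> (H i2 0)^`M(i2) = 0 -> (H i2 0)^`M(i1) = 0 ->
  triangularizable H.
Proof.
move=> HZ HL d11 d22 d21.
pose rho j : nat := if j == i1 then 1%N else if j == i2 then 2%N
  else if Z j then 3%N else 0%N.
apply: (@weight_triangularizable rho) => i j; rewrite /rho.
have [->|j1] := eqVneq j i1.
  have [->//|i1'] := eqVneq i i1; have [->//|i2'] := eqVneq i i2.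
  by case: ifP => // Zi _; rewrite HZ // mderiv0.
have [->|j2] := eqVneq j i2.
  have [_ //|i1'] := eqVneq i i1; have [->//|i2'] := eqVneq i i2.
  by case: ifP => // Zi _; rewrite HZ // mderiv0.
case: ifP => [Zj|/negbT Zj _]; last exact: HL.
have [_ //|i1'] := eqVneq i i1; have [_ //|i2'] := eqVneq i i2.
by case: ifP => // Zi _; rewrite HZ // mderiv0.
Qed.

Variables i1 i2 : 'I_n.
Hypothesis neq12 : i1 != i2.

Let neq21 : i2 != i1. Proof. by rewrite eq_sym. Qed.

Lemma trace_split (f : 'I_n -> {mpoly K[n]}) :
  (forall j, j != i1 -> j != i2 -> f j = 0) -> \sum_j f j = f i1 + f i2.
Proof.
move=> f0; rewrite (bigD1 i1) //= (bigD1 i2) //= big1 ?addr0 // => j /andP[]; exact: f0.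
Qed.

Definition block_split H := forall j, j != i1 -> j != i2 ->
  H j 0 = 0 \/ (forall i, (H i 0)^`M(j) = 0).

(** Every index outside the block has a zero row or a zero column, so tr J and tr J^2 are those of
    the block B, and (tr B)^2 - tr B^2 = 2 det B. *)
Lemma block_trace_det H : block_split H ->
  \tr (jacobian H) = 0 -> \tr (jacobian H *m jacobian H) = 0 ->
  (H i1 0)^`M(i1) + (H i2 0)^`M(i2) = 0 /\
  (H i1 0)^`M(i1) * (H i2 0)^`M(i2) = (H i1 0)^`M(i2) * (H i2 0)^`M(i1).
Proof.
move=> split_H tr1 tr2; have tr0 : (H i1 0)^`M(i1) + (H i2 0)^`M(i2) = 0.
  rewrite -[RHS]tr1 /mxtrace trace_split ?mxE // => j neq1 neq2; rewrite mxE.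
  by case: (split_H j neq1 neq2) => [->|->]; rewrite ?mderiv0.
split=> //; have : \tr (jacobian H *m jacobian H) =
    (H i1 0)^`M(i1) * (H i1 0)^`M(i1) + (H i1 0)^`M(i2) * (H i2 0)^`M(i1) +
    ((H i2 0)^`M(i1) * (H i1 0)^`M(i2) + (H i2 0)^`M(i2) * (H i2 0)^`M(i2)).
  rewrite /mxtrace trace_split => [|j neq1 neq2].
    rewrite !mxE !trace_split ?mxE // => j neq1 neq2; rewrite !mxE;
    by case: (split_H j neq1 neq2) => [->|->]; rewrite ?mderiv0 ?mulr0 ?mul0r.
  rewrite mxE big1 // => l _; rewrite !mxE.
  by case: (split_H j neq1 neq2) => [->|->]; rewrite ?mderiv0 ?mulr0 ?mul0r.
rewrite tr2 => det0.
have h2 : (H i2 0)^`M(i2) = - (H i1 0)^`M(i1) by apply/eqP; rewrite -addr_eq0 addrC tr0.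
apply/eqP; rewrite -subr_eq0; apply/eqP; apply: (mulf_eq0l (nat2R_neq0 n char_K)).
by rewrite -[RHS]oppr0 [X in _ = - X]det0 h2; ring.
Qed.

(** Moving the kernel vector to a basis vector clears one column of the block; the vanishing trace
    then clears the other diagonal entry, and [block_weight] applies. *)
Lemma block_kernel_triangularizable H u v :
  block_split H -> (H i1 0)^`M(i1) + (H i2 0)^`M(i2) = 0 -> (u != 0) || (v != 0) ->
  u%:MP * (H i1 0)^`M(i1) + v%:MP * (H i1 0)^`M(i2) = 0 ->
  u%:MP * (H i2 0)^`M(i1) + v%:MP * (H i2 0)^`M(i2) = 0 -> triangularizable H.
Proof.
move=> split_H tr0 uv ker1 ker2.
have cI c p : c != 0 -> c%:MP * p = 0 -> p = 0 :> {mpoly K[n]}.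
  by move=> c0; apply: mulf_eq0l; rewrite mpolyC_eq0.
pose Z j := H j 0 == 0.
have ZP j : j != i1 -> j != i2 -> Z j -> H j 0 = 0 by move=> _ _ /eqP.
have LP j : j != i1 -> j != i2 -> ~~ Z j -> forall i, (H i 0)^`M(j) = 0.
  by move=> j1 j2 Zj; case: (split_H j j1 j2) => // Hj0; rewrite /Z Hj0 eqxx in Zj.
(* For u = 0 the kernel vector is already a basis vector, and exchanging [i1] and [i2] suffices. *)
have [u0|u_neq0] := eqVneq u 0.
  rewrite u0 eqxx /= in uv; rewrite u0 mpolyC0 !mul0r !add0r in ker1 ker2.
  have d12 := cI _ _ uv ker1; have d22 := cI _ _ uv ker2.
  apply: (@block_weight _ i2 i1 Z) => // [j j2 j1|j j2 j1|]; [exact: ZP|exact: LP|].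
  by rewrite -[RHS]tr0 d22 addr0.
pose w := v / u.
have dw f : u%:MP * f^`M(i1) + v%:MP * f^`M(i2) = 0 -> f^`M(i1) + w%:MP * f^`M(i2) = 0.
  move=> kf; apply: (cI _ _ u_neq0); rewrite -[RHS]kf mulrDr mulrA -mpolyCM.
  by rewrite /w mulrCA mulfV // mulr1.
have {}ker1 := dw _ ker1; have {}ker2 := dw _ ker2.
(* [T] adds w = v / u times the basis vector of [i2] to that of [i1], which produces the kernel
   vector, and fixes the other basis vectors. *)
pose E : 'M[K]_n := delta_mx i2 i1.
have EE : E *m E = 0 by rewrite /E mul_delta_mx_0.
pose T := 1%:M + w *: E; pose T' := 1%:M - w *: E.
have TT' : T *m T' = 1%:M.
  rewrite mulmxDl mul1mx /T' mulmxBr mulmx1 -scalemxAl -scalemxAr EE !scaler0 subr0.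
  by rewrite subrK.
have [Tu _] := mulmx1_unit TT'.
have invT : invmx T = T' by rewrite -[RHS](mulKmx Tu) TT' mulmx1.
have T_E a b : T a b = (a == b)%:R + w * ((a == i2) && (b == i1))%:R by rewrite !mxE.
have T'_E a b : T' a b = (a == b)%:R - w * ((a == i2) && (b == i1))%:R by rewrite !mxE.
have dT p j : j != i1 -> (lin_subst T p)^`M(j) = lin_subst T p^`M(j).
  move=> j1; rewrite mderiv_lin_subst (bigD1 j) //= big1 => [|l neq].
    by rewrite T_E eqxx (negPf j1) andbF mulr0 !addr0 mpolyC1 mulr1.
  by rewrite T_E (negPf neq) (negPf j1) andbF mulr0 addr0 mpolyC0 mulr0.
have dT1 p : (lin_subst T p)^`M(i1) = lin_subst T (p^`M(i1) + w%:MP * p^`M(i2)).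
  rewrite mderiv_lin_subst trace_split => [|l l1 l2]; last first.
    by rewrite T_E (negPf l1) (negPf l2) mulr0 addr0 mpolyC0 mulr0.
  rewrite rmorphD rmorphM /= lin_substC !T_E !eqxx (negPf neq12) (negPf neq21) /=.
  by rewrite !(mulr0, addr0, add0r, mulr1, mpolyC1) [w%:MP * _]mulrC.
have conj_E j : j != i2 -> lin_conj T H j 0 = lin_subst T (H j 0).
  move=> j2; rewrite lin_conjE invT (bigD1 j) //= big1 => [|l neq].
    by rewrite T'_E eqxx (negPf j2) mulr0 subr0 addr0 mpolyC1 mul1r.
  by rewrite T'_E eq_sym (negPf neq) (negPf j2) mulr0 subr0 mpolyC0 mul0r.
have conj_2 : lin_conj T H i2 0 = lin_subst T (H i2 0 - w%:MP * H i1 0).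
  rewrite lin_conjE invT trace_split => [|l l1 l2]; last first.
    by rewrite T'_E eq_sym (negPf l1) (negPf l2) andbF mulr0 subr0 mpolyC0 mul0r.
  rewrite rmorphB rmorphM /= lin_substC !T'_E !eqxx (negPf neq21) /=.
  by rewrite !(mulr0, subr0, sub0r, mulr1, mpolyC1, mul1r) mpolyCN mulNr addrC.
apply: (triangularizable_lin_conj Tu); apply: (@block_weight _ i1 i2 Z) => //.
- by move=> j j1 j2 Zj; rewrite conj_E // ZP // rmorph0.
- move=> j j1 j2 Zj i; have dH l : (lin_subst T (H l 0))^`M(j) = 0.
    by rewrite dT // LP // rmorph0.
  have [->|i2'] := eqVneq i i2; last by rewrite conj_E.
  by rewrite conj_2 dT // mderivB mderiv_mulC !LP // mulr0 subr0 rmorph0.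
- by rewrite conj_E // dT1 ker1 rmorph0.
- rewrite conj_2 dT // mderivB mderiv_mulC.
  have -> : (H i2 0)^`M(i2) - w%:MP * (H i1 0)^`M(i2) =
    ((H i1 0)^`M(i1) + (H i2 0)^`M(i2)) - ((H i1 0)^`M(i1) + w%:MP * (H i1 0)^`M(i2)).
    by ring.
  by rewrite tr0 ker1 subr0 rmorph0.
- rewrite conj_2 dT1 mderivB mderiv_mulC mderivB mderiv_mulC.
  have -> : (H i2 0)^`M(i1) - w%:MP * (H i1 0)^`M(i1) +
     w%:MP * ((H i2 0)^`M(i2) - w%:MP * (H i1 0)^`M(i2)) =
    ((H i2 0)^`M(i1) + w%:MP * (H i2 0)^`M(i2))
      - w%:MP * ((H i1 0)^`M(i1) + w%:MP * (H i1 0)^`M(i2)) by ring.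
  by rewrite ker1 ker2 mulr0 subr0 rmorph0.
Qed.

End Triangularizable.

(** * Independent linear forms as coordinates *)

Section LinearForms.

Variable K : fieldType.
Hypothesis char_K : (6%:R : K) \is a GRing.unit.

Lemma linear_formE n (p : {mpoly K[n]}) : p \is 1.-homog ->
  p = \sum_i (p@_(U_(i)))%:MP * 'X_i.
Proof.
move=> p1; rewrite -[LHS]mul1r -(euler p1); apply: eq_bigr => i _.
have [c p_i] := mderiv_linear i p1; rewrite p_i mulrC; congr (_%:MP * _).
have := congr1 (mcoeff 0%MM) p_i.
by rewrite mcoeff_mderiv mnm0E add0m mulr1n mcoeffC eqxx mulr1 => ->.
Qed.

(** Independence gives the coefficient matrix a right inverse, and [complete_dual_pair] turns its
    rows into coordinate forms. *)
Lemma linear_coordinates r k (p : 'I_r -> {mpoly K[r + k]}) :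
  (forall i, p i \is 1.-homog) ->
  (forall v : 'I_r -> K, \sum_i (v i)%:MP * p i = 0 -> forall i, v i = 0) ->
  exists2 T, T \in unitmx & forall i, lin_subst T (p i) = 'X_(lshift k i).
Proof.
move=> p1 indep; pose A : 'M[K]_(r, r + k) := \matrix_(i, j) (p i)@_(U_(j)).
have pE i : p i = \sum_j (A i j)%:MP * 'X_j.
  by rewrite {1}(linear_formE (p1 i)); apply: eq_bigr => j _; rewrite mxE.
have /row_freeP[B AB1] : row_free A.
  apply: inj_row_free => v vA0; apply/rowP => i; rewrite mxE.
  apply: (indep (fun i => v 0 i)) => {i}.
  under eq_bigr => i _ do rewrite pE mulr_sumr.
  rewrite exchange_big big1 // => j _.
  have := congr1 (fun X : 'rV_(r + k) => X 0 j) vA0; rewrite /= !mxE => vAj.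
  transitivity ((\sum_i v 0 i * A i j)%:MP * 'X_j : {mpoly K[r + k]}).
    rewrite raddf_sum mulr_suml; apply: eq_bigr => i _.
    by rewrite /= mpolyCM mulrA.
  by rewrite vAj mpolyC0 mul0r.
have [T Tu [AT _]] := complete_dual_pair AB1; exists T => // i.
rewrite pE rmorph_sum /=.
under eq_bigr => j _ do rewrite rmorphM /= lin_substC lin_subst_var mulr_sumr.
rewrite exchange_big /=.
transitivity (\sum_l ((A *m T) i l)%:MP * 'X_l : {mpoly K[r + k]}).
  apply: eq_bigr => l _; rewrite mxE raddf_sum mulr_suml; apply: eq_bigr => j _.
  by rewrite /= mpolyCM mulrA.
rewrite AT (bigD1 (lshift k i)) //= row_mxEl mxE eqxx mpolyC1 mul1r big1 ?addr0 // => l.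
case: (splitP l) => q l_eq.
  have -> : l = lshift k q by apply: val_inj.
  rewrite (inj_eq (@lshift_inj _ _)) eq_sym => /negPf neq.
  by rewrite row_mxEl mxE neq mpolyC0 mul0r.
have -> : l = rshift r q by apply: val_inj.
by rewrite row_mxEr mxE mpolyC0 mul0r.
Qed.

Definition two_parameter_form n (i1 i2 : 'I_n) (h1 h2 : {mpoly K[n]}) : Prop :=
  exists k y m r1 r2,
    [/\ k != 0, y \is 1.-homog /\ m \is 1.-homog,
      two_free i1 i2 y /\ two_free i1 i2 m,
      (forall u v : K, u%:MP * y + v%:MP * m = 0 -> u = 0 /\ v = 0) &
      [/\ h1 = k%:MP * m * (y * 'X_i1 + m * 'X_i2) + r1,
           h2 = - (k%:MP * y * (y * 'X_i1 + m * 'X_i2)) + r2,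
           two_free i1 i2 r1 & two_free i1 i2 r2]].

(** The coefficients - k y^2 of x1 in h2 and k m^2 of x2 in h1 would confine y and m to the single
    variable x_i3, against their independence. *)
Lemma form_needs_two_parameters n (i1 i2 i3 : 'I_n) h1 h2 : i1 != i2 ->
  two_parameter_form i1 i2 h1 h2 ->
  ~ (forall j, j != i1 -> j != i2 -> j != i3 -> h1^`M(j) = 0 /\ h2^`M(j) = 0).
Proof.
move=> neq12 [k [y [m [r1 [r2 [k_neq0 [y1 m1] [ty tm] indep [h1_eq h2_eq tr1 tr2]]]]]]] dh0.
have kI : k%:MP != 0 :> {mpoly K[n]} by rewrite mpolyC_eq0.
have n2 := nat2R_neq0 n char_K.
have neq21 : i2 != i1 by rewrite eq_sym.
have dy_dm j : j != i3 -> y^`M(j) = 0 /\ m^`M(j) = 0.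
  move=> j3; have [->|j1] := eqVneq j i1.
    by case: ty tm => /mderiv_free -> _ [/mderiv_free ->].
  have [->|j2] := eqVneq j i2.
    by case: ty tm => _ /mderiv_free -> [_ /mderiv_free ->].
  have [dh1 dh2] := dh0 j j1 j2 j3.
  have dX1 : ('X_i1 : {mpoly K[n]})^`M(j) = 0 by rewrite mderivXU (negPf j1).
  have dX2 : ('X_i2 : {mpoly K[n]})^`M(j) = 0 by rewrite mderivXU (negPf j2).
  have coef (f g c : {mpoly K[n]}) i i' : i != i' ->
      varfree i f -> varfree i g -> varfree i c ->
      2%:R * k%:MP * f * f^`M(j) * 'X_i + k%:MP * g * 'X_i' + c = 0 -> f != 0 -> f^`M(j) = 0.
    move=> neq ff fg fc sum0 f_neq0.
    have fX : varfree i ('X_i' : {mpoly K[n]}) by apply: freeX; rewrite eq_sym.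
    have fk := freeC i k; have f2 := free_nat K i 2%N; have f0 := free0 K i.
    have fj := free_mderiv j ff.
    have := @extract_var _ _ i (k%:MP * g * 'X_i' + c) (2%:R * k%:MP * f * f^`M(j)) 0 0 0 0.
    case; do ?[assumption|apply: freeD|apply: freeM].
      by rewrite -[RHS]sum0; ring.
    case=> _ eq0 _ _; apply: (mulf_eq0l f_neq0); apply: (mulf_eq0l kI).
    by apply: (mulf_eq0l n2); rewrite -[RHS]eq0; ring.
  have y_neq0 : y != 0.
    have [y0|//] := eqVneq y 0; have [] := indep 1 0; last by move=> /eqP; rewrite oner_eq0.
    by rewrite y0 mpolyC0; ring.
  have m_neq0 : m != 0.
    have [m0|//] := eqVneq m 0; have [] := indep 0 1; last by move=> _ /eqP; rewrite oner_eq0.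
    by rewrite m0 mpolyC0; ring.
  case: ty tm tr1 tr2 => fy gy [fm gm] [fr1 gr1] [fr2 gr2]; split.
    apply: (coef y (y^`M(j) * m + y * m^`M(j)) (- r2^`M(j)) i1 i2) => //.
    - by apply: freeD; apply: freeM => //; apply: free_mderiv.
    - by apply: freeN; apply: free_mderiv.
    - rewrite -[RHS]oppr0 -[X in _ = - X]dh2 h2_eq !(mderivD, mderivN, mderivM, mderivC) dX1 dX2.
      by ring.
  apply: (coef m (y^`M(j) * m + y * m^`M(j)) (r1^`M(j)) i2 i1) => //.
  - by apply: freeD; apply: freeM => //; apply: free_mderiv.
  - by apply: free_mderiv.
  - rewrite -[RHS]dh1 h1_eq !(mderivD, mderivN, mderivM, mderivC) dX1 dX2.
    by ring.
have [a y_eq] := dhomog_one_var char_K (isT : (1 < 5)%N) y1 (fun j j3 => proj1 (dy_dm j j3)).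
have [b m_eq] := dhomog_one_var char_K (isT : (1 < 5)%N) m1 (fun j j3 => proj2 (dy_dm j j3)).
have [] := indep b (- a).
  by rewrite y_eq m_eq mpolyCN -!mul_mpolyC; ring.
move=> b0 /eqP; rewrite oppr_eq0 => /eqP a0.
have [] := indep 1 0; last by move=> /eqP; rewrite oner_eq0.
by rewrite y_eq a0 scale0r mpolyC0; ring.
Qed.

End LinearForms.

(** * The dichotomy in rank two *)

Section RankTwo.

Variable K : fieldType.
Hypothesis char_K : (6%:R : K) \is a GRing.unit.

Lemma block_dichotomy n (H : polymap K n) (i1 i2 : 'I_n) : i1 != i2 ->
  cubic_homogeneous H -> block_split i1 i2 H ->
  \tr (jacobian H) = 0 -> \tr (jacobian H *m jacobian H) = 0 ->
  triangularizable H \/ two_parameter_form i1 i2 (H i1 0) (H i2 0).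
Proof.
move=> neq12 H_cubic split_H tr1 tr2.
have [tr0 det0] := block_trace_det char_K neq12 split_H tr1 tr2.
case: (nilpotent_block char_K neq12 (H_cubic i1) (H_cubic i2) tr0 det0); last by right.
by case=> u [v [uv k1 k2]]; left; apply: (block_kernel_triangularizable _ split_H _ uv).
Qed.

Lemma lshift_neq k : lshift k (0 : 'I_2) != lshift k 1.
Proof. by rewrite (inj_eq (@lshift_inj _ _)). Qed.

(** The coefficient matrix with columns a and b has rank at most 2; in a basis adapted to its column
    space only the first two components survive. *)
Lemma plane_coordinates k (H : polymap K (2 + k)) (a b : 'I_(2 + k) -> K) f1 f2 :
  (forall i, H i 0 = a i *: f1 + b i *: f2) ->
  exists2 T, T \in unitmx & forall j, lin_conj T H (rshift 2 j) 0 = 0.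
Proof.
move=> H_eq; pose M : 'M_(2 + k, 2) := \matrix_(i < 2 + k, r < 2) if r == 0 then a i else b i.
pose L := col_ebase M; have Lu : L \in unitmx := col_ebase_unit M.
exists L => // j; rewrite lin_conjE.
have LM r : \sum_i invmx L (rshift 2 j) i * M i r = 0.
  have := congr1 (fun X : 'M_(2 + k, 2) => (invmx L *m X) (rshift 2 j) r) (mulmx_ebase M).
  rewrite -mulmxA mulKmx // mxE big1 => [|q _]; first by rewrite [RHS]mxE => /esym.
  rewrite mxE /=; case: eqP => [eq_jq|_]; last by rewrite mul0r.
  by have := ltn_ord q; rewrite -eq_jq ltnNge leq_addr.
transitivity ((\sum_i invmx L (rshift 2 j) i * M i 0)%:MP * lin_subst L f1
  + (\sum_i invmx L (rshift 2 j) i * M i 1)%:MP * lin_subst L f2); last first.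
  by rewrite !LM mpolyC0 !mul0r addr0.
rewrite !raddf_sum !mulr_suml -big_split /=; apply: eq_bigr => i _.
rewrite /= H_eq -!mul_mpolyC rmorphD !rmorphM /= !lin_substC !mxE /=.
by ring.
Qed.

Lemma cone_coordinates n (H : polymap K n) (i1 i2 j0 : 'I_n) l mu (a b c : 'I_n -> K) :
  i1 != i2 -> l \is 1.-homog -> varfree i1 l -> j0 != i1 -> j0 != i2 -> l^`M(j0) != 0 ->
  (forall i, H i 0 = ('X_i1 + 2%:R * l + mu%:MP * 'X_i2) *
     ((a i)%:MP * (('X_i1 - l - mu%:MP * 'X_i2) * ('X_i1 - l - mu%:MP * 'X_i2))
      + (b i)%:MP * (('X_i1 - l - mu%:MP * 'X_i2) * 'X_i2)
      + (c i)%:MP * ('X_i2 * 'X_i2))) ->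
  exists o1 o2 o3 : 'I_n, [/\ o1 != o2, o1 != o3, o2 != o3 &
  exists2 T, T \in unitmx & exists a b c : 'I_n -> K, forall i,
    lin_conj T H i 0 = 'X_o3 * ((a i)%:MP * ('X_o1 * 'X_o1)
      + (b i)%:MP * ('X_o1 * 'X_o2) + (c i)%:MP * ('X_o2 * 'X_o2))].
Proof.
move=> neq12 l1 fl j1 j2 lj H_eq.
have [k n_eq] : exists k, n = (3 + k)%N.
  exists (n - 3)%N; rewrite subnKC //.
  have : (#|[set i1; i2; j0]| <= n)%N by rewrite -[X in (_ <= X)%N]card_ord max_card.
  by rewrite cardsU cards2 neq12 cards1 (_ : _ :&: _ = set0) ?cards0 //; apply/setP => x;
    rewrite !inE; apply/negP => /andP[/orP[]/eqP-> /eqP eq]; rewrite eq eqxx in j1 j2.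
subst n.
pose p (r : 'I_3) : {mpoly K[3 + k]} := if r == 0 then 'X_i1 - l - mu%:MP * 'X_i2
  else if r == 1 then 'X_i2 else 'X_i1 + 2%:R * l + mu%:MP * 'X_i2.
have X1 i : ('X_i : {mpoly K[3 + k]}) \is 1.-homog := dhomogXU K i.
have p1 r : p r \is 1.-homog.
  rewrite /p; case: ifP => _; first by rewrite !rpredB // mul_mpolyC dhomogZ.
  by case: ifP => _ //; rewrite !rpredD // -?mpolyC_nat mul_mpolyC dhomogZ.
have [T Tu Tp] : exists2 T, T \in unitmx & forall i, lin_subst T (p i) = 'X_(lshift k i).
  apply: (linear_coordinates p1) => v; rewrite !big_ord_recl big_ord0 addr0 /p /=.
  set v0 := v ord0; set v1 := v (lift ord0 ord0); set v2 := v (lift ord0 (lift ord0 ord0)).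
  rewrite -mpolyC_nat => sum0.
  (* The derivatives in x1 and x_j0 give v0 + v2 = 0 and, since l_j0 is nonzero, 2 v2 = v0; hence 3
     v2 = 0. *)
  have := congr1 (mderiv j0) sum0; have := congr1 (mderiv i1) sum0.
  rewrite !mderivE (mderiv_free fl) !eqxx (negPf j1) (negPf j2) (negPf neq12).
  rewrite !(mulr1n, mulr0n) mpolyC_nat => d1 dj.
  have v2_0 : v2%:MP = 0 :> {mpoly K[3 + k]}.
    apply: (mulf_eq0l lj); apply: (mulf_eq0l (nat3R_neq0 (3 + k) char_K)).
    transitivity ((- v0%:MP * l^`M(j0) + 2%:R * v2%:MP * l^`M(j0))
      + (v0%:MP + v2%:MP) * l^`M(j0)); first by ring.
    have -> : v0%:MP + v2%:MP = 0 :> {mpoly K[3 + k]} by rewrite -[RHS]d1; ring.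
    by rewrite mul0r addr0 -[RHS]dj; ring.
  have v0_0 : v0%:MP = 0 :> {mpoly K[3 + k]}.
    rewrite v2_0 in d1; rewrite -[RHS]d1; ring.
  have v1_0 : v1%:MP = 0 :> {mpoly K[3 + k]}.
    apply: (mulf_eq0l (mpolyXU_neq0 K i2)); rewrite v0_0 v2_0 in sum0.
    by rewrite -[RHS]sum0; ring.
  have zeroC x : x%:MP = 0 :> {mpoly K[3 + k]} -> x = 0.
    by move=> /eqP; rewrite mpolyC_eq0 => /eqP.
  case=> [[|[|[|//]]] r_lt]; [rewrite -[RHS](zeroC _ v0_0)|rewrite -[RHS](zeroC _ v1_0)
    |rewrite -[RHS](zeroC _ v2_0)]; congr v; exact: val_inj.
have Tp0 := Tp 0; have Tp1 := Tp 1; have Tp2 := Tp (lift ord0 (lift ord0 ord0)).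
rewrite /p /= in Tp0 Tp1 Tp2.
exists (lshift k 0), (lshift k 1), (lshift k (lift ord0 (lift ord0 ord0))).
rewrite !(inj_eq (@lshift_inj _ _)); split=> //; exists T => //.
exists (fun i => \sum_j invmx T i j * a j), (fun i => \sum_j invmx T i j * b j),
  (fun i => \sum_j invmx T i j * c j) => i.
rewrite lin_conjE !raddf_sum !mulr_suml -!big_split mulr_sumr /=.
apply: eq_bigr => j _; rewrite H_eq rmorphM /= Tp2 !rmorphD !rmorphM /= Tp0 Tp1 !lin_substC.
by rewrite ?mpolyCM; ring.
Qed.

(** In the last two cases of the classification H depends, after a linear change, on the two
    variables of a block and at most one more, so [form_needs_two_parameters] leaves only
    triangularizability. *)
Lemma rank2_dichotomy k (H : polymap K (2 + k)) :
  cubic_homogeneous H -> nilpotent_mx (jacobian H) -> rkJ H = 2%N ->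
  triangularizable H \/
  exists2 T, T \in unitmx & (forall j, lin_conj T H (rshift 2 j) 0 = 0) /\
    two_parameter_form (lshift k 0) (lshift k 1)
      (lin_conj T H (lshift k 0) 0) (lin_conj T H (lshift k 1) 0).
Proof.
move=> H_cubic H_nil rk2.
have [T Tu [f1 [f2 [V1 V2 g1 g2]]]] := rank2_coordinates char_K H_cubic rk2.
have [tr1 tr2] := nilpotent_trace_jac H_nil; have neq12 := lshift_neq k.
have [trT1 trT2] := trace_lin_conj Tu tr1 tr2.
have T_cubic := cubic_lin_conj T H_cubic.
have rk_le2 : rank_le2 (jacobian (lin_conj T H)).
  by apply: rank_le2_lin_conj => //; apply: rkJ_rank_le2; rewrite rk2.
have others j : j != lshift k 0 -> j != lshift k 1 -> exists i, j = rshift 2 i.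
  case: (splitP j) => q j_eq; last by exists q; apply: val_inj.
  have -> : j = lshift k q by apply: val_inj.
  by rewrite !(inj_eq (@lshift_inj _ _)); case: q {j_eq} => [[|[|//]] ?].
case: (cubic_space_classification char_K neq12 (@span_comb _ _ (lin_conj T H))
   (fun f => span_homog T_cubic) (fun f g h => span_dep rk_le2)
   (span_entry (lin_conj T H)) V1 V2 g1 g2).
- move=> [a [b H_eq]]; have [U Uu U0] := plane_coordinates H_eq.
  rewrite lin_conj_comp // in U0; have TU : T *m U \in unitmx by rewrite unitmx_mul Tu.
  have [trU1 trU2] := trace_lin_conj TU tr1 tr2.
  have split_U : block_split (lshift k 0) (lshift k 1) (lin_conj (T *m U) H).
    move=> j j1 j2; left; have [i ->] := others j j1 j2; exact: U0.
  case: (block_dichotomy neq12 (cubic_lin_conj _ H_cubic) split_U trU1 trU2) => [tri|form].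
    by left; apply: triangularizable_lin_conj tri.
  by right; exists (T *m U).
- move=> H_free; left; apply: (triangularizable_lin_conj Tu).
  have split_T : block_split (lshift k 0) (lshift k 1) (lin_conj T H).
    by move=> j j1 j2; right => i; apply: H_free.
  case: (block_dichotomy neq12 T_cubic split_T trT1 trT2) => // form.
  (* No third variable occurs here, so the choice of [i3] is arbitrary. *)
  case: (form_needs_two_parameters char_K (i3 := lshift k 0) neq12 form) => j j1 j2 _.
  by rewrite !H_free.
move=> [l [mu [j0 [a [b [c [[l1 fl j1 j2 lj] /= H_eq]]]]]]]; left.
have [o1 [o2 [o3 [neq12' neq13 neq23 [U Uu [a' [b' [c' HU_eq]]]]]]]] :=
  cone_coordinates neq12 l1 fl j1 j2 lj H_eq.
rewrite lin_conj_comp // in HU_eq; have TU : T *m U \in unitmx by rewrite unitmx_mul Tu.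
have [trU1 trU2] := trace_lin_conj TU tr1 tr2.
apply: (triangularizable_lin_conj TU).
move: (lin_conj (T *m U) H) (cubic_lin_conj (T *m U) H_cubic) HU_eq trU1 trU2.
move=> G G_cubic G_eq trG1 trG2.
have dX i j : ('X_i : {mpoly K[2 + k]})^`M(j) = (j == i)%:R by apply: mderivXU.
have G_free j : j != o1 -> j != o2 -> j != o3 -> forall i, (G i 0)^`M(j) = 0.
  move=> d1 d2 d3 i; rewrite G_eq !(mderivD, mderivM, mderivC) !dX.
  by rewrite (negPf d1) (negPf d2) (negPf d3) mulr0n; ring.
(* All components are divisible by x_o3, so setting x_o3 = 0 in the vanishing trace leaves only the
   cofactor [Q] of component [o3]. With this component zero, [o3] is an admissible index outside the
   block. *)
have G3 : G o3 0 = 0.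
  pose Q := (a' o3)%:MP * ('X_o1 * 'X_o1) + (b' o3)%:MP * ('X_o1 * 'X_o2)
    + (c' o3)%:MP * ('X_o2 * 'X_o2) : {mpoly K[2 + k]}.
  have X3_neq0 := mpolyXU_neq0 K o3.
  have [R trR] : exists R, 'X_o3 * R + Q = 0.
    exists (2%:R * (a' o1)%:MP * 'X_o1 + (b' o1)%:MP * 'X_o2
       + (b' o2)%:MP * 'X_o1 + 2%:R * (c' o2)%:MP * 'X_o2).
    rewrite -[RHS]trG1 /mxtrace (bigD1 o3) //= (bigD1 o1) //= (bigD1 o2) /=; last first.
      by rewrite neq23 eq_sym.
    rewrite big1 ?addr0 => [|j /andP[/andP[d3 d1] d2]]; last by rewrite mxE G_free.
    rewrite !mxE !G_eq !(mderivD, mderivM, mderivC) !dX !eqxx.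
    rewrite (eq_sym o3 o1) (eq_sym o3 o2) (eq_sym o2 o1).
    rewrite (negPf neq12') (negPf neq13) (negPf neq23) !(mulr0n, mulr1n) /Q.
    by ring.
  have fX1 : varfree o3 ('X_o1 : {mpoly K[2 + k]}) by apply: freeX.
  have fX2 : varfree o3 ('X_o2 : {mpoly K[2 + k]}) by apply: freeX.
  have fC x : varfree o3 (x%:MP : {mpoly K[2 + k]}) := freeC o3 x.
  have fQ : varfree o3 Q := freeD (freeD (freeM (fC _) (freeM fX1 fX1))
    (freeM (fC _) (freeM fX1 fX2))) (freeM (fC _) (freeM fX2 fX2)).
  have Q0 : Q = 0.
    have := congr1 (subst_var o3 0) trR.
    by rewrite rmorphD rmorphM rmorph0 /= subst_varX eqxx mul0r add0r fQ.
  by rewrite G_eq -/Q Q0 mulr0.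
have split_G : block_split o1 o2 G.
  move=> j d1 d2; have [->|d3] := eqVneq j o3; first by left.
  by right => i; apply: G_free.
case: (block_dichotomy neq12' G_cubic split_G trG1 trG2) => // form.
case: (form_needs_two_parameters char_K (i3 := o3) neq12' form) => j d1 d2 d3.
by rewrite !G_free.
Qed.

End RankTwo.

(** * Reduction to the normal form of (ii) *)

Section NormalForm.

Variable K : fieldType.
Hypothesis char_K : (6%:R : K) \is a GRing.unit.

(** The existence of the four indices is what carries n >= 4. *)
Definition cubic_normal_form n (G : polymap K n) : Prop :=
  exists i1 i2 i3 i4 : 'I_n,
     [/\ nat_of_ord i1 = 0%N, nat_of_ord i2 = 1%N,
         nat_of_ord i3 = 2%N & nat_of_ord i4 = 3%N] /\
     [/\ in_vars [pred j : 'I_n | (2 <= j)%N]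
           (G i1 0 - ('X_i1 * 'X_i3 * 'X_i4 - 'X_i2 * 'X_i4 ^+ 2)),
         in_vars [pred j : 'I_n | (2 <= j)%N]
           (G i2 0 - ('X_i1 * 'X_i3 ^+ 2 - 'X_i2 * 'X_i3 * 'X_i4)) &
         forall i : 'I_n, (2 <= i)%N -> G i 0 = 0].

Lemma varfree_coef n (p : {mpoly K[n]}) i : varfree i p -> p@_(U_(i)) = 0.
Proof.
move=> /varfreeP fp; apply: memN_msupp_eq0; apply/negP => /fp.
by rewrite mnm1E eqxx.
Qed.

Lemma in_vars_ge2 k (p : {mpoly K[2 + k]}) :
  p \is 3.-homog -> p^`M(lshift k 0) = 0 -> p^`M(lshift k 1) = 0 ->
  in_vars [pred j : 'I_(2 + k) | (2 <= j)%N] p.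
Proof.
move=> p3 /(deriv0_free char_K (isT : (3 < 5)%N) p3) /varfreeP f0.
move=> /(deriv0_free char_K (isT : (3 < 5)%N) p3) /varfreeP f1 m m_p j /=.
case: (splitP j) => q j_eq; last by rewrite j_eq leq_addr.
have -> : j = lshift k q by apply: val_inj.
case: q {j_eq} => [[|[|//]] q_lt] _.
  by rewrite (_ : Ordinal q_lt = 0) ?f0 //; apply: val_inj.
by rewrite (_ : Ordinal q_lt = 1) ?f1 //; apply: val_inj.
Qed.

Lemma form_normal_form k (G : polymap K (2 + k)) : cubic_homogeneous G ->
  (forall j, G (rshift 2 j) 0 = 0) ->
  two_parameter_form (lshift k 0) (lshift k 1) (G (lshift k 0) 0) (G (lshift k 1) 0) ->
  exists2 T, T \in unitmx & cubic_normal_form (lin_conj T G).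
Proof.
move=> G_cubic G0 [s [y [m [r1 [r2 [s_neq0 [y1 m1] [ty tm] indep [G1_eq G2_eq tr1 tr2]]]]]]].
have plane_formE (p : {mpoly K[2 + k]}) : p \is 1.-homog ->
    two_free (lshift k 0) (lshift k 1) p ->
    p = \sum_l (p@_(U_(rshift 2 l)))%:MP * 'X_(rshift 2 l).
  move=> p1 [fp gp]; rewrite {1}(linear_formE p1) big_split_ord /= !big_ord_recl big_ord0.
  have -> : lshift k ord0 = lshift k 0 by [].
  have -> : lift ord0 ord0 = 1 :> 'I_2 by apply: val_inj.
  by rewrite !varfree_coef // mpolyC0 !mul0r !add0r.
(* The forms s y and m are to become x3 and x4. *)
pose c (r : 'I_2) : {mpoly K[2 + k]} := if r == 0 then s%:MP * y else m.
have c1 r : c r \is 1.-homog by rewrite /c; case: ifP => // _; rewrite mul_mpolyC dhomogZ.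
have tc r : two_free (lshift k 0) (lshift k 1) (c r).
  by rewrite /c; case: ifP => // _; apply: two_freeM => //; apply: two_freeC.
pose A : 'M[K]_(2, k) := \matrix_(r, l) (c r)@_(U_(rshift 2 l)).
have cE r : c r = \sum_l (A r l)%:MP * 'X_(rshift 2 l).
  by rewrite {1}(plane_formE _ (c1 r) (tc r)); apply: eq_bigr => l _; rewrite mxE.
have A_free : row_free A.
  apply: inj_row_free => v vA0.
  have sum0 : \sum_r (v 0 r)%:MP * c r = 0.
    under eq_bigr => r _ do rewrite cE mulr_sumr.
    rewrite exchange_big big1 // => l _.
    have := congr1 (fun X : 'rV_k => X 0 l) vA0; rewrite /= !mxE => vAl.
    transitivity ((\sum_r v 0 r * A r l)%:MP * 'X_(rshift 2 l) : {mpoly K[2 + k]}).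
      rewrite raddf_sum mulr_suml; apply: eq_bigr => r _.
      by rewrite /= mpolyCM mulrA.
    by rewrite vAl mpolyC0 mul0r.
  move: sum0; rewrite !big_ord_recl big_ord0 addr0 /c /= mulrA -mpolyCM => /indep[vs0 v10].
  move/eqP: vs0; rewrite mulf_eq0 (negPf s_neq0) orbF => /eqP v00.
  apply/rowP => -[[|[|//]] r_lt]; rewrite mxE; [rewrite -[RHS]v00|rewrite -[RHS]v10];
  by congr (v 0 _); apply: val_inj.
(* Two independent forms in the k variables beyond x1 and x2 force k >= 2. *)
have [k' k_eq] : exists k', k = (2 + k')%N.
  exists (k - 2)%N; rewrite subnKC //; move: A_free; rewrite /row_free => /eqP <-.
  exact: rank_leq_col.
subst k.
have /row_freeP[B AB1] := A_free.
have [T2 T2u [AT2 _]] := complete_dual_pair AB1.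
(* With x1 scaled by - s and y turned into x3 / s, the linear factor y x1 + m x2 becomes x2 x4 - x1
   x3, and s cancels from the cubic parts of both components. *)
pose d : 'rV[K]_2 := \row_i if i == 0 then - s else 1.
pose d' : 'rV[K]_2 := \row_i if i == 0 then - s^-1 else 1.
have dd' : diag_mx d *m diag_mx d' = 1%:M.
  apply/matrixP => i j; rewrite mul_diag_mx !mxE; case: ifP => _.
    by case: eqP => _; rewrite ?mulr1n ?mulr0n ?mulr0 // mulrNN mulfV.
  by rewrite mul1r.
pose T := block_mx (diag_mx d) 0 0 T2; pose T' := block_mx (diag_mx d') 0 0 (invmx T2).
have TT' : T *m T' = 1%:M.
  by rewrite mulmx_block !(mulmx0, mul0mx, addr0, add0r) dd' mulmxV // -scalar_mx_block.
have [Tu _] := mulmx1_unit TT'.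
have invT : invmx T = T' by rewrite -[RHS](mulKmx Tu) TT' mulmx1.
pose i1 := lshift (2 + k') (0 : 'I_2); pose i2 := lshift (2 + k') (1 : 'I_2).
pose i3 := rshift 2 (lshift k' (0 : 'I_2)); pose i4 := rshift 2 (lshift k' (1 : 'I_2)).
have subst_l q : lin_subst T 'X_(lshift (2 + k') q) = (d 0 q)%:MP * 'X_(lshift (2 + k') q).
  rewrite lin_subst_var big_split_ord /= [X in _ + X]big1 ?addr0 => [|l _]; last first.
    by rewrite block_mxEur mxE mpolyC0 mul0r.
  rewrite (bigD1 q) //= block_mxEul mxE eqxx mulr1n big1 ?addr0 // => l neq.
  by rewrite block_mxEul mxE eq_sym (negPf neq) mulr0n mpolyC0 mul0r.
have subst_c r : lin_subst T (c r) = 'X_(rshift 2 (lshift k' r)).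
  rewrite cE rmorph_sum /=.
  transitivity (\sum_q ((A *m T2) r q)%:MP * 'X_(rshift 2 q) : {mpoly K[2 + (2 + k')]}).
    under eq_bigr => l _.
      rewrite rmorphM /= lin_substC lin_subst_var big_split_ord /=.
      rewrite [X in _ * (X + _)]big1 ?add0r => [|q _]; last first.
        by rewrite block_mxEdl mxE mpolyC0 mul0r.
      rewrite mulr_sumr.
      over.
    rewrite exchange_big /=; apply: eq_bigr => q _; rewrite mxE raddf_sum mulr_suml.
    by apply: eq_bigr => l _; rewrite block_mxEdr /= mpolyCM mulrA.
  rewrite AT2 (bigD1 (lshift k' r)) //= row_mxEl mxE eqxx mpolyC1 mul1r.
  rewrite big1 ?addr0 // => l; case: (splitP l) => q l_eq.
    have -> : l = lshift k' q by apply: val_inj.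
    rewrite (inj_eq (@lshift_inj _ _)) eq_sym => /negPf neq.
    by rewrite row_mxEl mxE neq mpolyC0 mul0r.
  have -> : l = rshift 2 q by apply: val_inj.
  by rewrite row_mxEr mxE mpolyC0 mul0r.
have comp_l q : lin_conj T G (lshift (2 + k') q) 0 =
    (d' 0 q)%:MP * lin_subst T (G (lshift (2 + k') q) 0).
  rewrite lin_conjE invT big_split_ord /= [X in _ + X]big1 ?addr0 => [|l _]; last first.
    by rewrite G0 rmorph0 mulr0.
  rewrite (bigD1 q) //= block_mxEul mxE eqxx mulr1n big1 ?addr0 // => l neq.
  by rewrite block_mxEul mxE eq_sym (negPf neq) mulr0n mpolyC0 mul0r.
have comp_r j : lin_conj T G (rshift 2 j) 0 = 0.
  rewrite lin_conjE invT big_split_ord /= !big1 ?addr0 // => [l _|l _].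
    by rewrite G0 rmorph0 mulr0.
  by rewrite block_mxEdl mxE mpolyC0 mul0r.
have d_eq : (d 0 0 = - s) * (d 0 1 = 1) * (d' 0 0 = - s^-1) * (d' 0 1 = 1).
  by rewrite !mxE.
have sI : s%:MP * (s^-1)%:MP = 1 :> {mpoly K[2 + (2 + k')]}.
  by rewrite -mpolyCM mulfV // mpolyC1.
have subst_y : lin_subst T y = (s^-1)%:MP * 'X_i3.
  have := subst_c 0; rewrite /c /= rmorphM /= lin_substC => sy.
  by rewrite /i3 -sy mulrA [_ * s%:MP]mulrC sI mul1r.
have subst_m : lin_subst T m = 'X_i4 by have := subst_c 1.
exists T => //; exists i1, i2, i3, i4; split; first by split.
have dsub r q : two_free i1 i2 r -> (lin_subst T r)^`M(lshift (2 + k') q) = 0.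
  move=> [fr gr]; rewrite mderiv_lin_subst big1 // => l _.
  case: (splitP l) => x l_eq.
    have -> : l = lshift (2 + k') x by apply: val_inj.
    have -> : r^`M(lshift (2 + k') x) = 0.
      case: x {l_eq} => [[|[|//]] x_lt].
        by rewrite (_ : Ordinal x_lt = 0) ?mderiv_free //; apply: val_inj.
      by rewrite (_ : Ordinal x_lt = 1) ?mderiv_free //; apply: val_inj.
    by rewrite rmorph0 mul0r.
  have -> : l = rshift 2 x by apply: val_inj.
  by rewrite block_mxEdl mxE mpolyC0 mulr0.
have X1 i : ('X_i : {mpoly K[2 + (2 + k')]}) \is 1.-homog := dhomogXU K i.
have X2 i j : ('X_i * 'X_j : {mpoly K[2 + (2 + k')]}) \is 2.-homog := dhomogM (X1 i) (X1 j).
have X3 i j l : ('X_i * 'X_j * 'X_l : {mpoly K[2 + (2 + k')]}) \is 3.-homog :=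
  dhomogM (X2 i j) (X1 l).
have TG_cubic := cubic_lin_conj T G_cubic.
split.
- have -> : lin_conj T G i1 0 - ('X_i1 * 'X_i3 * 'X_i4 - 'X_i2 * 'X_i4 ^+ 2) =
    (- s^-1)%:MP * lin_subst T r1.
    rewrite comp_l G1_eq rmorphD !rmorphM rmorphD !rmorphM /= lin_substC subst_y subst_m.
    rewrite !subst_l !d_eq !mpolyCN mpolyC1 -/i1 -/i2.
    transitivity (- (s%:MP * (s^-1)%:MP) * 'X_i4 * ('X_i4 * 'X_i2 - s%:MP * (s^-1)%:MP * 'X_i3 * 'X_i1)
       - (s^-1)%:MP * lin_subst T r1 - ('X_i1 * 'X_i3 * 'X_i4 - 'X_i2 * 'X_i4 ^+ 2)).
      by ring.
    by rewrite sI; ring.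
  have r1_3 : r1 \is 3.-homog.
    have -> : r1 = G i1 0 - s%:MP * (m * (y * 'X_i1 + m * 'X_i2)) by rewrite G1_eq; ring.
    rewrite rpredB // mul_mpolyC dhomogZ //; apply: (dhomogM m1).
    by rewrite rpredD //; apply: (dhomogM (d := 1) (e := 1)).
  apply: in_vars_ge2.
  - by rewrite mul_mpolyC dhomogZ // lin_subst_homog.
  - by rewrite mderiv_mulC dsub // mulr0.
  - by rewrite mderiv_mulC dsub // mulr0.
- have -> : lin_conj T G i2 0 - ('X_i1 * 'X_i3 ^+ 2 - 'X_i2 * 'X_i3 * 'X_i4) =
    lin_subst T r2.
    rewrite comp_l G2_eq rmorphD rmorphN !rmorphM rmorphD !rmorphM /= lin_substC subst_y subst_m.
    rewrite !subst_l !d_eq !mpolyCN mpolyC1 -/i1 -/i2.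
    transitivity (- (s%:MP * (s^-1)%:MP) * 'X_i3 * ('X_i4 * 'X_i2 - s%:MP * (s^-1)%:MP * 'X_i3 * 'X_i1)
       + lin_subst T r2 - ('X_i1 * 'X_i3 ^+ 2 - 'X_i2 * 'X_i3 * 'X_i4)).
      by ring.
    by rewrite sI; ring.
  have r2_3 : r2 \is 3.-homog.
    have -> : r2 = G i2 0 + s%:MP * (y * (y * 'X_i1 + m * 'X_i2)) by rewrite G2_eq; ring.
    rewrite rpredD // mul_mpolyC dhomogZ //; apply: (dhomogM y1).
    by rewrite rpredD //; apply: (dhomogM (d := 1) (e := 1)).
  apply: in_vars_ge2.
  - by rewrite lin_subst_homog.
  - by rewrite dsub.
  - by rewrite dsub.
- move=> i; case: (splitP i) => q i_eq; first by rewrite i_eq leqNgt ltn_ord.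
  by have -> : i = rshift 2 q by apply: val_inj.
Qed.

End NormalForm.

(** * Tame and invertible maps *)

Section TameMaps.

Variables (K : fieldType) (n : nat).
Hypothesis char_K : (6%:R : K) \is a GRing.unit.
Implicit Types (F G H : polymap K n) (p q : {mpoly K[n]}) (i j : 'I_n) (T U : 'M[K]_n).

Lemma pcompD F G H : pcomp (F + G) H = pcomp F H + pcomp G H.
Proof. by apply/matrixP => i j; rewrite !mxE comp_mpolyD. Qed.

Lemma pcomp_const (b : 'cV[K]_n) H : pcomp (constmx n b) H = constmx n b.
Proof. by apply/matrixP => i j; rewrite !mxE comp_mpolyC. Qed.

Lemma pcomp_affine T (b : 'cV[K]_n) F :
  pcomp (affine_map T b) F = constmx n T *m F + constmx n b.
Proof. by rewrite pcompD pcomp_const pcomp_constmx pcomp_var. Qed.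

Lemma affine_linear T : affine_map T 0 = constmx n T *m vars.
Proof. by rewrite /affine_map /constmx map_mx0 addr0. Qed.

Lemma vars_lin_conj T H : T \in unitmx ->
  vars + lin_conj T H =
  pcomp (affine_map (invmx T) 0) (pcomp (vars + H) (affine_map T 0)).
Proof.
move=> Tu; rewrite pcomp_affine {2}/constmx map_mx0 addr0 pcompD pcomp_var mulmxDr.
by rewrite !affine_linear mulmxA -constmxM mulVmx // constmx1 mul1mx.
Qed.

Lemma tame_vars : tame (vars : polymap K n).
Proof.
have -> : vars = affine_map 1%:M 0 :> polymap K n by rewrite affine_linear constmx1 mul1mx.
by apply: tame_affine; apply: unitmx1.
Qed.

Lemma tame_lin_conj T H : T \in unitmx -> tame (vars + lin_conj T H) -> tame (vars + H).
Proof.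
move=> Tu tameT.
have -> : H = lin_conj (invmx T) (lin_conj T H).
  by rewrite lin_conj_comp ?unitmx_inv // mulmxV // lin_conj1.
rewrite vars_lin_conj ?unitmx_inv //.
by do !apply: tame_comp => //; apply: tame_affine; rewrite ?unitmx_inv.
Qed.

Lemma invertible_comp F G : invertible_map F -> invertible_map G ->
  invertible_map (pcomp F G).
Proof.
move=> [F' [FF' F'F]] [G' [GG' G'G]]; exists (pcomp G' F'); split.
  by rewrite pcompA -(pcompA G) GG' pcomp_var.
by rewrite pcompA -(pcompA F') F'F pcomp_var.
Qed.

Lemma invertible_affine T (b : 'cV[K]_n) : T \in unitmx -> invertible_map (affine_map T b).
Proof.
move=> Tu; exists (affine_map (invmx T) (- (invmx T *m b))).
rewrite !pcomp_affine /affine_map !mulmxDr !mulmxA -!constmxM mulmxV // mulVmx //.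
rewrite !constmx1 !mul1mx mulmxN mulmxA mulmxV // mul1mx.
have constN (c : 'cV[K]_n) : constmx n (- c) = - constmx n c by apply: map_mxN.
by rewrite !constN addrNK addrK.
Qed.

Lemma comp_mpoly_eq (f g : 'I_n -> {mpoly K[n]}) p :
  (forall i, varfree i p \/ f i = g i) ->
  p \mPo [tuple f i | i < n] = p \mPo [tuple g i | i < n].
Proof.
move=> fg; rewrite (comp_mpolyEX p [tuple f i | i < n]) (comp_mpolyEX p [tuple g i | i < n]).
rewrite big_seq [RHS]big_seq; apply: eq_bigr => m m_p; apply: congr1.
rewrite (comp_mpolyX m [tuple f i | i < n]) (comp_mpolyX m [tuple g i | i < n]).
apply: eq_bigr => i _.
rewrite !tnth_mktuple; case: (fg i) => [/varfreeP fp|-> //].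
by rewrite (fp m m_p) !expr0.
Qed.

Lemma varfree_in_vars i p : varfree i p -> in_vars [pred j | j != i] p.
Proof. by move=> /varfreeP fp m m_p j /=; rewrite negbK => /eqP ->; apply: fp. Qed.

Lemma in_vars_varfree i p : in_vars [pred j | j != i] p -> varfree i p.
Proof. by move=> p_in; apply/varfreeP => m m_p; apply: p_in => //=; rewrite negbK. Qed.

Lemma comp_elementary i q G : varfree i q -> (forall j, j != i -> G j 0 = 'X_j) ->
  q \mPo [tuple G j 0 | j < n] = q.
Proof.
move=> fq G_eq; rewrite -[RHS]comp_mpoly_id; apply: comp_mpoly_eq => j.
by have [->|neq] := eqVneq j i; [left|right; apply: G_eq].
Qed.

Lemma elementary_inverse i p : varfree i p ->
  pcomp (elementary_map i p) (elementary_map i (- p)) = vars.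
Proof.
move=> fp; apply/matrixP => j l; rewrite !mxE comp_mpolyD comp_mpoly_var !mxE.
case: eqP => [->|_]; last by rewrite comp_mpoly0 !addr0.
rewrite (comp_elementary fp) ?addrNK // => k /negPf neq.
by rewrite mxE neq addr0.
Qed.

Lemma invertible_elementary i p : varfree i p -> invertible_map (elementary_map i p).
Proof.
move=> fp; exists (elementary_map i (- p)); split; first exact: elementary_inverse.
by rewrite -{2}[p]opprK; apply/elementary_inverse/freeN.
Qed.

Lemma tame_invertible F : tame F -> invertible_map F.
Proof.
elim=> [T b Tu|i p p_in|{}F G _ invF _ invG].
- exact: invertible_affine.
- exact/invertible_elementary/in_vars_varfree.
- exact: invertible_comp.
Qed.

Definition strictly_upper H : Prop := forall i j, (j <= i)%N -> (H i 0)^`M(j) = 0.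

(** The components are switched on one at a time from the first. Each H_i involves only later
    variables, which the map built so far leaves fixed, so the next map is its composite with an
    elementary one. *)
Lemma tame_strictly_upper H : cubic_homogeneous H -> strictly_upper H -> tame (vars + H).
Proof.
move=> H_cubic H_upper.
have H_free i j : (j <= i)%N -> varfree j (H i 0).
  by move=> le_ji; apply: (deriv0_free char_K _ (H_cubic i)) => //; apply: H_upper.
pose F m : polymap K n := vars + \col_i (if (i < m)%N then H i 0 else 0).
have tameF m : (m <= n)%N -> tame (F m).
  elim: m => [_|m IHm lt_mn].
    rewrite (_ : F 0%N = vars); first exact: tame_vars.
    by apply/matrixP => i j; rewrite !mxE ltn0 addr0.
  pose i0 := Ordinal lt_mn.
  have -> : F m.+1 = pcomp (elementary_map i0 (H i0 0)) (F m).
    apply/matrixP => i j; rewrite ord1 !mxE comp_mpolyD comp_mpoly_var !mxE ltnS.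
    rewrite leq_eqVlt; have [->|neq] := eqVneq i i0; last first.
      by rewrite -val_eqE /= in neq; rewrite (negPf neq) comp_mpoly0 addr0.
    rewrite /= eqxx ltnn addr0 -[in LHS](comp_mpoly_id (H i0 0)); congr (_ + _).
    apply: comp_mpoly_eq => l; have [le_l|gt_l] := leqP l i0; first by left; apply: H_free.
    by right; rewrite !mxE ltnNge ltnW // addr0.
  apply: tame_comp; last exact/IHm/ltnW.
  by apply/tame_elementary/varfree_in_vars/H_free.
rewrite (_ : vars + H = F n); first exact: tameF.
by apply/matrixP => i j; rewrite ord1 !mxE ltn_ord.
Qed.

Lemma sort_weight (rho : 'I_n -> nat) :
  exists s : 'S_n, forall i j : 'I_n, (i <= j)%N -> (rho (s i) <= rho (s j))%N.
Proof.
pose r := sort (fun i j => (rho i <= rho j)%N) (enum 'I_n).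
have size_r : size r = n by rewrite size_sort size_enum_ord.
have r_uniq : uniq r by rewrite sort_uniq enum_uniq.
have r_sorted : sorted (fun i j => (rho i <= rho j)%N) r.
  by apply: sort_sorted => x y; apply: leq_total.
have nth_inj : injective (fun i : 'I_n => nth i r i).
  move=> i j /eqP; rewrite (set_nth_default i j) ?size_r // nth_uniq ?size_r //.
  by move=> /eqP; apply: val_inj.
exists (perm nth_inj) => i j le_ij; rewrite !permE (set_nth_default i j) ?size_r //.
apply: (sorted_leq_nth _ _ i r_sorted); rewrite ?inE ?size_r //.
by move=> x y z; apply: leq_trans.
Qed.

(** Sorting the coordinates by weight turns the weight condition into strict upper triangularity. *)
Lemma triangularizable_upper H : triangularizable H ->
  exists2 T, T \in unitmx & strictly_upper (lin_conj T H).
Proof.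
case=> T Tu [rho rhoH]; have [s s_mono] := sort_weight rho.
exists (T *m perm_mx s^-1); first by rewrite unitmx_mul Tu unitmx_perm.
rewrite -lin_conj_comp ?unitmx_perm // => i j le_ji.
have inv_perm : invmx (perm_mx s^-1) = perm_mx s :> 'M[K]_n.
  have Pu : perm_mx s^-1 \in @unitmx K n by apply: unitmx_perm.
  by rewrite -[RHS](mulKmx Pu) -perm_mxM mulVg perm_mx1 mulmx1.
have dP p : (lin_subst (perm_mx s^-1) p)^`M(j) = lin_subst (perm_mx s^-1) p^`M(s j).
  rewrite mderiv_lin_subst (bigD1 (s j)) //= !mxE permK eqxx mpolyC1 mulr1.
  rewrite big1 ?addr0 // => l neq; rewrite !mxE.
  have -> : (s^-1%g l == j) = false.
    by apply/negbTE; apply: contraNneq neq => <-; rewrite permKV.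
  by rewrite mpolyC0 mulr0.
rewrite lin_conjE inv_perm (bigD1 (s i)) //= big1 => [|l /negPf neq]; last first.
  have -> : (perm_mx s : 'M[K]_n) i l = 0 by rewrite !mxE eq_sym neq.
  by rewrite mpolyC0 mul0r.
have -> : (perm_mx s : 'M[K]_n) i (s i) = 1 by rewrite !mxE eqxx.
by rewrite mpolyC1 mul1r addr0 dP rhoH ?rmorph0 // s_mono.
Qed.

(** Similarity over K conjugates JH without substituting T x, unlike the Jacobian of [lin_conj]. The
    two matrices differ by an injective substitution, so zero entries correspond. *)
Lemma triangularizable_similar H : triangularizable H ->
  exists2 M, similar_over_base (ratmx (jacobian H)) M & triangular M.
Proof.
move=> /triangularizable_upper[T Tu H_upper].
exists (ratmx (constmx n (invmx T)) *m ratmx (jacobian H) *m ratmx (constmx n T)).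
  by exists T.
apply/orP; right; apply/is_trig_mxP => i j lt_ij; rewrite mxE /ratmx -!map_mxM mxE.
set N := _ *m _ *m _; suff -> : N j i = 0 by rewrite rmorph0.
have subst_N : map_mx (lin_subst T) N = jacobian (lin_conj T H).
  rewrite jacobian_lin_conj /N (map_lin_substM T _ (constmx n T)).
  by rewrite (map_lin_substM T (constmx n (invmx T))) !(map_lin_subst_constmx T).
have subst0 : lin_subst T (N j i) = 0.
  transitivity (map_mx (lin_subst T) N j i); first by rewrite [RHS]mxE.
  by rewrite subst_N mxE H_upper // ltnW.
rewrite -[N j i]lin_subst1 -(mulmxV Tu) -(lin_subst_comp (invmx T) T) subst0.
exact: rmorph0.
Qed.

End TameMaps.

(** * Shears preserving x1 x3 - x2 x4 *)

Section Shears.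

Variables (K : fieldType) (n : nat) (i1 i2 : 'I_n).
Hypothesis neq12 : i1 != i2.
Implicit Types (F G H : polymap K n) (p q h : {mpoly K[n]}) (i j : 'I_n).

Definition shear p q : polymap K n :=
  \col_j ('X_j + (if j == i1 then p else if j == i2 then q else 0)).

Lemma shear_fst p q : shear p q i1 0 = 'X_i1 + p.
Proof. by rewrite mxE eqxx. Qed.

Lemma shear_snd p q : shear p q i2 0 = 'X_i2 + q.
Proof. by rewrite mxE eq_sym (negPf neq12) eqxx. Qed.

Lemma shear_other p q j : j != i1 -> j != i2 -> shear p q j 0 = 'X_j.
Proof. by move=> /negPf n1 /negPf n2; rewrite mxE n1 n2 addr0. Qed.

Lemma shear00 : shear 0 0 = vars.
Proof. by apply/matrixP => i j; rewrite !mxE !if_same addr0. Qed.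

Lemma shear_unique F p q : F i1 0 = 'X_i1 + p -> F i2 0 = 'X_i2 + q ->
  (forall j, j != i1 -> j != i2 -> F j 0 = 'X_j) -> F = shear p q.
Proof.
move=> F1 F2 F0; apply/matrixP => i j; rewrite ord1.
have [->|n1] := eqVneq i i1; first by rewrite shear_fst.
have [->|n2] := eqVneq i i2; first by rewrite shear_snd.
by rewrite shear_other // F0.
Qed.

Lemma comp_sum F G p i : F i 0 = 'X_i + p ->
  pcomp F G i 0 = G i 0 + (p \mPo [tuple G l 0 | l < n]).
Proof. by move=> Fi; rewrite mxE Fi comp_mpolyD comp_mpoly_var. Qed.

Lemma comp_other F G i : F i 0 = 'X_i -> pcomp F G i 0 = G i 0.
Proof. by move=> Fi; rewrite mxE Fi comp_mpoly_var. Qed.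

Lemma pcomp_shear p q h1 h2 : varfree i1 h1 -> varfree i2 h1 ->
  varfree i1 h2 -> varfree i2 h2 ->
  pcomp (shear h1 h2) (shear p q) = shear (p + h1) (q + h2).
Proof.
move=> f11 f12 f21 f22.
have comp_h h : varfree i1 h -> varfree i2 h -> h \mPo [tuple shear p q l 0 | l < n] = h.
  move=> f1 f2; rewrite -[RHS]comp_mpoly_id; apply: comp_mpoly_eq => l.
  have [->|n1] := eqVneq l i1; first by left.
  have [->|n2] := eqVneq l i2; first by left.
  by right; rewrite shear_other.
apply: shear_unique => [||j n1 n2].
- by rewrite (comp_sum _ (shear_fst _ _)) shear_fst comp_h // addrA.
- by rewrite (comp_sum _ (shear_snd _ _)) shear_snd comp_h // addrA.
- by rewrite comp_other shear_other.
Qed.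

Lemma tame_shear h1 h2 : varfree i1 h1 -> varfree i2 h1 ->
  varfree i1 h2 -> varfree i2 h2 -> tame (shear h1 h2).
Proof.
move=> f11 f12 f21 f22.
rewrite -[h1]add0r -[h2]addr0 -pcomp_shear //; try exact: free0.
apply: tame_comp.
  rewrite (_ : shear h1 0 = elementary_map i1 h1).
    exact/tame_elementary/varfree_in_vars.
  by apply/matrixP => i j; rewrite !mxE if_same.
rewrite (_ : shear 0 h2 = elementary_map i2 h2).
  exact/tame_elementary/varfree_in_vars.
apply/esym/shear_unique => [||j n1 n2]; rewrite mxE ?eqxx ?(negPf neq12) //.
by rewrite (negPf n2) addr0.
Qed.

Section InvariantShear.

Variables i3 i4 : 'I_n.
Hypotheses (neq13 : i1 != i3) (neq14 : i1 != i4) (neq23 : i2 != i3) (neq24 : i2 != i4).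

Let w : {mpoly K[n]} := 'X_i1 * 'X_i3 - 'X_i2 * 'X_i4.

(** Increments p x4 of x1 and p x3 of x2 change w by p x4 x3 - p x3 x4 = 0. *)
Lemma comp_invariant F p : F i1 0 = 'X_i1 + p * 'X_i4 -> F i2 0 = 'X_i2 + p * 'X_i3 ->
  F i3 0 = 'X_i3 -> F i4 0 = 'X_i4 -> w \mPo [tuple F l 0 | l < n] = w.
Proof.
move=> F1 F2 F3 F4; rewrite /w comp_mpolyB !comp_mpolyM !comp_mpoly_var F1 F2 F3 F4.
by ring.
Qed.

Definition invariant_shear (e : K) := shear (e%:MP * w * 'X_i4) (e%:MP * w * 'X_i3).

(** The inner shear fixes w, x3 and x4, so the increments simply add up: the shears form a
    one-parameter group. *)
Lemma invariant_shear_comp e f :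
  pcomp (invariant_shear e) (invariant_shear f) = invariant_shear (e + f).
Proof.
set F := invariant_shear f.
have F3 : F i3 0 = 'X_i3 by rewrite shear_other // eq_sym.
have F4 : F i4 0 = 'X_i4 by rewrite shear_other // eq_sym.
have Fw : w \mPo [tuple F l 0 | l < n] = w.
  by apply: (comp_invariant (p := f%:MP * w)); rewrite ?shear_fst ?shear_snd.
apply: shear_unique => [||j n1 n2]; last by rewrite comp_other shear_other.
  rewrite (comp_sum _ (shear_fst _ _)) shear_fst !comp_mpolyM comp_mpolyC Fw.
  by rewrite comp_mpoly_var F4 mpolyCD; ring.
rewrite (comp_sum _ (shear_snd _ _)) shear_snd !comp_mpolyM comp_mpolyC Fw.
by rewrite comp_mpoly_var F3 mpolyCD; ring.
Qed.

Lemma invertible_invariant_shear e : invertible_map (invariant_shear e).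
Proof.
have inv0 : invariant_shear 0 = vars by rewrite /invariant_shear mpolyC0 !mul0r shear00.
by exists (invariant_shear (- e)); rewrite !invariant_shear_comp addrN addNr.
Qed.

(* The shear is the commutator of [x5 -> x5 + w] and [(x1, x2) -> (x1, x2) + x5 (x4, x3)]. *)
Lemma tame_invariant_shear i5 : i5 != i1 -> i5 != i2 -> i5 != i3 -> i5 != i4 ->
  tame (invariant_shear 1).
Proof.
move=> n51 n52 n53 n54.
pose W (e : K) := elementary_map i5 (e%:MP * w).
pose D (e : K) := shear (e%:MP * 'X_i5 * 'X_i4) (e%:MP * 'X_i5 * 'X_i3).
have free_w : varfree i5 w.
  by apply: freeD; [|apply: freeN]; apply: freeM; apply: freeX; rewrite eq_sym.
have tameW e : tame (W e).
  by apply/tame_elementary/varfree_in_vars/freeM => //; apply: freeC.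
have tameD e : tame (D e).
  by apply: tame_shear; do ?apply: freeM; do ?apply: freeC; apply: freeX; rewrite // eq_sym.
have W5 e : W e i5 0 = 'X_i5 + e%:MP * w by rewrite mxE eqxx.
have W_other e j : j != i5 -> W e j 0 = 'X_j by rewrite mxE => /negPf ->; rewrite addr0.
have D_other e j : j != i1 -> j != i2 -> D e j 0 = 'X_j by apply: shear_other.
have [n31 n41 n32 n42] : [/\ i3 != i1, i4 != i1, i3 != i2 & i4 != i2].
  by split; rewrite eq_sym.
have [n15 n25 n35 n45] : [/\ i1 != i5, i2 != i5, i3 != i5 & i4 != i5].
  by split; rewrite eq_sym.
(* [pcomp] applies its right factor first, so the order of application is D(-1), W(1), D(1) and
   finally W(-1). *)
set F := D (-1); set G := pcomp (W 1) F; set E := pcomp (D 1) G.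
have F1 : F i1 0 = 'X_i1 + (-1)%:MP * 'X_i5 * 'X_i4 := shear_fst _ _.
have F2 : F i2 0 = 'X_i2 + (-1)%:MP * 'X_i5 * 'X_i3 := shear_snd _ _.
have Fw : w \mPo [tuple F l 0 | l < n] = w.
  by apply: (comp_invariant (p := (-1)%:MP * 'X_i5)); rewrite ?shear_fst ?shear_snd ?D_other.
have G5 : G i5 0 = 'X_i5 + w.
  by rewrite (comp_sum _ (W5 1)) D_other // comp_mpolyM comp_mpolyC Fw mpolyC1 mul1r.
have G_other j : j != i5 -> G j 0 = F j 0 by move=> n5; rewrite comp_other // W_other.
have E1 : E i1 0 = 'X_i1 + 1%:MP * w * 'X_i4.
  rewrite (comp_sum _ (shear_fst _ _)) !comp_mpolyM comp_mpolyC !comp_mpoly_var G5.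
  by rewrite !G_other // F1 D_other // mpolyCN mpolyC1; ring.
have E2 : E i2 0 = 'X_i2 + 1%:MP * w * 'X_i3.
  rewrite (comp_sum _ (shear_snd _ _)) !comp_mpolyM comp_mpolyC !comp_mpoly_var G5.
  by rewrite !G_other // F2 D_other // mpolyCN mpolyC1; ring.
have E5 : E i5 0 = 'X_i5 + w by rewrite comp_other ?D_other.
have E_other j : j != i1 -> j != i2 -> j != i5 -> E j 0 = 'X_j.
  by move=> n1 n2 n5; rewrite comp_other ?D_other // G_other // D_other.
have Ew : w \mPo [tuple E l 0 | l < n] = w.
  by apply: (comp_invariant (p := 1%:MP * w)) => //; apply: E_other.
rewrite (_ : invariant_shear 1 = pcomp (W (-1)) E).
  exact: tame_comp (tameW _) (tame_comp (tameD _) (tame_comp (tameW _) (tameD _))).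
apply/esym/shear_unique => [||j n1 n2].
- by rewrite comp_other ?W_other.
- by rewrite comp_other ?W_other.
have [->|n5] := eqVneq j i5; last by rewrite comp_other ?W_other // E_other.
by rewrite (comp_sum _ (W5 _)) E5 comp_mpolyM comp_mpolyC Ew mpolyCN mpolyC1; ring.
Qed.

End InvariantShear.

End Shears.

(** * Invertibility and tameness of the normal form *)

Section NormalFormMaps.

Variables (K : fieldType) (n : nat).
Implicit Types (G H : polymap K n).

(** w x4 and w x3 are exactly the prescribed cubic parts. The remainders [h1] and [h2] are free of
    x1 and x2, so they are unchanged when added after the invariant shear. *)
Lemma normal_form_shears G : cubic_normal_form G ->
  exists i1 i2 i3 i4 : 'I_n, [/\ nat_of_ord i1 = 0%N, nat_of_ord i2 = 1%N,
    nat_of_ord i3 = 2%N & nat_of_ord i4 = 3%N] /\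
  exists h1 h2 : {mpoly K[n]}, [/\ varfree i1 h1, varfree i2 h1, varfree i1 h2, varfree i2 h2 &
    vars + G = pcomp (shear i1 i2 h1 h2) (invariant_shear i1 i2 i3 i4 1)].
Proof.
case=> i1 [i2 [i3 [i4 [[v1 v2 v3 v4] [r1 r2 G0]]]]].
exists i1, i2, i3, i4; split=> //.
have neq12 : i1 != i2 by rewrite -val_eqE /= v1 v2.
set h1 := _ - _ in r1; set h2 := _ - _ in r2; exists h1, h2.
have free_ge2 (h : {mpoly K[n]}) (i : 'I_n) :
    in_vars [pred j : 'I_n | (2 <= j)%N] h -> (i < 2)%N -> varfree i h.
  by move=> h_in lt_i2; apply/varfreeP => m m_h; apply: (h_in m m_h); rewrite /= -ltnNge.
have [f11 f12 f21 f22] : [/\ varfree i1 h1, varfree i2 h1, varfree i1 h2 & varfree i2 h2].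
  by split; apply: free_ge2; rewrite ?v1 ?v2.
split=> //; rewrite pcomp_shear //.
apply: shear_unique => // [||j n1 n2]; rewrite mxE [vars _ _]mxE.
- by rewrite /h1 mpolyC1; ring.
- by rewrite /h2 mpolyC1; ring.
rewrite G0 ?addr0 // leqNgt; apply/negP => lt_j2.
by move: n1 n2; rewrite -!val_eqE /= v1 v2; lia.
Qed.

Lemma normal_form_invertible G : cubic_normal_form G -> invertible_map (vars + G).
Proof.
move=> /normal_form_shears[i1 [i2 [i3 [i4 [[v1 v2 v3 v4] [h1 [h2 [f11 f12 f21 f22 ->]]]]]]]].
have neq (i j : 'I_n) (a b : nat) : nat_of_ord i = a -> nat_of_ord j = b -> a != b -> i != j.
  by move=> <- <-.
apply: invertible_comp; first apply: tame_invertible.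
  by apply: tame_shear f11 f12 f21 f22; apply: neq v1 v2 _.
by apply: invertible_invariant_shear; [apply: neq v1 v2 _|apply: neq v1 v3 _|
  apply: neq v1 v4 _|apply: neq v2 v3 _|apply: neq v2 v4 _].
Qed.

Lemma normal_form_tame G : (5 <= n)%N -> cubic_normal_form G -> tame (vars + G).
Proof.
move=> n_ge5.
move=> /normal_form_shears[i1 [i2 [i3 [i4 [[v1 v2 v3 v4] [h1 [h2 [f11 f12 f21 f22 ->]]]]]]]].
have neq (i j : 'I_n) (a b : nat) : nat_of_ord i = a -> nat_of_ord j = b -> a != b -> i != j.
  by move=> <- <-.
pose i5 := Ordinal n_ge5; have v5 : nat_of_ord i5 = 4%N by [].
have neq12 : i1 != i2 by apply: neq v1 v2 _.
apply: tame_comp; first exact: tame_shear.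
apply: (@tame_invariant_shear _ _ _ _ neq12 i3 i4 _ _ _ _ i5); first [exact: neq v1 v3 _|
  exact: neq v1 v4 _|exact: neq v2 v3 _|exact: neq v2 v4 _|exact: neq v5 v1 _|
  exact: neq v5 v2 _|exact: neq v5 v3 _|exact: neq v5 v4 _].
Qed.

Lemma invertible_lin_conj T H : T \in unitmx ->
  invertible_map (vars + lin_conj T H) -> invertible_map (vars + H).
Proof.
move=> Tu invT.
have -> : H = lin_conj (invmx T) (lin_conj T H).
  by rewrite lin_conj_comp ?unitmx_inv // mulmxV // lin_conj1.
rewrite vars_lin_conj ?unitmx_inv //.
apply: invertible_comp; first by apply: invertible_affine; rewrite !unitmx_inv.
by apply: invertible_comp => //; apply: invertible_affine; rewrite unitmx_inv.
Qed.

End NormalFormMaps.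

(** * Jacobian rank at most two *)

Section SmallRank.

Variables (K : fieldType).
Hypothesis char_K : (6%:R : K) \is a GRing.unit.

Lemma rkJ0_eq0 n (H : polymap K n) : cubic_homogeneous H -> rkJ H = 0%N -> H = 0.
Proof.
move=> H_cubic rk0; apply/matrixP => i j; rewrite ord1 [RHS]mxE.
apply: (dhomog_deriv0 char_K (isT : (0 < 3 < 5)%N) (H_cubic i)) => l.
have /eqP := rk0; rewrite mxrank_eq0 => /eqP/matrixP/(_ i l).
by rewrite !mxE => /eqP; rewrite tofrac_eq0 => /eqP.
Qed.

(** The rows i and j of the Jacobian are multiplied by the columns x and e_m; by Euler's identity
    the first column of this minor is 3 times (H_i, H_j). *)
Lemma rkJ1_minors n (H : polymap K n) : cubic_homogeneous H -> (rkJ H < 2)%N ->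
  forall i j m, H i 0 * (H j 0)^`M(m) = H j 0 * (H i 0)^`M(m).
Proof.
move=> H_cubic rk1 i j m.
pose s (r : 'I_2) := if r == 0 then i else j.
pose A : 'M[{mpoly K[n]}]_(2, n) := \matrix_(r, l) (s r == l)%:R.
pose B : 'M[{mpoly K[n]}]_(n, 2) := \matrix_(l, r) if r == 0 then 'X_l else (l == m)%:R.
have AJ r l : (A *m jacobian H) r l = (H (s r) 0)^`M(l).
  rewrite mxE (bigD1 (s r)) //= !mxE eqxx mul1r big1 ?addr0 // => p /negPf neq.
  by rewrite !mxE eq_sym neq mul0r.
have M0 r : (A *m jacobian H *m B) r 0 = 3%:R * H (s r) 0.
  rewrite mxE -(euler (H_cubic (s r))); apply: eq_bigr => l _.
  by rewrite AJ mxE eqxx mulrC.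
have M1 r : (A *m jacobian H *m B) r 1 = (H (s r) 0)^`M(m).
  rewrite mxE (bigD1 m) //= AJ !mxE eqxx mulr1 big1 ?addr0 // => l /negPf neq.
  by rewrite [B _ _]mxE /= neq mulr0.
have := det_minor_eq0 A B rk1; rewrite det_mx22 !M0 !M1 /s /= => det0.
apply: (mulfI (nat3R_neq0 n char_K)); apply/eqP; rewrite -subr_eq0 -{}det0.
by apply/eqP; ring.
Qed.

(** [wronskian_dep] makes the ratios constant, and the trace of JH is the derivative of h along c.
    The entry c_i0 = 1 records that c is nonzero. *)
Lemma rkJ1_form n (H : polymap K n) : cubic_homogeneous H ->
  nilpotent_mx (jacobian H) -> rkJ H = 1%N ->
  exists h (c : 'I_n -> K) i0, [/\ h \is 3.-homog, c i0 = 1,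
    forall i, H i 0 = (c i)%:MP * h & \sum_l (c l)%:MP * h^`M(l) = 0].
Proof.
move=> H_cubic H_nil rk1.
have [i0 H_i0|H0] := pickP (fun i => H i 0 != 0); last first.
  have: jacobian H = 0.
    apply/matrixP => i l; rewrite !mxE.
    by have /eqP -> := negbFE (H0 i); rewrite raddf0.
  by move=> J0; move: rk1; rewrite /rkJ J0 /ratmx map_mx0 mxrank0.
have proportional i : exists c, H i 0 = c *: H i0 0.
  apply: (wronskian_dep char_K _ (H_cubic i0) (H_cubic i) H_i0) => // l.
  by apply: rkJ1_minors; rewrite ?rk1.
have [c Hc] := fin_all_exists proportional.
have c_i0 : c i0 = 1.
  move/eqP: (Hc i0); rewrite -{1}[H i0 0]scale1r -subr_eq0 -scalerBl.
  by rewrite scaler_eq0 (negPf H_i0) orbF subr_eq0 => /eqP <-.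
exists (H i0 0), c, i0; split=> // [i|]; first by rewrite mul_mpolyC.
have [tr0 _] := nilpotent_trace_jac H_nil; rewrite -[RHS]tr0.
by apply: eq_bigr => l _; rewrite mxE (Hc l) mderivZ mul_mpolyC.
Qed.

Lemma rkJ1_coordinates k (H : polymap K (1 + k)) : cubic_homogeneous H ->
  nilpotent_mx (jacobian H) -> rkJ H = 1%N ->
  exists2 T, T \in unitmx &
    (lin_conj T H (lshift k 0) 0)^`M(lshift k 0) = 0 /\
    forall j, lin_conj T H (rshift 1 j) 0 = 0.
Proof.
move=> H_cubic H_nil rk1.
have [h [c [i0 [h3 c_i0 Hc tr0]]]] := rkJ1_form H_cubic H_nil rk1.
pose C : 'cV[K]_(1 + k) := \col_l c l.
(* Because c_i0 = 1, the coordinate form of [i0] is dual to c, so c can be made the image of the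
   first basis vector. *)
have AC1 : delta_mx 0 i0 *m C = 1%:M :> 'M_1.
  by apply/matrixP => i j; rewrite !ord1 -rowE !mxE c_i0 eqxx.
have [T Tu [_ TC]] := complete_dual_pair AC1; exists T => //.
have conj_eq i : lin_conj T H i 0 =
    ((col_mx 1%:M 0 : 'cV[K]_(1 + k)) i 0)%:MP * lin_subst T h.
  have -> : col_mx 1%:M 0 = invmx T *m C by rewrite -TC mulKmx.
  rewrite lin_conjE mxE raddf_sum mulr_suml; apply: eq_bigr => j _ /=.
  have -> : C j 0 = c j by rewrite mxE.
  by rewrite Hc rmorphM /= lin_substC mpolyCM mulrA.
split=> [|j]; last by rewrite conj_eq col_mxEd mxE mpolyC0 mul0r.
rewrite conj_eq col_mxEu mxE eqxx mpolyC1 mul1r mderiv_lin_subst.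
transitivity (lin_subst T (\sum_l (c l)%:MP * h^`M(l))); last by rewrite tr0 rmorph0.
rewrite rmorph_sum; apply: eq_bigr => l _ /=; rewrite rmorphM /= lin_substC mulrC.
congr (_%:MP * _); transitivity (C l 0); last by rewrite mxE.
rewrite -TC mxE big_split_ord /= big_ord1 col_mxEu mxE eqxx mulr1 big1 ?addr0 // => q _.
by rewrite col_mxEd mxE mulr0.
Qed.

Lemma rkJ1_triangularizable k (H : polymap K (1 + k)) : cubic_homogeneous H ->
  nilpotent_mx (jacobian H) -> rkJ H = 1%N -> triangularizable H.
Proof.
move=> H_cubic H_nil rk1; have [T Tu [dT0 T0]] := rkJ1_coordinates H_cubic H_nil rk1.
(* Weight 0 for the first index and 1 for all others: the first component avoids its own variable,
   and the others vanish. *)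
exists T => //; exists (fun i => (0 < i)%N : nat) => i j.
case: (splitP i) => q i_eq; last first.
  by have -> : i = rshift 1 q by [apply: val_inj]; rewrite T0 raddf0.
have -> : i = lshift k 0 by apply: val_inj; rewrite /= i_eq ord1.
rewrite ltnn leqn0 eqb0 -eqn0Ngt => /eqP j0.
by have -> : j = lshift k 0 by apply: val_inj.
Qed.

Lemma triangularizable_tame n (H : polymap K n) : cubic_homogeneous H ->
  triangularizable H -> tame (vars + H).
Proof.
move=> H_cubic /triangularizable_upper[T Tu H_upper].
by apply: (tame_lin_conj Tu); apply: tame_strictly_upper => //; apply: cubic_lin_conj.
Qed.

Lemma rkJ2_normal_form k (H : polymap K (2 + k)) : cubic_homogeneous H ->
  nilpotent_mx (jacobian H) -> rkJ H = 2%N ->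
  triangularizable H \/
  exists2 T, T \in unitmx & cubic_normal_form (lin_conj T H).
Proof.
move=> H_cubic H_nil rk2.
have [|[T Tu [T0 formT]]] := rank2_dichotomy char_K H_cubic H_nil rk2; first by left.
have [U Uu nfU] := form_normal_form char_K (cubic_lin_conj T H_cubic) T0 formT.
by right; exists (T *m U); [rewrite unitmx_mul Tu | rewrite -lin_conj_comp].
Qed.

End SmallRank.

Theorem theorem3p4 (K : fieldType) (n : nat) (n_gt0 : (0 < n)%N)
    (char_K : (6%:R : K) \is a GRing.unit)
    (H : polymap K n) (H_cubic : cubic_homogeneous H)
    (JH_nil : nilpotent_mx (jacobian H)) :
  (* (i) *)
  (rkJ H = 1%N ->
   exists2 T : 'M[K]_n, T \in unitmx &
     (forall i : 'I_n, nat_of_ord i = 0%N ->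
        in_vars [pred j : 'I_n | (1 <= j)%N] (lin_conj T H i 0)) /\
     (forall i : 'I_n, (1 <= i)%N -> lin_conj T H i 0 = 0)) /\
  (* (ii) *)
  (rkJ H = 2%N ->
   ~ (exists2 M, similar_over_base (ratmx (jacobian H)) M & triangular M) ->
   exists2 T : 'M[K]_n, T \in unitmx &
   exists i1 i2 i3 i4 : 'I_n,
     [/\ nat_of_ord i1 = 0%N, nat_of_ord i2 = 1%N,
         nat_of_ord i3 = 2%N & nat_of_ord i4 = 3%N] /\
     [/\ in_vars [pred j : 'I_n | (2 <= j)%N]
           (lin_conj T H i1 0 - ('X_i1 * 'X_i3 * 'X_i4 - 'X_i2 * 'X_i4 ^+ 2)),
         in_vars [pred j : 'I_n | (2 <= j)%N]
           (lin_conj T H i2 0 - ('X_i1 * 'X_i3 ^+ 2 - 'X_i2 * 'X_i3 * 'X_i4)) &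
         forall i : 'I_n, (2 <= i)%N -> lin_conj T H i 0 = 0]) /\
  ((rkJ H <= 2)%N -> invertible_map (vars + H)) /\
  (rkJ H = 1%N \/ (rkJ H = 2%N /\ (5 <= n)%N) -> tame (vars + H)).
Proof.
case: n n_gt0 H H_cubic JH_nil => // k _ H H_cubic JH_nil.
have rank1_tame : rkJ H = 1%N -> tame (vars + H).
  by move=> rk1; apply/triangularizable_tame/(@rkJ1_triangularizable K char_K k).
have rank2_nf : rkJ H = 2%N -> triangularizable H \/
    exists2 T, T \in unitmx & cubic_normal_form (lin_conj T H).
  (* A Jacobian of rank 2 has at least two rows, which brings the dimension into the form 2 + k. *)
  move=> rk2; have := rank_leq_row (ratmx (jacobian H)); rewrite -/(rkJ H) rk2.
  case: k H H_cubic JH_nil rk2 {rank1_tame} => // k H H_cubic JH_nil rk2 _.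
  exact: (@rkJ2_normal_form K char_K k).
split; [|split; [|split]].
- move=> rk1; have [T Tu [dT0 T0]] := @rkJ1_coordinates K char_K k H H_cubic JH_nil rk1.
  exists T => //; split=> i.
    move=> i0; have -> : i = lshift k (0 : 'I_1) by apply: val_inj.
    have T3 := cubic_lin_conj T H_cubic (lshift k (0 : 'I_1)).
    have /varfreeP Tfree := deriv0_free char_K (isT : (3 < 5)%N) T3 dT0.
    move=> m m_T j; rewrite /= -eqn0Ngt => /eqP j0.
    have -> : j = lshift k (0 : 'I_1) by apply: val_inj.
    exact: Tfree.
  case: (@splitP 1 k i) => q i_eq; first by rewrite i_eq ord1.
  by have -> : i = rshift 1 q by apply: val_inj.
- move=> rk2 not_tri; case: (rank2_nf rk2) => // tri.
  by case: not_tri; apply: triangularizable_similar.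
- rewrite leq_eqVlt => /predU1P[rk2|]; last first.
    rewrite ltnS leq_eqVlt => /predU1P[rk1|]; first exact/tame_invertible/rank1_tame.
    rewrite ltnS leqn0 => /eqP rk0; rewrite (rkJ0_eq0 char_K H_cubic rk0) addr0.
    exact/tame_invertible/tame_vars.
  case: (rank2_nf rk2) => [tri|[T Tu nfT]].
    exact/tame_invertible/(triangularizable_tame char_K).
  exact/(invertible_lin_conj Tu)/normal_form_invertible.
- case=> [|[rk2 n_ge5]]; first exact: rank1_tame.
  case: (rank2_nf rk2) => [tri|[T Tu nfT]]; first exact: (triangularizable_tame char_K).
  exact/(tame_lin_conj Tu)/normal_form_tame.
Qed.
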